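(* Consider the $L_\infty$ approximation problem ${\rm APP}=\{{\rm APP}_{\infty,d}\}_{d\in\mathbb N}$, ${\rm APP}_{\infty,d}:H(K_{d,\mathbf r,\mathbf g})\to L_\infty([0,1]^d)$, $f\mapsto f$, in the worst case setting, with weights $1\ge g_1\ge g_2\ge\dots>0$ and smoothness $\frac12<r_1\le r_2\le\cdots$. The following hold for $\Lambda^{\rm std}$ and for $\Lambda^{\rm all}$. 1. For ABS or NOR, ALG-SPT holds iff ALG-PT holds iff $\liminf_{j\to\infty}\frac{\ln(1/g_j)}{\ln j}>1$. 2. For NOR, ALG-QPT holds iff $\sup_{d\in\mathbb N}\frac{1}{\ln_+d}\sum_{j=1}^d g_j\ln_+\frac1{g_j}<\infty$. 4. For ABS or NOR, ALG-UWT holds iff $\liminf_{j\to\infty}\frac{\ln(1/g_j)}{\ln j}\ge1$. 5. For ABS or NOR, ALG-$(s,t)$-WT with $s>0$, $t>1$ always holds. 6. For ABS or NOR, ALG-$(s,1)$-WT with $s>0$ holds iff ALG-WT holds iff $\lim_{j\to\infty}g_j=0$. 7. For ABS or NOR, ALG-$(s,t)$-WT with $s>0$ and $0<t<1$ holds iff $\lim_{j\to\infty}j^{1-t}g_j\ln_+\frac1{g_j}=0$.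
   Context: $\ln_+x=\max(1,\ln x)$. $H(K_{d,\mathbf r,\mathbf g})$ is the reproducing kernel Hilbert space of 1-periodic functions on $[0,1]^d$ with kernel $K_{d,\mathbf r,\mathbf g}(\mathbf x,\mathbf y)=\prod_{k=1}^d\big(1+2g_k\sum_{j=1}^\infty j^{-2r_k}\cos(2\pi j(x_k-y_k))\big)$; equivalently $\|f\|^2=\sum_{\mathbf h\in\mathbb Z^d}|\hat f(\mathbf h)|^2\prod_{j:h_j\ne0}g_j^{-1}|h_j|^{2r_j}$, with $\hat f(\mathbf h)=\int_{[0,1]^d}f(\mathbf x)e^{-2\pi i\mathbf h\cdot\mathbf x}d\mathbf x$. $L_\infty$ carries the sup norm. $\Lambda^{\rm all}$: all continuous linear functionals; $\Lambda^{\rm std}$: point evaluations. $e(n,{\rm APP}_{\infty,d};\Lambda)$: infimum over algorithms $A(f)=\phi(L_1f,\dots,L_nf)$, $L_i\in\Lambda$, $\phi$ arbitrary, of $\sup_{\|f\|\le1}\|f-A(f)\|_\infty$; $e(0,{\rm APP}_{\infty,d})=\sup_{\|f\|\le1}\|f\|_\infty$. $n^\star(\varepsilon,d;\Lambda)=\inf\{n\ge0:e(n,{\rm APP}_{\infty,d};\Lambda)\le\varepsilon{\rm CRI}_d\}$ with ${\rm CRI}_d=1$ (ABS) or $e(0,{\rm APP}_{\infty,d})$ (NOR). With $n=n^\star(\varepsilon,d;\Lambda)$, $d\in\mathbb N$, $\varepsilon\in(0,1)$ and limits as $\varepsilon^{-1}+d\to\infty$: ALG-SPT: $\exists C,p$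 with $n\le C\varepsilon^{-p}$; ALG-PT: $n\le Cd^q\varepsilon^{-p}$; ALG-QPT: $n\le C\exp(t(1+\ln d)(1+\ln\varepsilon^{-1}))$; ALG-UWT: $\ln n/(\varepsilon^{-\alpha}+d^\beta)\to0$ for all $\alpha,\beta>0$; ALG-WT: $\ln n/(\varepsilon^{-1}+d)\to0$; ALG-$(s,t)$-WT: $\ln n/(\varepsilon^{-s}+d^t)\to0$. *)

(* Defs.v *)
From HB Require Import structures.
From mathcomp Require Import all_boot all_order all_algebra.
From mathcomp Require Import all_classical all_reals all_analysis.
Set Implicit Arguments. Unset Strict Implicit. Unset Printing Implicit Defensive.
Import Order.TTheory GRing.Theory Num.Theory.
Import numFieldNormedType.Exports.
Local Open Scope classical_set_scope.
Local Open Scope ring_scope.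

(* Points of R^d are functions 'I_d -> R (coordinate k : 'I_d is the
   paper's coordinate k+1).  Multi-indices h in Z^d are {ffun 'I_d -> int}. *)
Definition mindex (d : nat) := {ffun 'I_d -> int}.

Definition upd (R : realType) (d : nat) (x : 'I_d -> R) (k : nat) (t : R)
  : 'I_d -> R := fun i => if val i == k then t else x i.

Fixpoint iint (R : realType) (d : nat) (k : nat) (F : ('I_d -> R) -> R)
  (x : 'I_d -> R) : R :=
  match k with
  | 0 => F x
  | k'.+1 => Rintegral (@lebesgue_measure R) `[0, 1]
               (fun t => iint k' F (upd x k' t))
  end.

(* integral over the unit cube [0,1]^d (iterated; used only for continuous
   integrands, for which it coincides with the d-dimensional Lebesgue integral) *)
Definition cube_int (R : realType) (d : nat) (F : ('I_d -> R) -> R) : R :=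
  iint d F (fun _ => 0).

Definition dotp (R : realType) (d : nat) (h : mindex d) (x : 'I_d -> R) : R :=
  \sum_(k < d) (h k)%:~R * x k.

Definition fc_re (R : realType) (d : nat) (f : ('I_d -> R) -> R) (h : mindex d) : R :=
  cube_int (fun x => f x * cos (2 * pi * dotp h x)).
Definition fc_im (R : realType) (d : nat) (f : ('I_d -> R) -> R) (h : mindex d) : R :=
  - cube_int (fun x => f x * sin (2 * pi * dotp h x)).

Definition weight (R : realType) (g r : nat -> R) (d : nat) (h : mindex d) : R :=
  \prod_(k < d | h k != 0) ((g k.+1)^-1 * (`|(h k)%:~R| : R) `^ (2 * r k.+1)).

Definition hnorm2 (R : realType) (g r : nat -> R) (d : nat) (f : ('I_d -> R) -> R)
  : \bar R :=
  \esum_(h in [set: mindex d])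
     (((fc_re f h) ^+ 2 + (fc_im f h) ^+ 2) * weight g r h)%:E.

Definition unit_cube (R : realType) (d : nat) : set ('I_d -> R) :=
  [set x | forall i, 0 <= x i <= 1].

Definition cont_fun (R : realType) (d : nat) (f : ('I_d -> R) -> R) : Prop :=
  forall x (e : R), 0 < e -> exists2 delta : R, 0 < delta &
    forall y, (forall i, `|x i - y i| < delta) -> `|f x - f y| < e.

Definition periodic1 (R : realType) (d : nat) (f : ('I_d -> R) -> R) : Prop :=
  forall x (i : 'I_d), f (fun j => if j == i then x j + 1 else x j) = f x.

Definition inH (R : realType) (g r : nat -> R) (d : nat) (f : ('I_d -> R) -> R)
  : Prop := [/\ cont_fun f, periodic1 f & (hnorm2 g r f < +oo)%E].

Definition unit_ball (R : realType) (g r : nat -> R) (d : nat) : set (('I_d -> R) -> R) :=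
  [set f | inH g r f /\ (hnorm2 g r f <= 1)%E].

Inductive info_class := Lstd | Lall.

Definition admissible (R : realType) (g r : nat -> R) (d : nat) (Lam : info_class)
  (L : (('I_d -> R) -> R) -> R) : Prop :=
  match Lam with
  | Lstd => exists x : 'I_d -> R, forall f, L f = f x
  | Lall =>
      (forall (a b : R) f1 f2, inH g r f1 -> inH g r f2 ->
          L (fun x => a * f1 x + b * f2 x) = a * L f1 + b * L f2) /\
      exists C : R, forall f, inH g r f -> `|L f| <= C * Num.sqrt (fine (hnorm2 g r f))
  end.

Definition wc_err (R : realType) (g r : nat -> R) (d n : nat)
  (L : 'I_n -> (('I_d -> R) -> R) -> R) (phi : ('I_n -> R) -> ('I_d -> R) -> R)
  : \bar R :=
  ereal_sup [set e | exists (f : ('I_d -> R) -> R) (x : 'I_d -> R),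
      [/\ unit_ball g r f, unit_cube x &
      e = (`|f x - phi (fun i => L i f) x|)%:E]].

Definition init_err (R : realType) (g r : nat -> R) (d : nat) : \bar R :=
  ereal_sup [set e | exists (f : ('I_d -> R) -> R) (x : 'I_d -> R),
      [/\ unit_ball g r f, unit_cube x & e = (`|f x|)%:E]].

Definition nth_err (R : realType) (g r : nat -> R) (Lam : info_class) (n d : nat)
  : \bar R :=
  if n == 0%N then init_err g r d else
  ereal_inf [set e | exists L phi,
     (forall i, admissible g r Lam (L i)) /\ e = @wc_err R g r d n L phi].

Inductive criterion := ABS | NOR.

Definition CRI (R : realType) (g r : nat -> R) (c : criterion) (d : nat) : \bar R :=
  match c with ABS => 1%E | NOR => init_err g r d end.

Definition ncomp (R : realType) (g r : nat -> R) (Lam : info_class) (c : criterion)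
  (eps : R) (d : nat) : \bar R :=
  ereal_inf [set (n%:R)%:E | n in
     [set n : nat | (nth_err g r Lam n d <= eps%:E * CRI g r c d)%E]].

Definition ALG_SPT (R : realType) (g r : nat -> R) (Lam : info_class) (c : criterion)
  : Prop :=
  exists C p : R, forall (d : nat) (eps : R), (0 < d)%N -> 0 < eps < 1 ->
    (ncomp g r Lam c eps d <= (C * eps^-1 `^ p)%:E)%E.

Definition ALG_PT (R : realType) (g r : nat -> R) (Lam : info_class) (c : criterion)
  : Prop :=
  exists C p q : R, forall (d : nat) (eps : R), (0 < d)%N -> 0 < eps < 1 ->
    (ncomp g r Lam c eps d <= (C * d%:R `^ q * eps^-1 `^ p)%:E)%E.

Definition ALG_QPT (R : realType) (g r : nat -> R) (Lam : info_class) (c : criterion)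
  : Prop :=
  exists C t : R, forall (d : nat) (eps : R), (0 < d)%N -> 0 < eps < 1 ->
    (ncomp g r Lam c eps d <=
       (C * expR (t * (1 + ln d%:R) * (1 + ln eps^-1)))%:E)%E.

Definition ALG_stWT (R : realType) (g r : nat -> R) (Lam : info_class) (c : criterion)
  (s t : R) : Prop :=
  forall eta : R, 0 < eta -> exists M : R, forall (d : nat) (eps : R),
    (0 < d)%N -> 0 < eps < 1 -> M < eps^-1 + d%:R ->
    (ncomp g r Lam c eps d < +oo)%E /\
    `|ln (fine (ncomp g r Lam c eps d)) / (eps^-1 `^ s + d%:R `^ t)| <= eta.

Definition ALG_UWT (R : realType) (g r : nat -> R) (Lam : info_class) (c : criterion)
  : Prop :=
  forall alpha beta : R, 0 < alpha -> 0 < beta -> ALG_stWT g r Lam c alpha beta.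

Definition ALG_WT (R : realType) (g r : nat -> R) (Lam : info_class) (c : criterion)
  : Prop := ALG_stWT g r Lam c 1 1.

Definition lnp (R : realType) (x : R) : R := Num.max 1 (ln x).

(* Main.v *)
Require Import Defs.
From HB Require Import structures.
From mathcomp Require Import all_boot all_order all_algebra.
From mathcomp Require Import all_classical all_reals all_analysis.
From mathcomp Require Import ring lra zify.
Import Order.TTheory GRing.Theory Num.Theory.
Import numFieldNormedType.Exports.
Local Open Scope classical_set_scope.
Local Open Scope ring_scope.

(* For real-valued functions the norm of H is diagonal in the Hartley basis
   cas(2 pi h.x) = cos + sin, with eigenvalues mu_h = 1 / weight_h.

   Lower bounds: the functions in the span of finitely many sqrt(mu_h) cas_h that
   n functionals annihilate are the range of a projection of corank n.
   Averaging its reproducing kernel on the diagonal over the cube bounds e(n)^2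
   from below by the sum of the mu_h minus n times the largest; for n = 0 this is
   sharp up to a factor 2.  Upper bounds: a greedy derandomization of Monte Carlo
   estimates the Hartley coefficients on a finite set A of frequencies from N
   function values; truncation costs the square root of the discarded
   eigenvalues, and the estimates cost at most |A| times the square root of the
   eigenvalue sum over N.

   The eigenvalue sums with exponent 1 - s factor over the coordinates, so that
   the logarithm of the complexity is controlled by sums of g_j^(1 - s); taking
   s of order 1 / ln d produces the entropy sum of g_j ln(1 / g_j), while
   Markov's inequality for the normalized eigenvalues shows that this entropy is
   also necessary.  For (strong) polynomial tractability the necessary condition
   comes from counting the products of m of the first d weights. *)

(** Each criterion concerns the logarithm of the complexity or leaves exponents free, so polynomial
    losses, such as the factor |A| of the sampling bound, are harmless. Sampling algorithms
    therefore serve both classes of information, while the lower bound holds for arbitrary linear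
    functionals. Averaging over the cube is compatible with the sup norm because the diagonal of the
    full kernel is constant.

    The initial error is at least 1, so the NOR complexity never exceeds the ABS one: necessary
    conditions are proved for NOR and sufficient ones for ABS, except that QPT has its own upper
    bound for NOR. There the normalization matters: the derivative at s = 0 of ln sum mu^(1 - s) -
    (1 - s) ln sum mu is the Shannon entropy of the normalized eigenvalues. The division by s in the
    exponent of the complexity is then compensated, and g ln(1/g) appears instead of g.

    The admissible s are limited by summability over frequencies, 2 r_1 (1 - s) > 1, which is where
    r_1 > 1/2 enters. *)

(** * Integration over the unit interval *)

Section UnitIntervalIntegral.
Context {R : realType}.
Implicit Types (u v : R -> R).

Definition int01 u : R := Rintegral (@lebesgue_measure R) `[0, 1] u.

Lemma integrable01 u : continuous u ->
  (@lebesgue_measure R).-integrable `[0, 1] (EFin \o u).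
Proof.
move=> cu; apply: continuous_compact_integrable; first exact: segment_compact.
exact: continuous_subspaceT.
Qed.

Lemma int01D u v : continuous u -> continuous v ->
  int01 (fun t => u t + v t) = int01 u + int01 v.
Proof. by move=> cu cv; apply: RintegralD => //; exact: integrable01. Qed.

Lemma int01Z c u : continuous u -> int01 (fun t => c * u t) = c * int01 u.
Proof. by move=> cu; apply: RintegralZl => //; exact: integrable01. Qed.

Lemma le_int01 u v : continuous u -> continuous v ->
  (forall t : R, 0 <= t <= 1 -> u t <= v t) -> int01 u <= int01 v.
Proof.
move=> cu cv uv; apply: le_Rintegral => //; do ?exact: integrable01.
Qed.

Lemma eq_int01 u v : (forall t : R, 0 <= t <= 1 -> u t = v t) -> int01 u = int01 v.
Proof.
by move=> uv; apply: eq_Rintegral => t; rewrite inE /= in_itv /= => /uv.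
Qed.

Lemma int01_cst c : int01 (fun=> c) = c.
Proof.
rewrite /int01 Rintegral_cst//= lebesgue_measure_itv /= lte_fin ltr01.
by rewrite -EFinB /= subr0 mulr1.
Qed.

Lemma int01_dist u v (e : R) : continuous u -> continuous v ->
  (forall t : R, 0 <= t <= 1 -> `|u t - v t| <= e) ->
  `|int01 u - int01 v| <= e.
Proof.
move=> cu cv uv.
have ce : continuous ((fun=> e) : R -> R) by move=> ?; exact: cvg_cst.
have H (a b : R -> R) : continuous a -> continuous b ->
    (forall t : R, 0 <= t <= 1 -> `|a t - b t| <= e) -> int01 a <= int01 b + e.
  move=> ca cb ab; rewrite -[e in leRHS]int01_cst -int01D//.
  apply: le_int01 => // [x|t t01]; first exact: cvgD (cb x) (ce x).
  by have := ab t t01; rewrite ler_norml => /andP[_]; lra.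
have huv := H u v cu cv uv.
have hvu : int01 v <= int01 u + e by apply: H => // t /uv; rewrite distrC.
by rewrite ler_norml; lra.
Qed.

Lemma int01_ge_sub u (a b c : R) : continuous u -> 0 <= a -> a <= b -> b <= 1 ->
  (forall t : R, 0 <= t <= 1 -> 0 <= u t) ->
  (forall t, a <= t <= b -> c <= u t) -> c * (b - a) <= int01 u.
Proof.
move=> cu a0 ab b1 u0 uc.
have iu : (@lebesgue_measure R).-integrable `[a, b] (EFin \o u).
  apply: continuous_compact_integrable; first exact: segment_compact.
  exact: continuous_subspaceT.
have -> : c * (b - a) = Rintegral (@lebesgue_measure R) `[a, b] (fun=> c).
  rewrite Rintegral_cst//= lebesgue_measure_itv /= lte_fin.
  by move: ab; rewrite le_eqVlt => /predU1P[->|->]; rewrite ?ltxx ?subrr// -EFinB.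
apply: (@le_trans _ _ (Rintegral (@lebesgue_measure R) `[a, b] u)).
  apply: le_Rintegral => //.
    apply: continuous_compact_integrable; first exact: segment_compact.
    by apply: continuous_subspaceT => ?; exact: cvg_cst.
rewrite /int01 /Rintegral fine_le//.
- exact: integrable_fin_num.
- by apply: integrable_fin_num => //; exact: integrable01.
apply: ge0_subset_integral => //.
- exact: measurable_int (integrable01 _ cu).
- by move=> t /=; rewrite !in_itv /= => /andP[at_ tb]; rewrite (le_trans a0)// (le_trans tb).
Qed.

Lemma sin2piDz (z : int) (x : R) : sin (x + 2 * pi * z%:~R) = sin x.
Proof.
have E n (y : R) : sin (y + 2 * pi * n%:R) = sin y.
  have -> : 2 * pi * n%:R = (pi *+ 2) *+ n :> R by rewrite -(mulr_natr _ n) -(mulr_natr _ 2); ring.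
  by rewrite (periodicn (@sinD2pi R)).
case: z => n; first exact: E.
by rewrite -[LHS](E n.+1) NegzE mulrNz; congr sin; ring.
Qed.

Lemma cos2piDz (z : int) (x : R) : cos (x + 2 * pi * z%:~R) = cos x.
Proof.
by rewrite -!sinDpihalf addrAC sin2piDz.
Qed.

(** The phase [c] is kept because, when one coordinate of the cube is integrated, the other
    coordinates enter as a constant phase. *)
Lemma int01_cos (m : int) (c : R) :
  int01 (fun t => cos (2 * pi * (m%:~R * t) + c)) = (m == 0)%:R * cos c.
Proof.
have [->|m0] := eqVneq m 0.
  by rewrite mul1r -[RHS]int01_cst; apply: eq_int01 => t _; rewrite mul0r mulr0 add0r.
rewrite mul0r.
have m0' : 2 * pi * m%:~R != 0 :> R.
  by rewrite !mulf_neq0// ?intr_eq0// gt_eqF// pi_gt0.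
pose F t : R := (2 * pi * m%:~R)^-1 * sin (2 * pi * m%:~R * t + c).
have dF (x : R) : is_derive x 1 F (cos (2 * pi * (m%:~R * x) + c)).
  rewrite /F; apply: is_derive_eq.
  by rewrite /GRing.scale /= !mulr1 addr0 mulrCA mulVf ?mulr1 // !mulrA.
rewrite /int01 /Rintegral (@continuous_FTC2 _ _ F) //=.
- rewrite /F mulr1 mulr0 add0r [_ + c]addrC sin2piDz subrr //.
- apply: continuous_subspaceT => x.
  apply: continuous_comp; last exact: continuous_cos.
  apply: cvgD; last exact: cvg_cst.
  by apply: cvgMr; apply: cvgMr.
- split.
  + by move=> x _; exact: ex_derive.
  + apply: cvg_at_right_filter; apply: differentiable_continuous.
    by apply/derivable1_diffP; exact: ex_derive.
  + apply: cvg_at_left_filter; apply: differentiable_continuous.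
    by apply/derivable1_diffP; exact: ex_derive.
- by move=> x _; rewrite derive1E; exact: derive_val.
Qed.

End UnitIntervalIntegral.

(** * Continuous functions of d real variables *)

Section ContinuousFunctions.
Context {R : realType} {d : nat}.
Implicit Types (F G : ('I_d -> R) -> R).

Lemma cont_fun_cst c : cont_fun (fun _ : 'I_d -> R => c).
Proof. by move=> x e e0; exists 1 => // y _; rewrite subrr normr0. Qed.

Lemma cont_fun_coord i : cont_fun (fun x : 'I_d -> R => x i).
Proof. by move=> x e e0; exists e. Qed.

Lemma cont_funD F G : cont_fun F -> cont_fun G -> cont_fun (fun x => F x + G x).
Proof.
move=> cF cG x e e0.
have [a a0 ha] := cF x (e / 2) ltac:(by rewrite divr_gt0).
have [b b0 hb] := cG x (e / 2) ltac:(by rewrite divr_gt0).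
exists (Num.min a b); first by rewrite lt_min a0.
move=> y xy; have -> : F x + G x - (F y + G y) = (F x - F y) + (G x - G y) by ring.
rewrite (le_lt_trans (ler_normD _ _))// [ltRHS]splitr ltrD//.
  by apply: ha => i; have := xy i; rewrite lt_min => /andP[].
by apply: hb => i; have := xy i; rewrite lt_min => /andP[].
Qed.

Lemma cont_fun_comp (u : R -> R) F : continuous u -> cont_fun F ->
  cont_fun (fun x => u (F x)).
Proof.
move=> cu cF x e e0.
have /cvgrPdist_lt/(_ e e0) := cu (F x).
rewrite -nbhs_nearE => /nbhs_ballP[a /= a0 ha].
have [b b0 hb] := cF x a a0.
by exists b => // y /hb xy; apply: ha; rewrite /ball /=.
Qed.

Lemma cont_funZ c F : cont_fun F -> cont_fun (fun x => c * F x).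
Proof. by apply: (cont_fun_comp (fun y => c * y)) => y; apply: cvgMr. Qed.

(** Polarization reduces products to linear combinations of squares, and squaring is a composition
    with a continuous function of one variable. *)
Lemma cont_funM F G : cont_fun F -> cont_fun G -> cont_fun (fun x => F x * G x).
Proof.
move=> cF cG.
have sq (H : ('I_d -> R) -> R) : cont_fun H -> cont_fun (fun x => H x ^+ 2).
  by apply: (cont_fun_comp (fun y => y ^+ 2)); exact: exprn_continuous.
have -> : (fun x => F x * G x) =
    (fun x => 4^-1 * ((F x + G x) ^+ 2 + (-1) * (F x + (-1) * G x) ^+ 2)).
  by apply/funext => x; field.
apply/cont_funZ/cont_funD; first exact/sq/cont_funD.
by apply/cont_funZ/sq/cont_funD => //; exact: cont_funZ.
Qed.

Lemma cont_fun_sum (I : Type) (s : seq I) (F : I -> ('I_d -> R) -> R) :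
  (forall i, cont_fun (F i)) -> cont_fun (fun x => \sum_(i <- s) F i x).
Proof.
move=> cF; elim: s => [|i s ih].
  under eq_fun do rewrite big_nil; exact: cont_fun_cst.
under eq_fun do rewrite big_cons; exact: cont_funD.
Qed.

Lemma cont_fun_line F x k : cont_fun F -> continuous (fun t => F (upd x k t)).
Proof.
move=> cF t; apply/cvgrPdist_lt => e e0.
have [a a0 ha] := cF (upd x k t) e e0.
rewrite -nbhs_nearE; apply/nbhs_ballP; exists a => //= s ts.
apply: ha => i; rewrite /upd; case: ifP => // _.
by rewrite subrr normr0.
Qed.

End ContinuousFunctions.

(** * The iterated integral over the cube *)

Section IteratedIntegral.
Context {R : realType} {d : nat}.
Implicit Types (F G : ('I_d -> R) -> R) (x y : 'I_d -> R).

Lemma iintS k F x : iint k.+1 F x = int01 (fun t => iint k F (upd x k t)).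
Proof. by []. Qed.

Lemma unit_cube_upd x k (t : R) : unit_cube x -> 0 <= t <= 1 ->
  unit_cube (upd x k t).
Proof. by move=> xc t01 i; rewrite /upd; case: ifP. Qed.

(* Tube lemma: continuity at [x] is uniform in the integrated coordinate. *)
Lemma cont_fun_tube F k x (e : R) : cont_fun F -> 0 < e ->
  exists2 delta : R, 0 < delta & forall t y, 0 <= t <= 1 ->
    (forall i, `|x i - y i| < delta) -> `|F (upd x k t) - F (upd y k t)| < e.
Proof.
move=> cF e0.
pose P (delta t : R) := forall y, (forall i, `|x i - y i| < delta) ->
  `|F (upd x k t) - F (upd y k t)| < e.
have /compact_near_coveringP cov : compact `[(0:R), 1] by exact: segment_compact.
have := cov _ (0^'+ : set_system R) P _.
move=> /(_ _ _)[|D /= D0 HD].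
  move=> t _.
  have [a a0 ha] := cF (upd x k t) (e / 2) ltac:(by rewrite divr_gt0).
  exists (ball t a, [set delta | delta < a]).
    split; first exact: nbhsx_ballx.
    exact: nbhs_right_lt.
  move=> [s delta] /= [ts da] y xy.
  have -> : F (upd x k s) - F (upd y k s) =
     (F (upd x k t) - F (upd y k s)) - (F (upd x k t) - F (upd x k s)) by ring.
  rewrite (le_lt_trans (ler_normB _ _))// [ltRHS]splitr ltrD//; apply: ha => i; rewrite /upd; case: ifP => // _.
    exact: lt_trans (xy i) da.
  by rewrite subrr normr0.
exists (D / 2); first by rewrite divr_gt0.
move=> t y t01 xy.
have Dh : 0 < D / 2 by rewrite divr_gt0.
apply: (HD (D / 2)) => //=; rewrite ?in_itv//=.
by rewrite sub0r normrN gtr0_norm// ltr_pdivrMr// ltr_pMr// ltr1n.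
Qed.

Lemma cont_fun_int01 F k : cont_fun F ->
  cont_fun (fun x => int01 (fun t => F (upd x k t))).
Proof.
move=> cF x e e0.
have [delta d0 hd] := cont_fun_tube F k x (e / 2) cF ltac:(by rewrite divr_gt0).
exists delta => // y xy.
rewrite (@le_lt_trans _ _ (e / 2)) ?ltr_pdivrMr ?ltr_pMr ?ltr1n//.
apply: int01_dist; [exact: cont_fun_line|exact: cont_fun_line|].
by move=> t t01; apply/ltW/hd.
Qed.

Lemma cont_fun_iint k F : cont_fun F -> cont_fun (iint k F).
Proof. by move=> cF; elim: k => //= k; exact: cont_fun_int01. Qed.

Lemma iintD k F G x : cont_fun F -> cont_fun G ->
  iint k (fun x => F x + G x) x = iint k F x + iint k G x.
Proof.
move=> cF cG; elim: k x => // k ih x; rewrite !iintS.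
under [int01 _ in LHS]eq_int01 do rewrite ih.
by rewrite int01D//; apply: cont_fun_line; exact: cont_fun_iint.
Qed.

Lemma iintZ k c F x : cont_fun F ->
  iint k (fun x => c * F x) x = c * iint k F x.
Proof.
move=> cF; elim: k x => // k ih x; rewrite !iintS.
under [int01 _ in LHS]eq_int01 do rewrite ih.
by rewrite int01Z//; apply: cont_fun_line; exact: cont_fun_iint.
Qed.

Lemma iint_cst k c x : iint k (fun=> c) x = c.
Proof.
elim: k x => // k ih x; rewrite iintS.
by under eq_int01 do rewrite ih; rewrite int01_cst.
Qed.

Lemma le_iint k F G x : cont_fun F -> cont_fun G -> unit_cube x ->
  (forall x, unit_cube x -> F x <= G x) -> iint k F x <= iint k G x.
Proof.
move=> cF cG + FG; elim: k x => [|k ih] x xc; first exact: FG.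
rewrite !iintS; apply: le_int01.
- by apply: cont_fun_line; exact: cont_fun_iint.
- by apply: cont_fun_line; exact: cont_fun_iint.
- by move=> t t01; apply: ih; exact: unit_cube_upd.
Qed.

Lemma unit_cube0 : unit_cube (fun _ : 'I_d => 0 : R).
Proof. by move=> i; rewrite lexx ler01. Qed.

Lemma cube_intD F G : cont_fun F -> cont_fun G ->
  cube_int (fun x => F x + G x) = cube_int F + cube_int G.
Proof. exact: iintD. Qed.

Lemma cube_intZ c F : cont_fun F -> cube_int (fun x => c * F x) = c * cube_int F.
Proof. exact: iintZ. Qed.

Lemma cube_int_cst c : cube_int (fun _ : 'I_d -> R => c) = c.
Proof. exact: iint_cst. Qed.

Lemma cube_int_sum (I : Type) (s : seq I) (F : I -> ('I_d -> R) -> R) :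
  (forall i, cont_fun (F i)) ->
  cube_int (fun x => \sum_(i <- s) F i x) = \sum_(i <- s) cube_int (F i).
Proof.
move=> cF; elim: s => [|i s ih].
  under [X in cube_int X]eq_fun do rewrite big_nil; by rewrite cube_int_cst big_nil.
under [X in cube_int X]eq_fun do rewrite big_cons.
by rewrite cube_intD ?ih ?big_cons//; exact: cont_fun_sum.
Qed.

Lemma le_cube_int F G : cont_fun F -> cont_fun G ->
  (forall x, unit_cube x -> F x <= G x) -> cube_int F <= cube_int G.
Proof. by move=> cF cG; apply: le_iint => //; exact: unit_cube0. Qed.

Lemma cube_int_le_cst F c : cont_fun F ->
  (forall x, unit_cube x -> F x <= c) -> cube_int F <= c.
Proof.
by move=> cF Fc; rewrite -[leRHS]cube_int_cst; apply: le_cube_int => //; exact: cont_fun_cst.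
Qed.

(* The slack avoids any appeal to strict monotonicity of the integral. *)
Lemma cube_int_mean F (e : R) : cont_fun F -> 0 < e ->
  exists2 x, unit_cube x & F x <= cube_int F + e.
Proof.
move=> cF e0; apply: contrapT => H.
suff : cube_int F + e <= cube_int F by rewrite gerDl leNgt e0.
rewrite -[leLHS]cube_int_cst; apply: le_cube_int => //; first exact: cont_fun_cst.
move=> x xc; rewrite leNgt; apply/negP => /ltW Fx; apply: H; by exists x.
Qed.

Lemma dotp_upd (h : mindex d) x (k : 'I_d) (t : R) :
  dotp h (upd x k t) = (h k)%:~R * t + (dotp h x - (h k)%:~R * x k).
Proof.
rewrite /dotp (bigD1 k)//= [\sum_(_ < _) _ * x _](bigD1 k)//= /upd eqxx.
rewrite [X in _ + (X - _)]addrC addrK; congr (_ + _).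
by apply: eq_bigr => i /negPf ik; rewrite (_ : (i == k :> nat) = false)//.
Qed.

Lemma cont_fun_dotp (h : mindex d) : cont_fun (dotp (R := R) h).
Proof. by apply: cont_fun_sum => i; apply: cont_funZ; exact: cont_fun_coord. Qed.

Lemma cont_fun_cos_dotp (h : mindex d) (c : R) :
  cont_fun (fun x => cos (2 * pi * dotp h x + c)).
Proof.
apply: cont_fun_comp; first exact: continuous_cos.
apply: cont_funD; last exact: cont_fun_cst.
by apply: cont_funZ; exact: cont_fun_dotp.
Qed.

(** If the indicator is 1, the frequencies of the integrated coordinates vanish and the cosine does
    not depend on those coordinates; this is why the right side may still be evaluated at the
    original [x]. *)
Lemma iint_cos (h : mindex d) k x (c : R) : (k <= d)%N ->
  iint k (fun x => cos (2 * pi * dotp h x + c)) x =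
  [forall i : 'I_d, (i < k)%N ==> (h i == 0)]%:R * cos (2 * pi * dotp h x + c).
Proof.
elim: k x => [|k ih] x kd.
  by rewrite (_ : [forall i, _] = true) ?mul1r//; apply/forallP => i; rewrite ltn0.
pose i0 := Ordinal kd.
rewrite iintS (eq_int01 _ (fun t => [forall i : 'I_d, (i < k)%N ==> (h i == 0)]%:R *
    cos (2 * pi * ((h i0)%:~R * t) + (2 * pi * (dotp h x - (h i0)%:~R * x i0) + c)))); last first.
  by move=> t _; rewrite ih ?(ltnW kd)// -[k]/(val i0) dotp_upd mulrDr -addrA.
rewrite int01Z; last first.
  move=> t; apply: continuous_comp; last exact: continuous_cos.
  apply: cvgD; last exact: cvg_cst.
  by apply: cvgMr; apply: cvgMr.
rewrite int01_cos mulrA.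
have -> : [forall i : 'I_d, (i < k.+1)%N ==> (h i == 0)] =
    [forall i : 'I_d, (i < k)%N ==> (h i == 0)] && (h i0 == 0).
  apply/forallP/andP => [H|[/forallP H1 H2] i].
    split; last by have := H i0; rewrite /= ltnSn.
    by apply/forallP => i; apply/implyP => ik; have := H i; rewrite ltnS (ltnW ik).
  apply/implyP; rewrite ltnS leq_eqVlt => /orP[/eqP ik|]; last by apply/implyP.
  by rewrite (_ : i = i0)//; apply: val_inj.
have [h0|_] := eqVneq (h i0) 0; last by rewrite andbF !mulr0 !mul0r.
by rewrite h0 andbT mulr1 mul0r subr0.
Qed.

Lemma cube_int_cos (h : mindex d) (c : R) :
  cube_int (fun x => cos (2 * pi * dotp h x + c)) = (h == 0)%:R * cos c.
Proof.
rewrite /cube_int iint_cos// (_ : dotp _ _ = 0); last first.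
  by rewrite /dotp big1// => i _; rewrite mulr0.
rewrite mulr0 add0r; congr (_%:R * _); congr nat_of_bool.
apply/forallP/eqP => [H|-> i]; last by rewrite ffunE eqxx implybT.
by apply/ffunP => i; rewrite ffunE; apply/eqP; have := H i; rewrite ltn_ord.
Qed.

End IteratedIntegral.

(** * The Hartley basis and its coefficients *)

Section HartleyBasis.
Context {R : realType} {d : nat}.
Implicit Types (F G f : ('I_d -> R) -> R) (x y : 'I_d -> R) (h l : mindex d).

(* The Hartley functions [cas] form a real orthonormal basis indexed by all of
   Z^d, which avoids pairing the frequencies [h] and [- h]. *)
Definition cas h x : R := cos (2 * pi * dotp h x) + sin (2 * pi * dotp h x).

Definition hcoef f h : R := cube_int (fun x => f x * cas h x).

Lemma dotpD h l x : dotp (h + l) x = dotp h x + dotp l x.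
Proof.
by rewrite /dotp -big_split; apply: eq_bigr => i _; rewrite ffunE rmorphD mulrDl.
Qed.

Lemma dotpN h x : dotp (- h) x = - dotp h x.
Proof.
by rewrite /dotp -sumrN; apply: eq_bigr => i _; rewrite ffunE rmorphN mulNr.
Qed.

(** The second cosine is the sine of the sum, written with a phase so that [cube_int_cos] applies to
    both terms; it integrates to 0 even when [h + l = 0], which gives orthonormality for all
    pairs. *)
Lemma casM h l x : cas h x * cas l x =
  cos (2 * pi * dotp (h - l) x + 0) + cos (2 * pi * dotp (h + l) x + - (pi / 2)).
Proof.
rewrite /cas addr0 cosBpihalf !dotpD dotpN !mulrDr mulrN cosB sinD; ring.
Qed.

Lemma cas_sqr_le2 h x : cas h x ^+ 2 <= 2.
Proof.
rewrite /cas; set c := cos _; set s := sin _.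
have : c ^+ 2 + s ^+ 2 = 1 by exact: cos2Dsin2.
have := sqr_ge0 (c - s); nra.
Qed.

Lemma norm_cas_le h x : `|cas h x| <= Num.sqrt 2.
Proof.
by rewrite -(ler_pXn2r (ltn0Sn 1)) ?nnegrE// -normrX ger0_norm ?sqr_ge0// sqr_sqrtr// cas_sqr_le2.
Qed.

Lemma cont_fun_cas h : cont_fun (cas h).
Proof.
have -> : cas h = fun x => cos (2 * pi * dotp h x + 0) +
    cos (2 * pi * dotp h x + - (pi / 2)).
  by apply/funext => x; rewrite addr0 cosBpihalf.
by apply: cont_funD; exact: cont_fun_cos_dotp.
Qed.

Lemma cas_orthonormal h l : cube_int (fun x => cas h x * cas l x) = (h == l)%:R.
Proof.
under [X in cube_int X]eq_fun do rewrite casM.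
rewrite cube_intD; [|exact: cont_fun_cos_dotp|exact: cont_fun_cos_dotp].
by rewrite !cube_int_cos cosN cos_pihalf mulr0 addr0 cos0 mulr1 subr_eq0.
Qed.

Lemma hcoefD f F h : cont_fun f -> cont_fun F ->
  hcoef (fun x => f x + F x) h = hcoef f h + hcoef F h.
Proof.
move=> cf cF; rewrite /hcoef; under [X in cube_int X]eq_fun do rewrite mulrDl.
by rewrite cube_intD//; apply: cont_funM => //; exact: cont_fun_cas.
Qed.

Lemma hcoefZ c f h : cont_fun f -> hcoef (fun x => c * f x) h = c * hcoef f h.
Proof.
move=> cf; rewrite /hcoef; under [X in cube_int X]eq_fun do rewrite -mulrA.
by rewrite cube_intZ//; apply: cont_funM => //; exact: cont_fun_cas.
Qed.

Definition trigpoly (A : seq (mindex d)) (c : mindex d -> R) x : R :=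
  \sum_(h <- A) c h * cas h x.

Lemma cont_fun_trigpoly A c : cont_fun (trigpoly A c).
Proof. by apply: cont_fun_sum => h; apply: cont_funZ; exact: cont_fun_cas. Qed.

Lemma hcoef_trigpoly A c h : uniq A ->
  hcoef (trigpoly A c) h = if h \in A then c h else 0.
Proof.
move=> uA; rewrite /hcoef /trigpoly.
under [X in cube_int X]eq_fun do rewrite big_distrl.
rewrite cube_int_sum; last first.
  move=> l; apply: cont_funM; last exact: cont_fun_cas.
  by apply: cont_funZ; exact: cont_fun_cas.
have -> : \sum_(l <- A) cube_int (fun x => c l * cas l x * cas h x) =
    \sum_(l <- A) c l * (l == h)%:R.
  apply: eq_bigr => l _; under [X in cube_int X]eq_fun do rewrite -mulrA.
  rewrite cube_intZ ?cas_orthonormal//.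
  by apply: cont_funM; exact: cont_fun_cas.
case: ifPn => hA.
  rewrite (bigD1_seq h)//= eqxx mulr1 big1 ?addr0// => l /negPf ->.
  by rewrite mulr0.
rewrite big_seq big1// => l lA; have [lh|] := eqVneq l h; last by rewrite mulr0.
by move: hA; rewrite -lh lA.
Qed.

Lemma periodic1_cas h : periodic1 (cas h).
Proof.
move=> x i; rewrite /cas.
have -> : dotp h (fun j => if j == i then x j + 1 else x j) = dotp h x + (h i)%:~R.
  rewrite /dotp (bigD1 i)//= [\sum_(_ < _) _ * x _](bigD1 i)//= eqxx mulrDr mulr1.
  rewrite [RHS]addrAC; congr (_ + _).
  by apply: eq_bigr => j /negPf ->.
by rewrite mulrDr cos2piDz sin2piDz.
Qed.

Lemma periodic1_trigpoly A c : periodic1 (trigpoly A c).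
Proof. by move=> x i; apply: eq_bigr => h _; rewrite periodic1_cas. Qed.

Lemma hcoefE f h : cont_fun f -> hcoef f h = fc_re f h - fc_im f h.
Proof.
move=> cf; rewrite /fc_re /fc_im opprK -cube_intD.
- by congr cube_int; apply/funext => x; rewrite -mulrDr.
- apply: cont_funM => //; apply: cont_fun_comp; first exact: continuous_cos.
  by apply: cont_funZ; exact: cont_fun_dotp.
- apply: cont_funM => //; apply: cont_fun_comp; first exact: continuous_sin.
  by apply: cont_funZ; exact: cont_fun_dotp.
Qed.

Lemma hcoefN f h : cont_fun f -> hcoef f (- h) = fc_re f h + fc_im f h.
Proof.
move=> cf; rewrite hcoefE//; congr (_ + _).
  by rewrite /fc_re; congr cube_int; apply/funext => x; rewrite dotpN mulrN cosN.
rewrite {1}/fc_im opprK /fc_im -[RHS]mulN1r -cube_intZ.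
  by congr cube_int; apply/funext => x; rewrite dotpN mulrN sinN; ring.
apply: cont_funM => //; apply: cont_fun_comp; first exact: continuous_sin.
by apply: cont_funZ; exact: cont_fun_dotp.
Qed.

End HartleyBasis.

(** * The norm of H in Hartley coefficients *)

Section HilbertNorm.
Context {R : realType} {d : nat} {g r : nat -> R}.
Hypothesis g_gt0 : forall j : nat, (0 < j)%N -> 0 < g j.
Implicit Types (f : ('I_d -> R) -> R) (h l : mindex d).

Lemma weight_gt0 h : 0 < weight g r h.
Proof.
apply: prodr_gt0 => k hk; rewrite mulr_gt0 ?invr_gt0 ?g_gt0// powR_gt0//.
by rewrite normr_gt0 intr_eq0.
Qed.

Lemma weight_ge0 h : 0 <= weight g r h.
Proof. exact/ltW/weight_gt0. Qed.

Lemma weightN h : weight g r (- h) = weight g r h.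
Proof.
rewrite /weight; apply: eq_big => [k|k _]; first by rewrite ffunE oppr_eq0.
by rewrite ffunE rmorphN normrN.
Qed.

(** The Hartley coefficients at [h] and [- h] are the difference and the sum of the real and
    imaginary parts, so their squares average to the squared modulus of the Fourier coefficient.
    Since the weight is even, reindexing by [- h] gives the claim. *)
Lemma hnorm2E f : cont_fun f -> hnorm2 g r f =
  \esum_(h in [set: mindex d]) ((hcoef f h) ^+ 2 * weight g r h)%:E.
Proof.
move=> cf; rewrite /hnorm2.
pose a h := ((hcoef f h) ^+ 2 * weight g r h / 2)%:E.
have a0 h : (0 <= a h)%E.
  rewrite /a lee_fin; apply: divr_ge0 => //; apply: mulr_ge0; [exact: sqr_ge0|exact: weight_ge0].
have aN : \esum_(h in [set: mindex d]) a h = \esum_(h in [set: mindex d]) a (- h).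
  apply: reindex_esum; split=> [h _ //|h l _ _|h _]; first exact: oppr_inj.
  by exists (- h) => //; rewrite opprK.
transitivity (\esum_(h in [set: mindex d]) (a h + a (- h)%R))%E.
  apply: eq_esum => h _; rewrite -EFinD hcoefN// hcoefE// weightN.
  by congr EFin; field.
rewrite esumD// -aN -esumD//; apply: eq_esum => h _.
by rewrite -EFinD -splitr.
Qed.

Lemma le_hnorm2 f (A : seq (mindex d)) : cont_fun f -> uniq A ->
  ((\sum_(h <- A) (hcoef f h) ^+ 2 * weight g r h)%:E <= hnorm2 g r f)%E.
Proof.
move=> cf uA; rewrite hnorm2E//; apply: esum_ge; exists [set` A].
  by split=> //; exact: finite_seq.
by rewrite -fsbig_seq// sumEFin.
Qed.

Lemma hnorm2_trigpoly (A : seq (mindex d)) (c : mindex d -> R) : uniq A ->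
  hnorm2 g r (trigpoly A c) = (\sum_(h <- A) (c h) ^+ 2 * weight g r h)%:E.
Proof.
move=> uA; rewrite hnorm2E; last exact: cont_fun_trigpoly.
transitivity (\esum_(h in [set` A]) ((c h) ^+ 2 * weight g r h)%:E).
  rewrite [RHS]esum_mkcond; apply: eq_esum => h _.
  rewrite hcoef_trigpoly// mem_setE.
  by case: ifP => //; rewrite expr0n mul0r.
rewrite esum_fset; last 2 first.
- exact: finite_seq.
- by move=> h _; rewrite lee_fin mulr_ge0 ?sqr_ge0 ?weight_ge0.
by rewrite -fsbig_seq// sumEFin.
Qed.

Lemma inH_trigpoly (A : seq (mindex d)) (c : mindex d -> R) : uniq A ->
  inH g r (trigpoly A c).
Proof.
move=> uA; split; [exact: cont_fun_trigpoly|exact: periodic1_trigpoly|].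
by rewrite hnorm2_trigpoly// ltry.
Qed.

End HilbertNorm.

(** * Cauchy-Schwarz and sums over subsets *)

Section FiniteSums.
Context {R : realType}.

Lemma cauchy_schwarz_sum (I : Type) (s : seq I) (a b : I -> R) :
  (\sum_(i <- s) a i * b i) ^+ 2 <=
  (\sum_(i <- s) a i ^+ 2) * (\sum_(i <- s) b i ^+ 2).
Proof.
elim: s => [|i s ih]; first by rewrite !big_nil expr0n mul0r.
rewrite !big_cons; move: ih.
have : 0 <= \sum_(j <- s) a j ^+ 2 by apply: sumr_ge0 => j _; exact: sqr_ge0.
have : 0 <= \sum_(j <- s) b j ^+ 2 by apply: sumr_ge0 => j _; exact: sqr_ge0.
set S := \sum_(j <- s) _ * _; set A := \sum_(j <- s) a _ ^+ 2.
set B := \sum_(j <- s) b _ ^+ 2; move: (a i) (b i) => x y B0 A0 SAB.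
suff : 2 * (S * (x * y)) <= A * y ^+ 2 + B * x ^+ 2 by nra.
have Q0 : 0 <= A * y ^+ 2 + B * x ^+ 2.
  by rewrite addr_ge0// mulr_ge0// sqr_ge0.
have [P0|P0] := lerP (2 * (S * (x * y))) 0; first exact: le_trans Q0.
rewrite -(ler_pXn2r (ltn0Sn 1)) ?nnegrE// ?(ltW P0)//.
apply: (@le_trans _ _ (4 * (A * B) * (x * y) ^+ 2)).
  have := sqr_ge0 (x * y); nra.
rewrite -subr_ge0 (_ : _ - _ = (A * y ^+ 2 - B * x ^+ 2) ^+ 2) ?sqr_ge0//; ring.
Qed.

Lemma big_subset (I : eqType) (A B : seq I) (F : I -> R) :
  uniq A -> uniq B -> {subset A <= B} ->
  \sum_(i <- B | i \in A) F i = \sum_(i <- A) F i.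
Proof.
move=> uA uB AB; rewrite -big_filter; apply: perm_big; apply: uniq_perm => //.
  exact: filter_uniq.
by move=> i; rewrite mem_filter; case: (boolP (i \in A)) => // /AB ->.
Qed.

Lemma big_subset_if (I : eqType) (A B : seq I) (F : I -> R) :
  uniq A -> uniq B -> {subset A <= B} ->
  \sum_(i <- B) (if i \in A then F i else 0) = \sum_(i <- A) F i.
Proof. by move=> uA uB AB; rewrite -big_mkcond big_subset. Qed.

Lemma le_sum_subset (I : eqType) (A B : seq I) (F : I -> R) :
  uniq A -> uniq B -> {subset A <= B} -> (forall i, 0 <= F i) ->
  \sum_(i <- A) F i <= \sum_(i <- B) F i.
Proof.
move=> uA uB AB F0; rewrite -(big_subset _ _ _ _ uA uB AB) big_mkcond.
by apply: ler_sum => i _; case: ifP.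
Qed.

End FiniteSums.

(** * The algebra of trigonometric polynomials *)

Section TrigonometricPolynomials.
Context {R : realType} {d : nat}.
Implicit Types (P Q : ('I_d -> R) -> R) (h l : mindex d).

(** Closure under products admits tensor product kernels, and integrating a function against a
    member involves only finitely many of its Hartley coefficients. *)
Definition is_trigpoly P := exists A c, uniq A /\ P = trigpoly A c.

Lemma is_trigpolyD P Q : is_trigpoly P -> is_trigpoly Q ->
  is_trigpoly (fun x => P x + Q x).
Proof.
move=> [A [a [uA ->]]] [B [b [uB ->]]].
exists (undup (A ++ B)), (fun h => (if h \in A then a h else 0) +
  (if h \in B then b h else 0)); split; first exact: undup_uniq.
apply/funext => x; rewrite /trigpoly.
have uAB := undup_uniq (A ++ B).
rewrite -(big_subset_if _ A (undup (A ++ B)))//; last first.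
  by move=> h hA; rewrite mem_undup mem_cat hA.
rewrite -(big_subset_if _ B (undup (A ++ B)))//; last first.
  by move=> h hA; rewrite mem_undup mem_cat hA orbT.
rewrite -big_split; apply: eq_bigr => h _ /=; rewrite mulrDl.
by case: ifP; case: ifP; rewrite ?mul0r.
Qed.

Lemma is_trigpolyZ k P : is_trigpoly P -> is_trigpoly (fun x => k * P x).
Proof.
move=> [A [a [uA ->]]]; exists A, (fun h => k * a h); split=> //.
by apply/funext => x; rewrite /trigpoly mulr_sumr; apply: eq_bigr => h _; rewrite mulrA.
Qed.

Lemma is_trigpoly0 : is_trigpoly (fun=> 0).
Proof.
by exists [::], (fun=> 0); split=> //; apply/funext => x; rewrite /trigpoly big_nil.
Qed.

Lemma is_trigpoly_sum (I : Type) (s : seq I) (P : I -> ('I_d -> R) -> R) :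
  (forall i, is_trigpoly (P i)) -> is_trigpoly (fun x => \sum_(i <- s) P i x).
Proof.
move=> tP; elim: s => [|i s ih].
  under eq_fun do rewrite big_nil; exact: is_trigpoly0.
under eq_fun do rewrite big_cons; exact: is_trigpolyD.
Qed.

Lemma is_trigpoly_cas h : is_trigpoly (cas h).
Proof.
exists [:: h], (fun=> 1); split=> //.
by apply/funext => x; rewrite /trigpoly big_seq1 mul1r.
Qed.

Lemma is_trigpoly_cos h c : is_trigpoly (fun x => cos (2 * pi * dotp h x + c)).
Proof.
have -> : (fun x => cos (2 * pi * dotp h x + c)) =
    (fun x => (cos c - sin c) / 2 * cas h x + (cos c + sin c) / 2 * cas (- h) x).
  by apply/funext => x; rewrite /cas dotpN mulrN cosN sinN cosD; field.
by apply: is_trigpolyD; apply: is_trigpolyZ; exact: is_trigpoly_cas.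
Qed.

Lemma is_trigpolyM P Q : is_trigpoly P -> is_trigpoly Q ->
  is_trigpoly (fun x => P x * Q x).
Proof.
move=> [A [a [uA ->]]] [B [b [uB ->]]]; rewrite /trigpoly.
under eq_fun do rewrite mulr_suml; apply: is_trigpoly_sum => h.
under eq_fun do rewrite mulr_sumr; apply: is_trigpoly_sum => l.
under eq_fun do rewrite mulrACA casM; apply: is_trigpolyZ.
by apply: is_trigpolyD; exact: is_trigpoly_cos.
Qed.

Lemma is_trigpoly_cst c : is_trigpoly (fun=> c).
Proof.
have -> : (fun _ : 'I_d -> R => c) = (fun x => c * cas 0 x).
  apply/funext => x; rewrite /cas (_ : dotp 0 x = 0) ?mulr0 ?cos0 ?sin0 ?addr0 ?mulr1//.
  by rewrite /dotp big1// => i _; rewrite ffunE mul0r.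
by apply: is_trigpolyZ; exact: is_trigpoly_cas.
Qed.

Lemma is_trigpolyX P n : is_trigpoly P -> is_trigpoly (fun x => P x ^+ n).
Proof.
move=> tP; elim: n => [|n ih]; first exact: is_trigpoly_cst.
by under eq_fun do rewrite exprS; exact: is_trigpolyM.
Qed.

Lemma is_trigpoly_prod (I : Type) (s : seq I) (P : I -> ('I_d -> R) -> R) :
  (forall i, is_trigpoly (P i)) -> is_trigpoly (fun x => \prod_(i <- s) P i x).
Proof.
move=> tP; elim: s => [|i s ih].
  under eq_fun do rewrite big_nil; exact: is_trigpoly_cst.
under eq_fun do rewrite big_cons; exact: is_trigpolyM.
Qed.

Lemma is_trigpoly_coord (i : 'I_d) (c : R) :
  is_trigpoly (fun x => cos (2 * pi * (x i - c))).
Proof.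
have -> : (fun x : 'I_d -> R => cos (2 * pi * (x i - c))) = (fun x =>
    cos (2 * pi * dotp [ffun j => (j == i)%:R] x + - (2 * pi * c))).
  apply/funext => x; rewrite mulrBr; congr (cos (_ * _ - _)).
  rewrite /dotp (bigD1 i)//= ffunE eqxx mul1r big1 ?addr0// => j /negPf ji.
  by rewrite ffunE ji mul0r.
exact: is_trigpoly_cos.
Qed.

End TrigonometricPolynomials.

(** * A concentrating kernel in one variable *)

Section ConcentratedKernel.
Context {R : realType}.

(* The mass of (1 + cos 2 pi (t - x0))^n concentrates at x0 as n grows. *)
Definition cos_kernel (x0 c : R) (n : nat) (t : R) : R :=
  c * (1 + cos (2 * pi * (t - x0))) ^+ n.

Lemma continuous_cos_kernel x0 c n : continuous (cos_kernel x0 c n).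
Proof.
have h1 : continuous (fun t : R => 1 + cos (2 * pi * (t - x0))).
  move=> t; apply: cvgD; first exact: cvg_cst.
  apply: continuous_comp; last exact: continuous_cos.
  by apply: cvgMr; apply: cvgB; [exact: cvg_id|exact: cvg_cst].
move=> t; apply: cvgMr.
have := @continuous_comp _ _ _ _ (fun y : R => y ^+ n) t (h1 t).
by apply; exact: exprn_continuous.
Qed.

Lemma cos_far (a delta : R) : 0 <= delta -> delta <= a -> a <= 1 - delta ->
  cos (2 * pi * a) <= cos (2 * pi * delta).
Proof.
move=> d0 da ad; have p0 := pi_gt0 R.
have mono b : delta <= b -> b <= 1 / 2 -> cos (2 * pi * b) <= cos (2 * pi * delta).
  move=> db b2; rewrite leNgt ltr_cos -?leNgt ?in_itv/=; try nra.
have [a2|a2] := lerP a (1 / 2); first exact: mono.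
have -> : 2 * pi * a = pi *+ 2 - 2 * pi * (1 - a) by rewrite -mulr_natr; ring.
rewrite -cosN opprB -[cos (_ - _)](@cosD2pi R) subrK; apply: mono; lra.
Qed.

(** The base [1 + cos] is at most [v1] at distance [delta] and at least [v2 > v1] within
    [delta / 2]; the integral of the n-th power is thus at least [delta v2^n], and the normalized
    kernel is at most [(v1 / v2)^n / delta] far away. Keeping [x0] at distance [delta] from both
    ends prevents the periodic copy of the peak from entering [0, 1]. *)
Lemma cos_kernel_exists (x0 delta eta : R) : 0 < delta -> delta <= x0 ->
  x0 <= 1 - delta -> 0 < eta ->
  exists c n, [/\ 0 <= c, int01 (cos_kernel x0 c n) = 1 &
    forall t, 0 <= t <= 1 -> delta <= `|t - x0| -> cos_kernel x0 c n t <= eta].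
Proof.
move=> d0 dx xd eta0; have p0 := pi_gt0 R.
pose u (t : R) := 1 + cos (2 * pi * (t - x0)).
pose v1 : R := 1 + cos (2 * pi * delta).
pose v2 : R := 1 + cos (2 * pi * (delta / 2)).
have u0 t : 0 <= u t by rewrite /u; have := cos_geN1 (2 * pi * (t - x0)); lra.
have v10 : 0 <= v1 by rewrite /v1; have := cos_geN1 (2 * pi * delta); lra.
have v12 : v1 < v2.
  rewrite /v1 /v2 ltrD2l ltr_cos ?in_itv/=; nra.
have v20 : 0 < v2 by exact: le_lt_trans v12.
have normE t : cos (2 * pi * (t - x0)) = cos (2 * pi * `|t - x0|).
  by rewrite -cos_norm normrM gtr0_norm// mulr_gt0.
have [n hn] : exists n, (v1 / v2) ^+ n <= eta * delta.
  have q1 : `|v1 / v2| < 1 by rewrite ger0_norm ?divr_ge0 ?(ltW v20)// ltr_pdivrMr// mul1r.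
  have /cvgrPdist_lt/(_ (eta * delta) (mulr_gt0 eta0 d0)) := cvg_expr q1.
  move=> [N _ /(_ N (leqnn N))]; rewrite sub0r normrN => h.
  by exists N; rewrite (le_trans (ler_norm _))// ltW.
pose I0 := int01 (cos_kernel x0 1 n).
have I0ge : v2 ^+ n * delta <= I0.
  have -> : delta = (x0 + delta / 2) - (x0 - delta / 2) by field.
  apply: int01_ge_sub; [exact: continuous_cos_kernel|lra|lra|lra|..].
    by move=> t _; rewrite /cos_kernel mul1r exprn_ge0.
  move=> t ht; rewrite /cos_kernel mul1r lerXn2r ?nnegrE ?(ltW v20)//.
  rewrite /v2 lerD2l normE leNgt ltr_cos -?leNgt ?in_itv/=.
  - by rewrite ler_wpM2l ?mulr_ge0 ?(ltW p0)// ler_norml; lra.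
  - by apply/andP; split; nra.
  have : `|t - x0| <= delta / 2 by rewrite ler_norml; lra.
  have := normr_ge0 (t - x0); nra.
have I0gt : 0 < I0 by apply: lt_le_trans I0ge; rewrite mulr_gt0 ?exprn_gt0.
exists I0^-1, n; split.
- by rewrite invr_ge0 ltW.
- have -> : cos_kernel x0 I0^-1 n = fun t => I0^-1 * cos_kernel x0 1 n t.
    by apply/funext => t; rewrite /cos_kernel mul1r.
  by rewrite int01Z ?mulVf ?gt_eqF//; exact: continuous_cos_kernel.
move=> t t01 tx; rewrite /cos_kernel mulrC ler_pdivrMr//.
apply: (@le_trans _ _ (v1 ^+ n)).
  rewrite lerXn2r ?nnegrE ?u0//.
  rewrite lerD2l normE cos_far//; first exact: ltW.
  by rewrite ler_norml; lra.
apply: (@le_trans _ _ (eta * (v2 ^+ n * delta))); last by rewrite ler_wpM2l// ltW.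
move: hn; rewrite expr_div_n ler_pdivrMr ?exprn_gt0// => /le_trans; apply.
by rewrite -!mulrA [delta * _]mulrC.
Qed.

End ConcentratedKernel.

(** * Pointwise bounds from the coefficients *)

Section PointwiseBound.
Context {R : realType} {d : nat}.
Implicit Types (F T : ('I_d -> R) -> R) (x y : 'I_d -> R) (h l : mindex d).

Lemma cont_fun_bounded F : cont_fun F ->
  exists2 M, 0 <= M & forall x, unit_cube x -> `|F x| <= M.
Proof.
move=> cF; pose K : set 'rV[R]_d := [set v | forall i, `[(0:R), 1]%classic (v ord0 i)].
have cK : compact K by apply: (@rV_compact _ _ (fun=> `[(0:R), 1]%classic)) => _; exact: segment_compact.
pose G (v : 'rV[R]_d) : R := F (fun i => v ord0 i).
have cG : continuous G.
  move=> v.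
  apply/(@cvgrPdist_lt _ _ _ _ (nbhs_filter v)) => e e0; have [a a0 ha] := cF (fun i => v ord0 i) e e0.
  rewrite -nbhs_nearE; apply/nbhs_ballP; exists a => //= w vw.
  by apply: ha => i; case: vw => _ /(_ ord0 i).
have /compact_bounded[M [_ HM]] : compact (G @` K).
  by apply: continuous_compact => //; exact: continuous_subspaceT.
exists (`|M| + 1) => [|x xc]; first by rewrite addr_ge0.
have MM : M < `|M| + 1 by rewrite (le_lt_trans (ler_norm M))// ltrDl.
have -> : F x = G (\row_i x i) by congr F; apply/funext => i; rewrite mxE.
apply: (HM _ MM) => /=; exists (\row_i x i) => // i.
by rewrite mxE /= in_itv /=; exact: xc.
Qed.

Lemma iint_prod (tau : 'I_d -> R -> R) k x : (forall i, continuous (tau i)) ->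
  (k <= d)%N -> iint k (fun x => \prod_i tau i (x i)) x =
  \prod_(i < d) (if (i < k)%N then int01 (tau i) else tau i (x i)).
Proof.
move=> ct; elim: k x => [|k ih] x kd; first by apply: eq_bigr => i _.
pose i0 := Ordinal kd.
rewrite iintS (eq_int01 _ (fun t =>
  (\prod_(i | i != i0) (if (i < k)%N then int01 (tau i) else tau i (x i))) * tau i0 t)); last first.
  move=> t _; rewrite ih ?(ltnW kd)// (bigD1 i0)//= ltnn /upd eqxx mulrC.
  congr (_ * _); apply: eq_bigr => i /negPf ii0.
  by rewrite (_ : (i == k :> nat) = false)//; exact: ii0.
rewrite int01Z// [RHS](bigD1 i0)//= ltnSn mulrC; congr (_ * _).
apply: eq_bigr => i ii0; rewrite ltnS [(i <= k)%N]leq_eqVlt.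
by rewrite (_ : (i == k :> nat) = false)//; exact: negPf ii0.
Qed.

Lemma cube_int_prod (tau : 'I_d -> R -> R) : (forall i, continuous (tau i)) ->
  cube_int (fun x => \prod_i tau i (x i)) = \prod_i int01 (tau i).
Proof.
move=> ct; rewrite /cube_int iint_prod//.
by apply: eq_bigr => i _; rewrite ltn_ord.
Qed.

Lemma cont_fun_prod (tau : 'I_d -> R -> R) : (forall i, continuous (tau i)) ->
  cont_fun (fun x => \prod_i tau i (x i)).
Proof.
move=> ct; elim: (index_enum _) => [|i s ih].
  under eq_fun do rewrite big_nil; exact: cont_fun_cst.
under eq_fun do rewrite big_cons; apply: cont_funM => //.
by apply: cont_fun_comp => //; exact: cont_fun_coord.
Qed.

(** The kernel is a tensor product. If coordinate k of [x] is far from that of [x0], its factor is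
    at most [eta], and the remaining product [Tk] still has integral 1. Hence [E] dominates the
    error everywhere, and [eta] is small enough for the d far regions to cost at most [e / 2]
    together. *)
Lemma approximate_identity F x0 (e : R) : cont_fun F ->
  (forall i, 0 < x0 i < 1) -> 0 < e ->
  exists T, [/\ is_trigpoly T, forall x, 0 <= T x, cube_int T = 1 &
    `|cube_int (fun x => F x * T x) - F x0| <= e].
Proof.
move=> cF x0i e0; have [M M0 HM] := cont_fun_bounded _ cF.
have e20 : 0 < e / 2 by rewrite divr_gt0.
have [delta d0 hd] := cF x0 (e / 2) e20.
pose eta := e / 2 / (2 * M * d%:R + 1).
have den0 : 0 < 2 * M * d%:R + 1 by rewrite ltr_wpDl// !mulr_ge0.
have eta0 : 0 < eta by rewrite divr_gt0.
have /choice[p hp] : forall i : 'I_d, exists p : R * nat, [/\ 0 <= p.1,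
    int01 (cos_kernel (x0 i) p.1 p.2) = 1 &
    forall t, 0 <= t <= 1 -> delta <= `|t - x0 i| -> cos_kernel (x0 i) p.1 p.2 t <= eta].
  move=> i; have /andP[x0p x01] := x0i i.
  pose di := Num.min delta (Num.min (x0 i) (1 - x0 i)).
  have [c [n [c0 c1 hc]]] : exists c n, [/\ 0 <= c, int01 (cos_kernel (x0 i) c n) = 1 &
      forall t, 0 <= t <= 1 -> di <= `|t - x0 i| -> cos_kernel (x0 i) c n t <= eta].
    apply: cos_kernel_exists => //; rewrite /di.
    - by rewrite !lt_min d0 x0p subr_gt0.
    - by rewrite !ge_min lexx orbT.
    - by rewrite lerBrDr addrC -lerBrDr !ge_min lexx !orbT.
  exists (c, n); split=> // t t01 dt; apply: hc => //.
  by rewrite /di (le_trans _ dt)// ge_min lexx.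
pose tau i := cos_kernel (x0 i) (p i).1 (p i).2.
have ct i : continuous (tau i) by exact: continuous_cos_kernel.
have tau0 i t : 0 <= tau i t.
  have [p0 _ _] := hp i; rewrite /tau /cos_kernel; apply: mulr_ge0; first exact: p0.
  by apply: exprn_ge0; rewrite -lerBlDl sub0r cos_geN1.
have tau1 i : int01 (tau i) = 1 by have [] := hp i.
pose T x := \prod_i tau i (x i).
pose tauk k i : R -> R := if i == k then (fun=> 1) else tau i.
have ctk k i : continuous (tauk k i).
  by rewrite /tauk; case: ifP => // _ ?; exact: cvg_cst.
pose Tk k x := \prod_i tauk k i (x i).
have T0 x : 0 <= T x by apply: prodr_ge0.
have Tk0 k x : 0 <= Tk k x.
  by apply: prodr_ge0 => i _; rewrite /tauk; case: ifP.
have cT : cont_fun T by exact: cont_fun_prod.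
have cTk k : cont_fun (Tk k) by exact: cont_fun_prod.
have T1 : cube_int T = 1 by rewrite cube_int_prod// big1.
have Tk1 k : cube_int (Tk k) = 1.
  rewrite cube_int_prod// big1// => i _; rewrite /tauk; case: ifP => // _.
  exact: int01_cst.
exists T; split=> //.
  apply: is_trigpoly_prod => i; rewrite /tau /cos_kernel; apply: is_trigpolyZ.
  apply: is_trigpolyX; apply: is_trigpolyD; first exact: is_trigpoly_cst.
  exact: is_trigpoly_coord.
pose E x := e / 2 * T x + 2 * M * eta * \sum_k Tk k x.
have cE : cont_fun E.
  apply: cont_funD; apply: cont_funZ => //; exact: cont_fun_sum.
have E0 : cube_int E <= e.
  rewrite cube_intD; [|exact: cont_funZ|by apply: cont_funZ; exact: cont_fun_sum].
  rewrite !cube_intZ//; last exact: cont_fun_sum.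
  rewrite cube_int_sum// T1 mulr1.
  have -> : \sum_k cube_int (Tk k) = d%:R.
    under eq_bigr do rewrite Tk1; by rewrite sumr_const card_ord.
  have -> : 2 * M * eta * d%:R = e / 2 * (2 * M * d%:R / (2 * M * d%:R + 1)).
    by rewrite /eta; field; rewrite gt_eqF.
  rewrite [leRHS]splitr lerD2l ler_piMr ?(ltW e20)//.
  by rewrite ler_pdivrMr// mul1r lerDl.
have Me0 : 0 <= 2 * M * eta by apply: mulr_ge0; [exact: mulr_ge0|exact: ltW].
have FE x : unit_cube x -> `|F x - F x0| * T x <= E x.
  move=> xc; have [[k kfar]|near_] := pselect (exists k, delta <= `|x k - x0 k|).
    have Fb : `|F x - F x0| <= 2 * M.
      rewrite (le_trans (ler_normB _ _))// mulr2n mulrDl !mul1r lerD ?HM//.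
      by move=> i; have /andP[? ?] := x0i i; rewrite !ltW.
    have Tb : T x <= eta * Tk k x.
      have -> : Tk k x = \prod_(i | i != k) tau i (x i).
        rewrite /Tk (bigD1 k)//= /tauk eqxx mul1r.
        by apply: eq_bigr => i /negPf ->.
      rewrite /T (bigD1 k)//=.
      apply: ler_wpM2r; first by apply: prodr_ge0.
      by have [_ _] := hp k; apply => //; exact: xc.
    apply: (@le_trans _ _ (2 * M * eta * Tk k x)).
      by rewrite -[leRHS]mulrA ler_pM// mulr_ge0// ltW.
    rewrite /E -[leLHS]add0r lerD//; first by rewrite mulr_ge0// ltW.
    apply: ler_wpM2l => //.
    by rewrite (bigD1 k)//= lerDl sumr_ge0.
  apply: (@le_trans _ _ (e / 2 * T x)).
    apply: ler_wpM2r => //; rewrite distrC ltW//; apply: hd => i.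
    by rewrite distrC ltNge; apply/negP => ?; apply: near_; exists i.
  by rewrite /E lerDl; apply: mulr_ge0 => //; exact: sumr_ge0.
have cFT : cont_fun (fun x => F x * T x) by exact: cont_funM.
have cFT0 : cont_fun (fun x => F x0 * T x) by exact: cont_funZ.
have I0 : cube_int (fun x => F x0 * T x) = F x0 by rewrite cube_intZ// T1 mulr1.
have up : cube_int (fun x => F x * T x) <= F x0 + cube_int E.
  rewrite -I0 -cube_intD//; apply: le_cube_int => //; first exact: cont_funD.
  move=> x /FE; rewrite -[T x in leLHS](ger0_norm (T0 x)) -normrM mulrBl ler_norml.
  by move=> /andP[_]; rewrite lerBlDl.
have lo : F x0 <= cube_int (fun x => F x * T x) + cube_int E.
  rewrite -[leLHS]I0 -cube_intD//; apply: le_cube_int => //; first exact: cont_funD.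
  move=> x /FE; rewrite -[T x in leLHS](ger0_norm (T0 x)) -normrM mulrBl ler_norml.
  by move=> /andP[+ _]; rewrite lerNl opprB lerBlDl.
by rewrite ler_norml; lra.
Qed.

Context {g r : nat -> R}.
Hypothesis g_gt0 : forall j : nat, (0 < j)%N -> 0 < g j.

(** Convergence of the Hartley series is avoided by testing [F] against a nonnegative [T] of
    integral 1: its coefficients are at most [sqrt 2] in modulus, and Cauchy-Schwarz gives the bound
    uniformly in [T]. Only frequencies where [F] has a nonzero coefficient count in [t], so for a
    residual [t] is the tail of the eigenvalue sum. *)
Lemma pointwise_bound F (H t : R) : cont_fun F -> 0 <= H -> 0 <= t ->
  (forall D, uniq D -> \sum_(h <- D) hcoef F h ^+ 2 * weight g r h <= H) ->
  (forall D, uniq D -> (forall h, h \in D -> hcoef F h != 0) ->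
     \sum_(h <- D) (weight g r h)^-1 <= t) ->
  forall x, unit_cube x -> F x ^+ 2 <= 2 * t * H.
Proof.
move=> cF H0 t0 hH ht.
have interior x : (forall i, 0 < x i < 1) -> `|F x| <= Num.sqrt (2 * t * H).
  move=> xi; apply/ler_addgt0Pr => e e0.
  have [T [[A [c [uA TE]]] T0 T1 FT]] := approximate_identity _ _ _ cF xi e0.
  have cT : cont_fun T by rewrite TE; exact: cont_fun_trigpoly.
  have cb h : h \in A -> `|c h| <= Num.sqrt 2.
    move=> hA; have : hcoef T h = c h by rewrite TE hcoef_trigpoly// hA.
    move=> <-; have cTc : cont_fun (fun x => T x * cas h x) by apply: cont_funM => //; exact: cont_fun_cas.
    have b y : `|T y * cas h y| <= Num.sqrt 2 * T y.
      by rewrite normrM (ger0_norm (T0 y)) mulrC ler_wpM2r// norm_cas_le.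
    have E2 : cube_int (fun y => Num.sqrt 2 * T y) = Num.sqrt 2 by rewrite cube_intZ// T1 mulr1.
    rewrite ler_norml -E2; apply/andP; split; last first.
      by apply: le_cube_int => //; [exact: cont_funZ|move=> y _; have := b y; rewrite ler_norml => /andP[]].
    rewrite -mulN1r -cube_intZ//; last exact: cont_funZ.
    apply: le_cube_int => //; first by do 2 apply: cont_funZ.
    by move=> y _; have := b y; rewrite ler_norml mulN1r => /andP[].
  have FTE : cube_int (fun y => F y * T y) = \sum_(h <- A) c h * hcoef F h.
    have -> : (fun y => F y * T y) = fun y => \sum_(h <- A) c h * (F y * cas h y).
      by apply/funext => y; rewrite TE mulr_sumr; apply: eq_bigr => h _; ring.
    have cFc h : cont_fun (fun y => F y * cas h y) by apply: cont_funM => //; exact: cont_fun_cas.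
    by rewrite cube_int_sum => [|h]; [apply: eq_bigr => h _; rewrite cube_intZ|exact: cont_funZ].
  pose D := [seq h <- A | hcoef F h != 0].
  have uD : uniq D by exact: filter_uniq.
  have DE : \sum_(h <- A) c h * hcoef F h = \sum_(h <- D) c h * hcoef F h.
    rewrite big_filter [LHS](bigID (fun h => hcoef F h != 0))/= [X in _ + X]big1 ?addr0//.
    by move=> h /negPn/eqP ->; rewrite mulr0.
  have sq2 : `|\sum_(h <- D) c h * hcoef F h| <= Num.sqrt (2 * t * H).
    rewrite -sqrtr_sqr ler_wsqrtr//.
    pose a h := c h / Num.sqrt (weight g r h).
    pose b h := hcoef F h * Num.sqrt (weight g r h).
    have -> : \sum_(h <- D) c h * hcoef F h = \sum_(h <- D) a h * b h.
      apply: eq_bigr => h _; rewrite /a /b.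
      have : Num.sqrt (weight g r h) != 0 by rewrite gt_eqF// sqrtr_gt0 weight_gt0.
      by move: (Num.sqrt _) => q q0; field.
    apply: (le_trans (cauchy_schwarz_sum _ _ _ _)); apply: ler_pM.
    - by apply: sumr_ge0 => *; exact: sqr_ge0.
    - by apply: sumr_ge0 => *; exact: sqr_ge0.
    - apply: (@le_trans _ _ (2 * \sum_(h <- D) (weight g r h)^-1)); last first.
        rewrite ler_wpM2l//; apply: ht => // h; rewrite mem_filter => /andP[] //.
      rewrite mulr_sumr big_seq [leRHS]big_seq; apply: ler_sum => h hD.
      rewrite /a expr_div_n sqr_sqrtr ?weight_ge0// ler_wpM2r ?invr_ge0 ?weight_ge0//.
      rewrite -real_normK ?num_real// -[leRHS]sqr_sqrtr//.
      rewrite lerXn2r ?nnegrE ?sqrtr_ge0// cb//.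
      by move: hD; rewrite mem_filter => /andP[].
    - apply: le_trans (hH _ uD); apply: ler_sum => h _.
      by rewrite /b exprMn sqr_sqrtr ?weight_ge0.
  have -> : F x = cube_int (fun y => F y * T y) - (cube_int (fun y => F y * T y) - F x) by ring.
  by rewrite (le_trans (ler_normB _ _))// lerD// FTE DE.
move=> x xc; rewrite -real_normK ?num_real//.
rewrite -[leRHS]sqr_sqrtr ?mulr_ge0// lerXn2r ?nnegrE ?sqrtr_ge0//.
apply/ler_addgt0Pr => e e0; have [a a0 ha] := cF x e e0.
pose s := Num.min (1 / 2) (a / 2).
have s0 : 0 < s by rewrite lt_min !divr_gt0.
have s1 : s <= 1 / 2 by rewrite ge_min lexx.
have sa : s <= a / 2 by rewrite ge_min lexx orbT.
(* The approximate identity requires an interior point, so [x] is moved slightly towards the centre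
   of the cube. *)
pose y i := (1 - s) * x i + s / 2.
have yi i : 0 < y i < 1 by have := xc i; rewrite /y; nra.
have Fxy : `|F x - F y| < e.
  apply: ha => i; rewrite /y (_ : _ - _ = s * (x i - 1 / 2)); last by field.
  rewrite normrM gtr0_norm//.
  have : `|x i - 1 / 2| <= 1 / 2 by have := xc i; rewrite ler_norml; lra.
  have := normr_ge0 (x i - 1 / 2); nra.
have -> : F x = F y + (F x - F y) by ring.
by rewrite (le_trans (ler_normD _ _))// lerD ?interior// ltW.
Qed.

End PointwiseBound.

(** * The orthogonal projection onto the kernel of a matrix *)

Section KernelProjection.
Context {R : realType}.

(** [P] is the identity minus the projection onto the row space. A row basis [B] replaces [M], which
    may be rank deficient: its Gram matrix is invertible, since [v G = 0] forces the norm of [v B]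
    to vanish. The trace is [N] minus the rank. *)
Lemma kernel_projection (n N : nat) (M : 'M[R]_(n, N)) : exists P : 'M[R]_N,
  [/\ P^T = P, P *m P = P, M *m P = 0 & N%:R - n%:R <= \tr P].
Proof.
have : (M <= row_base M)%MS by rewrite eq_row_base.
move: (row_base_free M); move: (row_base M) => B fB MB; pose G := B *m B^T.
have uG : G \in unitmx.
  rewrite -row_free_unit; apply: inj_row_free => v vG.
  have vB : v *m B = 0.
    have : (v *m B) *m (v *m B)^T = 0 by rewrite trmx_mul mulmxA -(mulmxA v) vG mul0mx.
    move=> /matrixP/(_ 0 0); rewrite !mxE => E; apply/matrixP => i j.
    have /psumr_eq0P/(_ E)/(_ j erefl) : forall k, true -> 0 <= (v *m B) 0 k * (v *m B)^T k 0.
      by move=> k _; rewrite [_^T _ _]mxE -expr2 sqr_ge0.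
    rewrite [_^T _ _]mxE => /eqP; rewrite -expr2 sqrf_eq0 => /eqP.
    by rewrite ord1 => ->; rewrite mxE.
  by apply: (row_free_inj fB); rewrite mul0mx.
pose P := 1%:M - B^T *m invmx G *m B; exists P.
have GT : G^T = G by rewrite /G trmx_mul trmxK.
have BP : B *m P = 0.
  rewrite /P mulmxBr mulmx1 !mulmxA -[B *m B^T]/G mulmxV// mul1mx subrr//.
split.
- rewrite /P linearB /= trmx1 !trmx_mul trmxK trmx_inv GT.
  by rewrite mulmxA.
- have -> : P *m P = P - B^T *m invmx G *m (B *m P).
    by rewrite [B^T *m _ *m (B *m P)]mulmxA {1}/P mulmxBl mul1mx.
  by rewrite BP mulmx0 subr0.
- have -> : M *m P = M *m pinvmx B *m (B *m P) by rewrite [RHS]mulmxA mulmxKpV.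
  by rewrite BP mulmx0.
- rewrite /P linearB /= mxtrace1 -mulmxA mxtrace_mulC -mulmxA mulVmx// mxtrace1.
  by rewrite lerB// ler_nat rank_leq_row.
Qed.

(** For a symmetric idempotent, [P j j] is the squared norm of row [j], hence at least its own
    square. *)
Lemma projection_diag (N : nat) (P : 'M[R]_N) j : P^T = P -> P *m P = P ->
  P j j <= 1.
Proof.
move=> PT PP; have : (P j j) ^+ 2 <= P j j.
  rewrite -[leRHS]/((P) j j) -{2}PP mxE (bigD1 j)//= -expr2 lerDl sumr_ge0// => k _.
  by rewrite -{2}PT mxE -expr2 sqr_ge0.
by move: (P j j) => p; nra.
Qed.

End KernelProjection.

(** * Lower bound for linear information *)

Section LowerBound.
Context {R : realType} {d : nat} {g r : nat -> R}.
Hypothesis g_gt0 : forall j : nat, (0 < j)%N -> 0 < g j.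
Implicit Types (f : ('I_d -> R) -> R) (h l : mindex d).

Lemma admissible_linear Lam (L : (('I_d -> R) -> R) -> R) (a b : R) f1 f2 :
  admissible g r Lam L -> inH g r f1 -> inH g r f2 ->
  L (fun x => a * f1 x + b * f2 x) = a * L f1 + b * L f2.
Proof.
by case: Lam => [[x Lx] _ _|[Ll _]]; [rewrite !Lx|exact: Ll].
Qed.

Lemma admissible_trigpoly Lam (L : (('I_d -> R) -> R) -> R) A c :
  admissible g r Lam L -> uniq A ->
  L (trigpoly A c) = \sum_(h <- A) c h * L (cas h).
Proof.
move=> aL; elim: A => [_|h A ih /= /andP[hA uA]].
  have H0 : inH g r (trigpoly [::] c) by exact: inH_trigpoly.
  have := admissible_linear _ _ 0 0 _ _ aL H0 H0.
  rewrite !mul0r addr0 big_nil => <-; congr L; apply/funext => x.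
  by rewrite /trigpoly big_nil mul0r addr0.
have Hh : inH g r (trigpoly [:: h] (fun=> 1)) by exact: inH_trigpoly.
have casE : trigpoly [:: h] (fun=> 1) = cas h :> (('I_d -> R) -> R).
  by apply/funext => x; rewrite /trigpoly big_seq1 mul1r.
have HA : inH g r (trigpoly A c) by exact: inH_trigpoly.
rewrite big_cons -ih// -casE -[L (trigpoly A c)]mul1r.
rewrite -(admissible_linear _ _ _ _ _ _ aL Hh HA); congr L; apply/funext => x.
by rewrite casE /trigpoly big_cons mul1r.
Qed.

(* The part of the span of the [sqrt (mu h) cas h] annihilated by [n] functionals
   is the range of a projection [P] of trace at least [size A - n]; its
   reproducing kernel at [(x, x)], [v^T P v], bounds the squared error below,
   and averages to [\sum_j P j j * mu j] over the cube. *)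
Lemma linear_information_lower_bound Lam n (L : 'I_n -> (('I_d -> R) -> R) -> R)
    (phi : ('I_n -> R) -> ('I_d -> R) -> R) (A : seq (mindex d))
    (mu : mindex d -> R) (M e : R) :
  (forall i, admissible g r Lam (L i)) -> uniq A ->
  (forall h, h \in A -> [/\ 0 <= mu h, mu h <= (weight g r h)^-1 & mu h <= M]) ->
  0 <= M -> 0 <= e ->
  (forall f x, unit_ball g r f -> unit_cube x ->
     `|f x - phi (fun i => L i f) x| <= e) ->
  \sum_(h <- A) mu h - n%:R * M <= e ^+ 2.
Proof.
move=> aL uA hmu M0 e0 he.
pose N := size A; pose a (j : 'I_N) := nth 0 A j.
have aA j : a j \in A by rewrite mem_nth.
have sumA (F : mindex d -> R) : \sum_(h <- A) F h = \sum_j F (a j).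
  by rewrite (big_nth 0) big_mkord.
have ainj j k : (a j == a k) = (j == k) by rewrite /a nth_uniq.
pose ext (c : 'I_N -> R) h := \sum_(j | a j == h) c j.
have extE c j : ext c (a j) = c j.
  by rewrite /ext (eq_bigl (pred1 j)) ?big_pred1_eq// => k; rewrite ainj.
have m0 j : 0 <= mu (a j) by have [] := hmu _ (aA j).
pose s j : R := Num.sqrt (mu (a j)).
have sE j : s j ^+ 2 = mu (a j) by rewrite sqr_sqrtr.
pose Mx : 'M[R]_(n, N) := \matrix_(i, j) (s j * L i (cas (a j))).
have [P [PT PP MP trP]] := kernel_projection _ _ Mx.
pose v x : 'cV[R]_N := \col_j (s j * cas (a j) x).
pose c x : 'cV[R]_N := P *m v x.
pose Q x := \sum_j \sum_k P j k * (s j * s k) * (cas (a j) x * cas (a k) x).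
have QE x : Q x = \sum_j c x j ord0 * v x j ord0.
  apply: eq_bigr => j _; rewrite mxE mulr_suml; apply: eq_bigr => k _.
  by rewrite !mxE; ring.
have Qc x : Q x = \sum_j c x j ord0 ^+ 2.
  have -> : Q x = ((c x)^T *m v x) ord0 ord0.
    by rewrite QE mxE; apply: eq_bigr => j _; rewrite !mxE.
  have -> : (c x)^T *m v x = (c x)^T *m c x.
    by rewrite /c trmx_mul PT -mulmxA [RHS]mulmxA -[_ *m P *m P]mulmxA PP mulmxA.
  by rewrite mxE; apply: eq_bigr => j _; rewrite mxE -expr2.
have Q0 x : 0 <= Q x by rewrite Qc sumr_ge0// => j _; exact: sqr_ge0.
have Qe x : unit_cube x -> Q x <= e ^+ 2.
  move=> xc; have := Q0 x; rewrite le_eqVlt => /predU1P[<-|Qp]; first exact: sqr_ge0.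
  pose q := Num.sqrt (Q x); have q0 : 0 < q by rewrite sqrtr_gt0.
  (* For [sg = 1] and [sg = -1] these coefficients give functions of the unit ball with zero
     information and values [q] and [- q] at [x]. The algorithm cannot distinguish them, so it errs
     by at least [q] on one of the two. *)
  pose b (sg : R) := ext (fun j => sg * (c x j ord0 * s j / q)).
  have ball sg : sg ^+ 2 = 1 -> unit_ball g r (trigpoly A (b sg)).
    move=> sg1; split; first exact: inH_trigpoly.
    rewrite hnorm2_trigpoly// lee_fin sumA.
    apply: (@le_trans _ _ (\sum_j c x j ord0 ^+ 2 / q ^+ 2)).
      apply: ler_sum => j _; rewrite /b extE exprMn sg1 mul1r !exprMn sE exprVn.
      rewrite [leLHS](_ : _ = c x j ord0 ^+ 2 / q ^+ 2 *
        (mu (a j) * weight g r (a j))); last by ring.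
      rewrite ler_piMr//.
        by rewrite mulr_ge0 ?invr_ge0 ?sqr_ge0.
      have [_ + _] := hmu _ (aA j).
      by move=> mw; rewrite -ler_pdivlMr ?weight_gt0// mul1r.
    by rewrite -mulr_suml -Qc sqr_sqrtr// divff// gt_eqF.
  have Lz sg i : L i (trigpoly A (b sg)) = 0.
    rewrite (admissible_trigpoly _ _ _ _ (aL i))// sumA.
    transitivity (sg / q * (Mx *m c x) i ord0).
      rewrite mxE mulr_sumr; apply: eq_bigr => j _; rewrite /b extE.
      by rewrite [Mx _ _]mxE; ring.
    by rewrite /c mulmxA MP mul0mx mxE mulr0.
  have fx sg : trigpoly A (b sg) x = sg * q.
    rewrite /trigpoly sumA.
    transitivity (sg / q * Q x).
      rewrite QE mulr_sumr; apply: eq_bigr => j _; rewrite /b extE.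
      by rewrite [v x _ _]mxE; ring.
    by rewrite -[Q x]sqr_sqrtr// expr2 mulrA divfK// gt_eqF.
  have E sg : sg ^+ 2 = 1 -> `|sg * q - phi (fun=> 0) x| <= e.
    move=> sg1; have := he _ _ (ball sg sg1) xc; rewrite fx.
    by under [fun i : 'I_n => _]eq_fun do rewrite Lz.
  have qe : q <= e.
    have := E 1 (expr1n _ _); have := E (-1) ltac:(by rewrite sqrrN expr1n).
    by rewrite !ler_norml mulN1r mul1r; lra.
  by rewrite -[Q x]sqr_sqrtr// lerXn2r ?nnegrE// ltW.
have cQ : cont_fun Q.
  apply: cont_fun_sum => j; apply: cont_fun_sum => k; apply: cont_funZ.
  by apply: cont_funM; exact: cont_fun_cas.
have : cube_int Q <= e ^+ 2 by exact: cube_int_le_cst.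
apply: le_trans.
have ccas j k : cont_fun (fun x => cas (a j) x * cas (a k) x).
  by apply: cont_funM; exact: cont_fun_cas.
have -> : cube_int Q = \sum_j P j j * mu (a j).
  rewrite cube_int_sum => [|j]; last by apply: cont_fun_sum => k; exact: cont_funZ.
  apply: eq_bigr => j _; rewrite cube_int_sum => [|k]; last exact: cont_funZ.
  rewrite (bigD1 j)//= big1 ?addr0 => [|k kj].
    by rewrite cube_intZ// cas_orthonormal eqxx mulr1 -expr2 sE.
  by rewrite cube_intZ// cas_orthonormal ainj eq_sym (negPf kj) mulr0.
rewrite sumA lerBlDr -lerBlDl -sumrB.
(* The mass lost by the projection is at most [M] times its corank, which is at most [n]. *)
apply: (@le_trans _ _ (\sum_j (1 - P j j) * M)).
  apply: ler_sum => j _; have [_ _ mM] := hmu _ (aA j).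
  have := projection_diag _ _ j PT PP; rewrite -{1}[mu _]mul1r -mulrBl => P1.
  by rewrite ler_wpM2l// subr_ge0.
rewrite -mulr_suml ler_wpM2r// sumrB sumr_const card_ord.
by rewrite lerBlDr addrC -lerBlDr.
Qed.

End LowerBound.

(** * Partial sums of the zeta function *)

Section ZetaSums.
Context {R : realType}.

Lemma ln_le_sub1 (x : R) : 0 < x -> ln x <= x - 1.
Proof.
move=> x0; rewrite -[x in ln x](subrK 1) [_ + 1]addrC; apply: le_ln1Dx.
by rewrite ltrBrDr addNr.
Qed.

Definition zsum (p : R) (m : nat) : R := \sum_(1 <= j < m.+1) j%:R `^ (- p).

Lemma zsum_ge0 p m : 0 <= zsum p m.
Proof. by apply: sumr_ge0 => j _; exact: powR_ge0. Qed.

Lemma zsum_ge1 p m : (0 < m)%N -> 1 <= zsum p m.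
Proof.
move=> m0; rewrite /zsum big_ltn// powR1 lerDl; apply: sumr_ge0 => j _; exact: powR_ge0.
Qed.

Lemma zsum_anti p q m : p <= q -> zsum q m <= zsum p m.
Proof.
move=> pq; rewrite /zsum big_nat_cond [leRHS]big_nat_cond.
apply: ler_sum => j /andP[/andP[j0 _] _]; apply: ler_powR; last by rewrite lerN2.
by rewrite ler1n.
Qed.

(* Comparison with the telescoping sum of [(j - 1)^(1 - p) - j^(1 - p)]. *)
Lemma zsum_bound p m : 1 < p -> zsum p m <= p / (p - 1).
Proof.
move=> p1; have p10 : 0 < p - 1 by rewrite subr_gt0.
suff H n : (p - 1) * zsum p n.+1 <= p - n.+1%:R `^ (1 - p).
  rewrite ler_pdivlMr// mulrC; case: m => [|m].
    by rewrite /zsum big_geq// mulr0; lra.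
  by apply: le_trans (H m) _; rewrite gerBl powR_ge0.
elim: n => [|n ih]; first by rewrite /zsum big_nat1 !powR1; lra.
rewrite /zsum big_nat_recr//= mulrDr.
set x : R := n.+2%:R; set y : R := n.+1%:R.
have y0 : 0 < y by rewrite ltr0n.
have x0 : 0 < x by rewrite ltr0n.
have xy : x = y + 1 by rewrite /x -natr1.
suff S : (p - 1) * x `^ (- p) <= y `^ (1 - p) - x `^ (1 - p).
  by apply: le_trans (lerD ih S) _; rewrite addrA subrK.
have E : x `^ (- p) = x `^ (1 - p) / x.
  by rewrite powRD ?(gt_eqF x0) ?implybT// powRr1 ?(ltW x0)// mulrAC divff ?mul1r ?gt_eqF.
have F : y `^ (1 - p) = x `^ (1 - p) * expR ((p - 1) * ln (x / y)).
  rewrite /powR !gt_eqF// -expRD; congr expR; rewrite lnM ?posrE ?invr_gt0// lnV//; ring.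
rewrite E F (_ : _ * (_ / x) = x `^ (1 - p) * ((p - 1) / x)); last by ring.
rewrite (_ : _ * expR _ - _ = x `^ (1 - p) * (expR ((p - 1) * ln (x / y)) - 1)); last by ring.
rewrite ler_wpM2l ?powR_ge0//.
rewrite lerBrDl; apply: le_trans (expR_ge1Dx _); rewrite lerD2l ler_wpM2l ?(ltW p10)//.
have : ln (y / x) <= y / x - 1 by rewrite ln_le_sub1// divr_gt0.
have -> : ln (y / x) = - ln (x / y) by rewrite -lnV ?invf_div// posrE divr_gt0.
rewrite lerNl => /(le_trans _); apply.
have y1 : y + 1 != 0 by rewrite -xy gt_eqF.
rewrite (_ : - (y / x - 1) = x^-1)//; rewrite xy; move: (y) y1 => z z1.
by field.
Qed.

End ZetaSums.

(** * Boxes of frequencies and product formulas for eigenvalue sums *)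

Section FrequencyBoxes.
Context {R : realType} {d : nat}.
Implicit Types (h l : mindex d) (m : nat).

(** Points of the box [-m, m]^d are shifted finite functions, so that sums of products over a box
    factor by distributivity. *)
Definition box_point m (i : {ffun 'I_d -> 'I_(m.*2.+1)}) : mindex d :=
  [ffun k => (i k : nat)%:Z - m%:Z].

Definition box m : seq (mindex d) :=
  [seq box_point m i | i <- enum {: {ffun 'I_d -> 'I_(m.*2.+1)}}].

Lemma box_uniq m : uniq (box m).
Proof.
rewrite map_inj_uniq ?enum_uniq// => i j /ffunP ij; apply/ffunP => k.
by have := ij k; rewrite !ffunE => /addIr [] /ord_inj.
Qed.

Lemma mem_box m h : (h \in box m) = [forall k, (absz (h k) <= m)%N].
Proof.
apply/mapP/forallP => [[i _ ->] k|H].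
  rewrite ffunE; have := ltn_ord (i k); move: (nat_of_ord _) => n.
  by rewrite -addnn; lia.
exists [ffun k => inord (absz (h k + m%:Z))]; first by rewrite mem_enum.
apply/ffunP => k; rewrite !ffunE; have := H k => hk.
have hb : (absz (h k + m%:Z)%R < m.*2.+1)%N by rewrite -addnn; lia.
rewrite (inordK hb); move: (h k) hk hb => z; lia.
Qed.

Lemma box_subset m n : (m <= n)%N -> {subset box m <= box n}.
Proof.
move=> mn h; rewrite !mem_box => /forallP H; apply/forallP => k.
exact: leq_trans (H k) mn.
Qed.

Lemma subset_box (D : seq (mindex d)) m0 :
  exists2 m, (m0 <= m)%N & {subset D <= box m}.
Proof.
elim: D => [|h D [m mm Dm]]; first by exists m0.
pose n := maxn m (\max_(k < d) absz (h k)).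
exists n; first by rewrite (leq_trans mm)// leq_maxl.
move=> l; rewrite inE => /predU1P[->|/Dm lm]; last first.
  by apply: box_subset lm; exact: leq_maxl.
rewrite mem_box; apply/forallP => k; rewrite leq_max.
by apply/orP; right; apply: (leq_bigmax (F := fun k => absz (h k))).
Qed.

Lemma sum_sym_interval m (psi : int -> R) : (forall z, psi (- z) = psi z) ->
  \sum_(0 <= i < m.*2.+1) psi (i%:Z - m%:Z) =
  psi 0 + 2 * \sum_(1 <= j < m.+1) psi j%:Z.
Proof.
move=> even_psi; elim: m => [|m ih].
  by rewrite [X in _ * X]big_geq// mulr0 addr0 double0 big_nat1.
rewrite doubleS big_nat_recl// big_nat_recr//=.
under eq_big_nat => i _.
  rewrite (_ : i.+1%:Z - m.+1%:Z = i%:Z - m%:Z); last by lia.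
  over.
have -> : psi (0%:Z - m.+1%:Z) = psi m.+1%:Z by rewrite sub0r even_psi.
rewrite /= ih [in RHS]big_nat_recr//=.
rewrite (_ : m.*2.+2%:Z - m.+1%:Z = m.+1%:Z); last by rewrite -addnn; lia.
ring.
Qed.

Lemma sum_box_prod m (phi : 'I_d -> int -> R) :
  (forall k z, phi k (- z) = phi k z) ->
  \sum_(h <- box m) \prod_k phi k (h k) =
  \prod_k (phi k 0 + 2 * \sum_(1 <= j < m.+1) phi k j%:Z).
Proof.
move=> even_phi; rewrite big_map big_enum /=.
transitivity (\prod_k \sum_(i < m.*2.+1) phi k ((i : nat)%:Z - m%:Z)).
  rewrite bigA_distr_bigA /=; apply: eq_bigr => i _; apply: eq_bigr => k _.
  by rewrite ffunE.
apply: eq_bigr => k _.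
rewrite -(big_mkord xpredT (fun i : nat => phi k (i%:Z - m%:Z))).
exact: sum_sym_interval.
Qed.

Context {g r : nat -> R}.
Hypothesis g_gt0 : forall j : nat, (0 < j)%N -> 0 < g j.

Definition eigval h : R := (weight g r h)^-1.

Lemma eigval_gt0 h : 0 < eigval h.
Proof. by rewrite invr_gt0 weight_gt0. Qed.

Lemma eigval_ge0 h : 0 <= eigval h.
Proof. exact/ltW/eigval_gt0. Qed.

Definition eigval1 (k : 'I_d) (z : int) : R :=
  if z == 0 then 1 else g k.+1 * (`|z%:~R| : R) `^ (- (2 * r k.+1)).

Lemma eigval_prod h : eigval h = \prod_k eigval1 k (h k).
Proof.
rewrite /eigval /weight big_mkcond -prodfV; apply: eq_bigr => k _.
rewrite /eigval1; case: ifPn => [|/negPn/eqP ->]; last by rewrite eqxx invr1.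
by move=> /negPf ->; rewrite invfM invrK powRN.
Qed.

Lemma powR_prod (I : Type) (s : seq I) (F : I -> R) (t : R) :
  (forall i, 0 <= F i) -> (\prod_(i <- s) F i) `^ t = \prod_(i <- s) (F i) `^ t.
Proof.
move=> F0; elim: s => [|i s ih]; first by rewrite !big_nil powR1.
by rewrite !big_cons powRM ?ih// prodr_ge0.
Qed.

Lemma sum_box_eigval_powR m (t : R) :
  \sum_(h <- box m) eigval h `^ t =
  \prod_(k < d) (1 + 2 * g k.+1 `^ t * zsum (2 * r k.+1 * t) m).
Proof.
have e0 (k : 'I_d) z : 0 <= eigval1 k z.
  by rewrite /eigval1; case: ifP => // _; rewrite mulr_ge0 ?powR_ge0// ltW ?g_gt0.
have -> : \sum_(h <- box m) eigval h `^ t =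
    \sum_(h <- box m) \prod_k eigval1 k (h k) `^ t.
  by apply: eq_bigr => h _; rewrite eigval_prod powR_prod.
rewrite (sum_box_prod m (fun k z => eigval1 k z `^ t)); last first.
  by move=> k z; rewrite /eigval1 oppr_eq0 rmorphN normrN.
apply: eq_bigr => k _; rewrite /eigval1 eqxx powR1; congr (_ + _).
rewrite -mulrA; congr (_ * _); rewrite /zsum mulr_sumr.
rewrite big_nat_cond [RHS]big_nat_cond; apply: eq_bigr => j /andP[/andP[j0 _] _].
rewrite (_ : (j%:Z == 0) = false); last by case: j j0.
rewrite powRM ?powR_ge0 ?(ltW (g_gt0 _ _))//; congr (_ * _).
by rewrite -powRrM mulNr [`| _ |]ger0_norm// ler0n.
Qed.

Lemma sum_box_eigval m :
  \sum_(h <- box m) eigval h =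
  \prod_(k < d) (1 + 2 * g k.+1 * zsum (2 * r k.+1) m).
Proof.
have := sum_box_eigval_powR m 1; under eq_bigr do rewrite powRr1 ?eigval_ge0//.
move=> ->; apply: eq_bigr => k _.
by rewrite powRr1 ?mulr1// ltW// g_gt0.
Qed.

End FrequencyBoxes.

(** * The full eigenvalue sum and the initial error *)

Section EigenvalueSum.
Context {R : realType} {d : nat} {g r : nat -> R}.
Hypothesis g_gt0 : forall j : nat, (0 < j)%N -> 0 < g j.
Hypothesis r_gt : forall j : nat, (0 < j)%N -> 1 / 2 < r j.
Implicit Types (f : ('I_d -> R) -> R) (h l : mindex d).

Local Notation eigval := (@eigval R d g r).

(** This is the value of the reproducing kernel on the diagonal. The boxes increase and exhaust Z^d,
    so their supremum dominates the sum over every finite set. *)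
Definition eigsum : R := sup (range (fun m => \sum_(h <- @box d m) eigval h)).

Let has_sup_box : has_sup (range (fun m => \sum_(h <- @box d m) eigval h)).
Proof.
split; first by exists (\sum_(h <- @box d 0) eigval h); exists 0%N.
exists (\prod_(k < d) (1 + 2 * g k.+1 * (2 * r k.+1 / (2 * r k.+1 - 1)))).
move=> _ [m _ <-]; rewrite sum_box_eigval//; apply: ler_prod => k _.
have g0 : 0 < g k.+1 by exact: g_gt0.
rewrite addr_ge0 ?mulr_ge0 ?(ltW g0) ?zsum_ge0//= lerD2l ler_wpM2l ?mulr_ge0 ?(ltW g0)//.
by apply: zsum_bound; have := r_gt k.+1 isT; lra.
Qed.

Lemma sum_box_le_eigsum m : \sum_(h <- @box d m) eigval h <= eigsum.
Proof. by apply: sup_upper_bound => //; exists m. Qed.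

Lemma sum_le_eigsum (D : seq (mindex d)) : uniq D ->
  \sum_(h <- D) eigval h <= eigsum.
Proof.
move=> uD; have [m _ Dm] := subset_box D 0.
apply: le_trans (sum_box_le_eigsum m); apply: le_sum_subset => //.
  exact: box_uniq.
by move=> h; exact: eigval_ge0.
Qed.

Lemma sum_disjoint_le_eigsum (A D : seq (mindex d)) : uniq A -> uniq D ->
  (forall h, h \in D -> h \notin A) ->
  \sum_(h <- D) eigval h <= eigsum - \sum_(h <- A) eigval h.
Proof.
move=> uA uD DA; rewrite lerBrDr -big_cat; apply: sum_le_eigsum.
rewrite cat_uniq uD uA andbT /=; apply/hasPn => h hA; apply/negP => /DA.
by rewrite hA.
Qed.

Lemma eigsum_approx m0 (e : R) : 0 < e -> exists2 m, (m0 <= m)%N &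
  eigsum - e < \sum_(h <- @box d m) eigval h.
Proof.
move=> e0; have [_ [m _ <-] me] := sup_adherent e0 has_sup_box.
exists (maxn m0 m); first exact: leq_maxl.
apply: (lt_le_trans me); apply: le_sum_subset; try exact: box_uniq.
  exact/box_subset/leq_maxr.
by move=> h; exact: eigval_ge0.
Qed.

Lemma sum_box_ge1 m : 1 <= \sum_(h <- @box d m) eigval h.
Proof.
have h0 : 0 \in @box d m by rewrite mem_box; apply/forallP => k; rewrite ffunE.
have -> : 1 = eigval 0.
  rewrite eigval_prod big1// => k _; by rewrite /eigval1 ffunE eqxx.
rewrite (bigD1_seq 0)//=; last exact: box_uniq.
by rewrite lerDl sumr_ge0// => h _; exact: eigval_ge0.
Qed.

Lemma eigsum_ge1 : 1 <= eigsum.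
Proof. exact: le_trans (sum_box_ge1 0) (sum_box_le_eigsum 0). Qed.

Lemma weighted_cauchy_schwarz (s : seq (mindex d)) (a b : mindex d -> R) :
  (\sum_(h <- s) a h * b h) ^+ 2 <=
  (\sum_(h <- s) a h ^+ 2 * weight g r h) * (\sum_(h <- s) eigval h * b h ^+ 2).
Proof.
pose w h := Num.sqrt (weight g r h).
have w0 h : w h != 0 by rewrite gt_eqF// sqrtr_gt0 weight_gt0.
have wE h : weight g r h = w h ^+ 2 by rewrite sqr_sqrtr// weight_ge0.
have -> : \sum_(h <- s) a h * b h = \sum_(h <- s) (a h * w h) * (b h / w h).
  by apply: eq_bigr => h _; have := w0 h; move: (w h) => q q0; field.
apply: (le_trans (cauchy_schwarz_sum _ _ _ _)).
under eq_bigr do rewrite exprMn -wE.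
under [X in _ * X <= _]eq_bigr do rewrite exprMn exprVn -wE mulrC.
by [].
Qed.

Lemma inH_bound f (H : R) x : cont_fun f -> 0 <= H ->
  (hnorm2 g r f <= H%:E)%E -> unit_cube x -> f x ^+ 2 <= 2 * eigsum * H.
Proof.
move=> cf H0 fH; apply: (pointwise_bound g_gt0 (r := r)) => //.
- exact: le_trans ler01 eigsum_ge1.
- by move=> D uD; rewrite -lee_fin (le_trans (le_hnorm2 g_gt0 _ _ cf uD)).
- by move=> D uD _; exact: sum_le_eigsum.
Qed.

(** For [Lall] the continuity of point evaluation is [inH_bound]; this lets one sampling algorithm
    bound the error for both classes. *)
Lemma admissible_eval Lam x : unit_cube x ->
  admissible g r Lam (fun f : ('I_d -> R) -> R => f x).
Proof.
move=> xc; case: Lam => /=; first by exists x.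
split=> //; exists (Num.sqrt (2 * eigsum)) => f [cf _ fin].
have fin' : hnorm2 g r f \is a fin_num.
  rewrite ge0_fin_numE//; apply: esum_ge0 => h _.
  by rewrite lee_fin mulr_ge0 ?addr_ge0 ?sqr_ge0 ?weight_ge0.
have H0 : 0 <= fine (hnorm2 g r f).
  apply: fine_ge0; apply: esum_ge0 => h _.
  by rewrite lee_fin mulr_ge0 ?addr_ge0 ?sqr_ge0 ?weight_ge0.
have e0 : 0 <= 2 * eigsum by rewrite mulr_ge0// (le_trans ler01 eigsum_ge1).
rewrite -sqrtrM// -sqrtr_sqr ler_wsqrtr//.
by apply: inH_bound => //; rewrite fineK.
Qed.

Lemma init_err_le : (init_err g r d <= (Num.sqrt (2 * eigsum))%:E)%E.
Proof.
apply: ge_ereal_sup => _ [f [x [[[cf _ _] fb] xc ->]]].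
rewrite lee_fin -sqrtr_sqr ler_wsqrtr//.
by have := inH_bound _ 1 _ cf ler01 fb xc; rewrite mulr1.
Qed.

(** The extremal function is the normalized section at the origin of the truncated kernel: every
    [cas h] equals 1 there, so its value is [S / sqrt S]. *)
Lemma init_err_ge m :
  ((Num.sqrt (\sum_(h <- @box d m) eigval h))%:E <= init_err g r d)%E.
Proof.
set S := \sum_(h <- _) _; have S0 : 0 < S by exact: lt_le_trans (sum_box_ge1 m).
have uB := box_uniq m.
pose c h := eigval h / Num.sqrt S.
have sS : Num.sqrt S != 0 by rewrite gt_eqF// sqrtr_gt0.
have SE : S = Num.sqrt S ^+ 2 by rewrite sqr_sqrtr// ltW.
apply: ereal_sup_ubound; exists (trigpoly (box m) c), (fun=> 0); split.
- split; first exact: inH_trigpoly.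
  rewrite hnorm2_trigpoly// lee_fin.
  rewrite (eq_bigr (fun h => eigval h / S)); last first.
    move=> h _; rewrite /c /eigval [in RHS]SE.
    have : weight g r h != 0 by rewrite gt_eqF// weight_gt0.
    by move: (weight g r h) (Num.sqrt S) sS => w q q0 wn0; field; rewrite q0.
  by rewrite -mulr_suml divff// gt_eqF.
- by move=> i; rewrite lexx ler01.
- congr EFin; rewrite /trigpoly (eq_bigr c); last first.
    move=> h _; rewrite /cas (_ : dotp _ _ = 0) ?mulr0 ?cos0 ?sin0 ?addr0 ?mulr1//.
    by rewrite /dotp big1// => i _; rewrite mulr0.
  have -> : \sum_(h <- box m) c h = Num.sqrt S.
    by rewrite -mulr_suml -/S {1}SE expr2 mulfK.
  by rewrite ger0_norm.
Qed.

End EigenvalueSum.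

(** * Deterministic choice of the sample points *)

Section Sampling.
Context {R : realType} {d : nat}.

(* Greedy derandomization of Monte Carlo: averaging over the new point, the
   cross terms vanish, so some choice increases the sum by at most the mean. *)
Lemma sampling_points (I : Type) (s : seq I) (w : I -> R)
    (c : I -> ('I_d -> R) -> R) (V e : R) (N : nat) :
  (forall i, 0 <= w i) -> (forall i, cont_fun (c i)) ->
  (forall i, cube_int (c i) = 0) ->
  (forall i, cube_int (fun x => c i x ^+ 2) <= V) -> 0 < e ->
  exists X : seq ('I_d -> R), [/\ size X = N, (forall k, unit_cube (nth (fun=> 0) X k)) &
    \sum_(i <- s) w i * (\sum_(y <- X) c i y) ^+ 2 <=
      N%:R * (V * (\sum_(i <- s) w i) + e)].
Proof.
move=> w0 cc c0 cV e0; elim: N => [|N [X [sX Xc ih]]].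
  exists [::]; split=> // [k|]; first by rewrite nth_nil; exact: unit_cube0.
  by rewrite mul0r big1// => i _; rewrite big_nil expr0n mulr0.
pose S i := \sum_(y <- X) c i y.
have cc2 i : cont_fun (fun x => c i x ^+ 2).
  by under eq_fun do rewrite expr2; exact: cont_funM.
pose F y := \sum_(i <- s) w i * (c i y ^+ 2 + (2 * S i * c i y + S i ^+ 2)).
have cterm i : cont_fun (fun y => 2 * S i * c i y + S i ^+ 2).
  by apply: cont_funD; [exact: cont_funZ|exact: cont_fun_cst].
have cterm2 i : cont_fun (fun y => c i y ^+ 2 + (2 * S i * c i y + S i ^+ 2)).
  exact: cont_funD.
have cF : cont_fun F by apply: cont_fun_sum => i; exact: cont_funZ.
have [y yc Fy] := cube_int_mean _ _ cF e0.
exists (y :: X); split; first by rewrite /= sX.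
  by case=> [|k] //=.
have -> : \sum_(i <- s) w i * (\sum_(z <- y :: X) c i z) ^+ 2 = F y.
  by apply: eq_bigr => i _; rewrite big_cons -/(S i); ring.
apply: (le_trans Fy); rewrite -natr1 mulrDl mul1r.
suff H : cube_int F <= \sum_(i <- s) w i * S i ^+ 2 + V * (\sum_(i <- s) w i).
  by rewrite (le_trans (lerD H (lexx e)))// -addrA lerD2r.
rewrite cube_int_sum => [|i]; last exact: cont_funZ.
rewrite mulr_sumr -big_split; apply: ler_sum => i _ /=.
rewrite cube_intZ// cube_intD// cube_intD//; [|exact: cont_funZ|exact: cont_fun_cst].
rewrite cube_intZ// c0 mulr0 add0r cube_int_cst.
by have := ler_wpM2l (w0 i) (cV i); lra.
Qed.

End Sampling.

(** * Error of the sampling algorithm *)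

Section SamplingUpperBound.
Context {R : realType} {d : nat} {g r : nat -> R}.
Hypothesis g_gt0 : forall j : nat, (0 < j)%N -> 0 < g j.
Hypothesis r_gt : forall j : nat, (0 < j)%N -> 1 / 2 < r j.
Implicit Types (f : ('I_d -> R) -> R) (h l : mindex d).

Local Notation eigval := (@eigval R d g r).
Local Notation eigsum := (@eigsum R d g r).

Lemma sqr_le_norm (x y : R) : 0 <= y -> x ^+ 2 <= y ^+ 2 -> `|x| <= y.
Proof.
by move=> y0 xy; rewrite -(ler_pXn2r (ltn0Sn 1)) ?nnegrE// real_normK ?num_real.
Qed.

Lemma sum_cas_sqr_le (A : seq (mindex d)) (x : 'I_d -> R) :
  \sum_(h <- A) cas h x ^+ 2 <= 2 * (size A)%:R.
Proof.
rewrite -sum1_size natr_sum mulr_sumr; apply: ler_sum => h _.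
by rewrite mulr1 cas_sqr_le2.
Qed.

Lemma hcoef_ball (f : ('I_d -> R) -> R) (D : seq (mindex d)) :
  unit_ball g r f -> uniq D ->
  \sum_(h <- D) hcoef f h ^+ 2 * weight g r h <= 1.
Proof.
move=> [[cf _ _] fb] uD; rewrite -lee_fin.
exact: le_trans (le_hnorm2 g_gt0 _ _ cf uD) fb.
Qed.

(** The residual has no coefficient in [B], so [pointwise_bound] applies with the eigenvalue tail,
    at most [t^2 / 2], and norm at most 1. *)
Lemma projection_error (f : ('I_d -> R) -> R) (B : seq (mindex d)) (t : R) y :
  unit_ball g r f -> uniq B -> 0 <= t ->
  eigsum - t ^+ 2 / 2 <= \sum_(h <- B) eigval h -> unit_cube y ->
  `|f y - trigpoly B (hcoef f) y| <= t.
Proof.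
move=> fb uB t0 Bt yc; have [[cf _ _] _] := fb.
pose F y := f y + (-1) * trigpoly B (hcoef f) y.
have cT := cont_fun_trigpoly B (hcoef f).
have cF : cont_fun F by apply: cont_funD => //; exact: cont_funZ.
have FE h : hcoef F h = if h \in B then 0 else hcoef f h.
  rewrite hcoefD//; last exact: cont_funZ.
  rewrite hcoefZ// hcoef_trigpoly//; case: ifP => _; first by rewrite mulN1r subrr.
  by rewrite mulr0 addr0.
apply: sqr_le_norm => //.
have -> : f y - trigpoly B (hcoef f) y = F y by rewrite /F mulN1r.
have -> : t ^+ 2 = 2 * (t ^+ 2 / 2) * 1 by field.
apply: (pointwise_bound g_gt0 (r := r)) => //.
- by rewrite divr_ge0// sqr_ge0.
- move=> D uD; apply: le_trans (hcoef_ball _ _ fb uD); apply: ler_sum => h _.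
  rewrite FE ler_wpM2r ?weight_ge0//; case: ifP => // _.
  by rewrite expr0n sqr_ge0.
- move=> D uD HD; apply: le_trans (sum_disjoint_le_eigsum g_gt0 r_gt _ _ uB uD _) _.
    by move=> h /HD; rewrite FE; case: ifP => //; rewrite eqxx.
  lra.
Qed.

(** The points are chosen to make the empirical Gram matrix of the basis close to the identity, a
    property free of [f], so they serve the whole unit ball. As the greedy choice controls finitely
    many entries, [f] is first replaced by its projection on a large box [B], up to a uniform error
    [t]. *)
Lemma sampling_error (A : seq (mindex d)) (N : nat) (e : R) : uniq A ->
  (0 < N)%N -> 0 < e ->
  exists X : seq ('I_d -> R), [/\ size X = N, (forall k, unit_cube (nth (fun=> 0) X k)) &
    forall f x, unit_ball g r f -> unit_cube x ->
    `|f x - \sum_(h <- A) (N%:R^-1 * \sum_(y <- X) f y * cas h y) * cas h x| <=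
    Num.sqrt (2 * (eigsum - \sum_(h <- A) eigval h)) +
    (size A)%:R * Num.sqrt (18 * eigsum / N%:R) + e].
Proof.
move=> uA N0 e0; set a : R := (size A)%:R; set del := eigsum - _.
have a0 : 0 <= a by rewrite ler0n.
have Nr0 : 0 < N%:R :> R by rewrite ltr0n.
(* Budget for [e]: the residual outside [B] contributes [t + 2 a t = e / 4], and the greedy slack
   [e'] at most [e / 2]. *)
pose t := e / (4 * (1 + 2 * a)).
have t0 : 0 < t by rewrite divr_gt0// mulr_gt0// ltr_pwDl// mulr_ge0.
have tE : 4 * (t + 2 * a * t) = e.
  by rewrite /t; field; rewrite gt_eqF// ltr_pwDl// mulr_ge0.
pose e' := e ^+ 2 * N%:R / (16 * (a + 1)).
have e'0 : 0 < e' by rewrite divr_gt0 ?mulr_gt0 ?exprn_gt0// ltr_wpDl.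
have [m0 _ AB0] := subset_box A 0.
have [m m0m Bt] := eigsum_approx (d := d) g_gt0 r_gt m0 (t ^+ 2 / 2) ltac:(by rewrite divr_gt0// exprn_gt0).
pose B := @box d m; have uB : uniq B by exact: box_uniq.
have AB : {subset A <= B} by move=> h /AB0; exact: box_subset.
pose s := [seq (h, l) | h <- A, l <- B].
pose w (p : mindex d * mindex d) := eigval p.2.
pose c (p : mindex d * mindex d) (x : 'I_d -> R) : R :=
  cas p.1 x * cas p.2 x + - (p.1 == p.2)%:R.
have ccas h l : cont_fun (fun x : 'I_d -> R => cas h x * cas l x).
  by apply: cont_funM; exact: cont_fun_cas.
have cc p : cont_fun (c p) by apply: cont_funD => //; exact: cont_fun_cst.
have c0 p : cube_int (c p) = 0.
  rewrite /c cube_intD//; last exact: cont_fun_cst.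
  by rewrite cas_orthonormal cube_int_cst subrr.
(* A product of two basis functions is at most 2 in modulus, and subtracting 0 or 1 leaves at most
   3. Combined with [sum_cas_sqr_le], this is the origin of 18. *)
have c9 p : cube_int (fun x => c p x ^+ 2) <= 9.
  apply: cube_int_le_cst; first by under eq_fun do rewrite expr2; exact: cont_funM.
  move=> x _; rewrite /c.
  have := cas_sqr_le2 p.1 x; have := cas_sqr_le2 p.2 x.
  have := sqr_ge0 (cas p.1 x - cas p.2 x); have := sqr_ge0 (cas p.1 x + cas p.2 x).
  case: (_ == _); rewrite /= ?mulr1n ?mulr0n; move: (cas _ _) (cas _ _) => u v; nra.
have w0 p : 0 <= w p by exact: eigval_ge0.
have [X [sX Xc XS]] := sampling_points _ s w c 9 e' N w0 cc c0 c9 e'0.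
exists X; split=> // f x fb xc.
have sumX (F : ('I_d -> R) -> R) : \sum_(y <- X) F y = \sum_(k < N) F (nth (fun=> 0) X k).
  by rewrite (big_nth (fun=> 0)) sX big_mkord.
pose rho y := f y - trigpoly B (hcoef f) y.
have rhot y : unit_cube y -> `|rho y| <= t.
  by move=> yc; apply: projection_error => //; exact: ltW.
pose G h l := N%:R^-1 * \sum_(y <- X) c (h, l) y.
pose rr h := N%:R^-1 * \sum_(y <- X) rho y * cas h y.
(* This is the aliasing error: what the other frequencies of [B] contribute to the estimate of
   coefficient [h] through the defect [G] of the empirical Gram matrix. [rr] is the contribution of
   the residual. *)
pose q h := \sum_(l <- B) hcoef f l * G h l.
have coefE h : h \in A -> N%:R^-1 * (\sum_(y <- X) f y * cas h y) =
    hcoef f h + q h + rr h.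
  move=> hA.
  have -> : hcoef f h + q h = \sum_(l <- B) hcoef f l * (N%:R^-1 * \sum_(y <- X) cas h y * cas l y).
    have -> : hcoef f h = \sum_(l <- B) hcoef f l * (h == l)%:R.
      rewrite (bigD1_seq h) ?AB//= eqxx mulr1 big1 ?addr0// => l.
      by rewrite eq_sym => /negPf ->; rewrite mulr0.
    rewrite -big_split; apply: eq_bigr => l _ /=; rewrite -mulrDr; congr (_ * _).
    rewrite /G /c /= big_split /= mulrDr [X in _ + (_ + _ * X)]sumX sumr_const card_ord.
    rewrite -[X in _ + (_ + _ * X)]mulr_natr; move: ((h == l)%:R : R) => b.
    by field; rewrite gt_eqF.
  rewrite /rr; under [in RHS]eq_bigr do rewrite mulrCA mulr_sumr.
  rewrite -mulr_sumr exchange_big -mulrDr -big_split /=; congr (_ * _).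
  apply: eq_bigr => y _; rewrite /rho /trigpoly mulrBl mulr_suml addrCA.
  rewrite (eq_bigr (fun l => hcoef f l * cas l y * cas h y)); last by move=> l _; ring.
  by rewrite subrr addr0.
pose D := [seq l <- B | l \notin A].
have uD : uniq D by exact: filter_uniq.
pose T2 := \sum_(l <- D) hcoef f l * cas l x.
pose T3 := \sum_(h <- A) q h * cas h x.
pose T4 := \sum_(h <- A) rr h * cas h x.
have -> : f x - \sum_(h <- A) (N%:R^-1 * \sum_(y <- X) f y * cas h y) * cas h x =
    rho x + T2 - T3 - T4.
  have -> : \sum_(h <- A) (N%:R^-1 * \sum_(y <- X) f y * cas h y) * cas h x =
      \sum_(h <- A) hcoef f h * cas h x + T3 + T4.
    rewrite -!big_split /= big_seq [RHS]big_seq; apply: eq_bigr => h /coefE ->.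
    by rewrite !mulrDl.
  have -> : rho x = f x - (\sum_(h <- A) hcoef f h * cas h x + T2).
    rewrite /rho /T2 big_filter /trigpoly (bigID (fun l => l \in A)) /=.
    by rewrite big_subset.
  ring.
have H2 : `|T2| <= Num.sqrt (2 * del).
  have del0 : 0 <= del by rewrite subr_ge0; exact: sum_le_eigsum.
  apply: sqr_le_norm; first exact: sqrtr_ge0.
  rewrite sqr_sqrtr ?mulr_ge0//.
  apply: (le_trans (weighted_cauchy_schwarz g_gt0 (r := r) _ _ _)).
  rewrite -[leRHS]mul1r; apply: ler_pM.
  - by apply: sumr_ge0 => h _; rewrite mulr_ge0 ?sqr_ge0 ?weight_ge0.
  - by apply: sumr_ge0 => h _; rewrite mulr_ge0 ?sqr_ge0 ?eigval_ge0.
  - exact: hcoef_ball.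
  apply: (@le_trans _ _ (2 * \sum_(h <- D) eigval h)).
    rewrite mulr_sumr; apply: ler_sum => h _.
    by rewrite mulrC ler_wpM2r ?eigval_ge0// cas_sqr_le2.
  rewrite ler_wpM2l//; apply: sum_disjoint_le_eigsum => // h.
  by rewrite mem_filter => /andP[].
have H3 : `|T3| <= a * Num.sqrt (18 * eigsum / N%:R) + e / 2.
  have es0 : 0 <= eigsum by apply: le_trans (eigsum_ge1 g_gt0 r_gt); exact: ler01.
  have z0 : 0 <= 18 * eigsum / N%:R by rewrite divr_ge0 ?mulr_ge0// ltW.
  have s0 := sqrtr_ge0 (18 * eigsum / N%:R).
  apply: sqr_le_norm; first by rewrite addr_ge0//; [exact: mulr_ge0|rewrite divr_ge0// ltW].
  apply: (@le_trans _ _ (a ^+ 2 * (18 * eigsum / N%:R) + e ^+ 2 / 4)); last first.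
    rewrite -[18 * eigsum / _ in leLHS]sqr_sqrtr//.
    have := mulr_ge0 (mulr_ge0 a0 s0) (ltW e0); nra.
  apply: (le_trans (cauchy_schwarz_sum _ _ _ _)).
  apply: (@le_trans _ _ (((9 * (a * eigsum) + e') / N%:R) * (2 * a))); last first.
    have -> : (9 * (a * eigsum) + e') / N%:R * (2 * a) =
        a ^+ 2 * (18 * eigsum / N%:R) + e' / N%:R * (2 * a).
      by field; rewrite gt_eqF.
    rewrite lerD2l /e' (_ : _ / N%:R * _ = e ^+ 2 * (a / (8 * (a + 1)))); last first.
      by field; rewrite !gt_eqF// ltr_wpDl.
    rewrite ler_wpM2l ?sqr_ge0// ler_pdivrMr ?mulr_gt0 ?ltr_wpDl//; lra.
  apply: ler_pM.
  - by apply: sumr_ge0 => h _; exact: sqr_ge0.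
  - by apply: sumr_ge0 => h _; exact: sqr_ge0.
  - apply: (@le_trans _ _ (\sum_(h <- A) \sum_(l <- B) eigval l * G h l ^+ 2)).
      apply: ler_sum => h _; rewrite /q.
      apply: (le_trans (weighted_cauchy_schwarz g_gt0 (r := r) _ _ _)).
      rewrite -[leRHS]mul1r ler_wpM2r ?hcoef_ball//.
      by apply: sumr_ge0 => l _; rewrite mulr_ge0 ?sqr_ge0 ?eigval_ge0.
    rewrite -(big_allpairs (F := fun p => eigval p.2 * G p.1 p.2 ^+ 2)) -/s.
    rewrite (eq_bigr (fun p => (N%:R^-1) ^+ 2 * (w p * (\sum_(y <- X) c p y) ^+ 2))); last first.
      by move=> [h l] _; rewrite /G /w exprMn /=; ring.
    rewrite -mulr_sumr; apply: le_trans (ler_wpM2l (sqr_ge0 _) XS) _.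
    rewrite [leLHS](_ : _ = (9 * (\sum_(i <- s) w i) + e') / N%:R); last first.
      by field; rewrite gt_eqF.
    rewrite ler_wpM2r ?invr_ge0 ?(ltW Nr0)// lerD2r ler_wpM2l//.
    rewrite big_allpairs /w /=.
    rewrite (eq_bigr (fun=> \sum_(l <- B) eigval l))// big_const_seq count_predT.
    rewrite iter_addr_0 -mulr_natl ler_wpM2l//.
    exact: sum_le_eigsum.
  - exact: sum_cas_sqr_le.
have H4 : `|T4| <= 2 * a * t.
  have r2 : Num.sqrt 2 * Num.sqrt 2 = 2 :> R by rewrite -expr2 sqr_sqrtr.
  have rb h : `|rr h| <= t * Num.sqrt 2.
    rewrite /rr normrM ger0_norm ?invr_ge0 ?(ltW Nr0)// mulrC ler_pdivrMr//.
    rewrite sumX (le_trans (ler_norm_sum _ _ _))//.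
    have -> : t * Num.sqrt 2 * N%:R = \sum_(k < N) t * Num.sqrt 2.
      by rewrite sumr_const card_ord mulr_natr.
    apply: ler_sum => k _; rewrite normrM ler_pM ?norm_cas_le//.
    exact: rhot.
  rewrite /T4 (le_trans (ler_norm_sum _ _ _))//.
  have -> : 2 * a * t = \sum_(h <- A) 2 * t.
    rewrite big_const_seq count_predT iter_addr_0 -mulr_natr /a; ring.
  apply: ler_sum => h _; rewrite normrM -r2 mulrAC [Num.sqrt 2 * t]mulrC.
  by rewrite ler_pM ?norm_cas_le ?rb.
have H1 := rhot x xc.
have HH : `|rho x + T2 - T3 - T4| <= `|rho x| + `|T2| + `|T3| + `|T4|.
  rewrite (le_trans (ler_normB _ _))// lerD2r (le_trans (ler_normB _ _))// lerD2r.
  exact: ler_normD.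
apply: (le_trans HH); lra.
Qed.

Lemma nth_err_le Lam (A : seq (mindex d)) (N : nat) : uniq A -> (0 < N)%N ->
  (nth_err g r Lam N d <= (Num.sqrt (2 * (eigsum - \sum_(h <- A) eigval h)) +
    (size A)%:R * Num.sqrt (18 * eigsum / N%:R))%:E)%E.
Proof.
move=> uA N0; apply/lee_addgt0Pr => e e0.
have [X [sX Xc HX]] := sampling_error A N e uA N0 e0.
rewrite /nth_err gtn_eqF//.
pose L (k : 'I_N) (f : ('I_d -> R) -> R) := f (nth (fun=> 0) X k).
pose phi (y : 'I_N -> R) (x : 'I_d -> R) : R :=
  \sum_(h <- A) (N%:R^-1 * \sum_(k < N) y k * cas h (nth (fun=> 0) X k)) * cas h x.
apply: (@le_trans _ _ (wc_err g r L phi)).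
  apply: ereal_inf_lbound; exists L, phi; split=> // k.
  by apply: admissible_eval.
apply: ge_ereal_sup => _ [f [x [fb xc ->]]]; rewrite -EFinD lee_fin.
apply: le_trans (HX f x fb xc); rewrite le_eqVlt; apply/orP; left; apply/eqP.
congr (`| _ - _ |); apply: eq_bigr => h _; congr (_ * _ * _).
by rewrite (big_nth (fun=> 0)) sX big_mkord.
Qed.

End SamplingUpperBound.

(** * From errors to information complexity *)

Section InformationComplexity.
Context {R : realType} {g r : nat -> R}.
Hypothesis g_gt0 : forall j : nat, (0 < j)%N -> 0 < g j.
Hypothesis r_gt : forall j : nat, (0 < j)%N -> 1 / 2 < r j.

Local Notation eigval := (@eigval R _ g r).
Local Notation eigsum d := (@eigsum R d g r).

(** The infimum over algorithms need not be attained, hence the slack [k], removed at the end. For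
    [n = 0] the initial error is the error of the zero algorithm with an empty list of
    functionals. *)
Lemma nth_err_lower_bound Lam d n (A : seq (mindex d)) (mu : mindex d -> R)
    (M e : R) : uniq A ->
  (forall h, h \in A -> [/\ 0 <= mu h, mu h <= eigval h & mu h <= M]) ->
  0 <= M -> 0 <= e -> (nth_err g r Lam n d <= e%:E)%E ->
  \sum_(h <- A) mu h - n%:R * M <= e ^+ 2.
Proof.
move=> uA hmu M0 e0 ne; set X := _ - _.
suff H (k : R) : 0 < k -> X <= (e + k) ^+ 2.
  have [X0|X0] := lerP X 0; first exact: le_trans (sqr_ge0 e).
  rewrite -[X]sqr_sqrtr ?(ltW X0)// lerXn2r ?nnegrE ?sqrtr_ge0//.
  apply/ler_addgt0Pr => k k0.
  by rewrite -[leRHS]ger0_norm ?addr_ge0 ?(ltW k0)// -sqrtr_sqr ler_wsqrtr// H.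
move=> k0; have ek0 : 0 <= e + k by rewrite addr_ge0// ltW.
move: ne; rewrite /nth_err; case: ifPn => [/eqP n0 ie|n0 ie].
  pose L (i : 'I_n) (f : ('I_d -> R) -> R) : R := f (fun=> 0).
  apply: (linear_information_lower_bound g_gt0 (r := r) Lam n L (fun _ _ => 0)) => //.
    by move=> i; rewrite /L; apply: admissible_eval => //; exact: unit_cube0.
  move=> f x fb xc; rewrite subr0 -lee_fin.
  apply: le_trans (le_trans ie _); last by rewrite lee_fin lerDl ltW.
  by apply: ereal_sup_ubound; exists f, x.
have [_ [L [phi [aL ->]]] wlt] : exists2 y, [set z | exists L phi,
    (forall i, admissible g r Lam (L i)) /\ z = @wc_err R g r d n L phi] y & (y < (e + k)%:E)%E.
  by apply: ereal_inf_lt; apply: le_lt_trans ie _; rewrite lte_fin ltrDl.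
apply: (linear_information_lower_bound g_gt0 (r := r) Lam n L phi) => //.
move=> f x fb xc; rewrite -lee_fin; apply: le_trans (ltW wlt).
by apply: ereal_sup_ubound; exists f, x.
Qed.

(** The frequencies with exactly [m] entries 1 and the others 0 have eigenvalues that are products
    of [m] weights. Lowering all of them to [b^m] makes the sum and the maximum explicit. *)
Lemma nth_err_draws Lam d n m (b e : R) : 0 < b -> b <= 1 ->
  (forall k : 'I_d, b <= g k.+1) ->
  0 <= e -> (nth_err g r Lam n d <= e%:E)%E ->
  b ^+ m * ('C(d, m)%:R - n%:R) <= e ^+ 2.
Proof.
move=> b0 b1 bg e0 ne.
pose ind (T : {set 'I_d}) : mindex d := [ffun k => ((k \in T) : nat)%:Z].
pose A := [seq ind T | T <- enum [set T : {set 'I_d} | #|T| == m]%SET].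
have uA : uniq A.
  rewrite map_inj_uniq ?enum_uniq// => T U /ffunP ST; apply/setP => k.
  by have := ST k; rewrite !ffunE; case: (k \in T) (k \in U) => [] [].
have sA : size A = 'C(d, m) by rewrite size_map -cardE card_draws card_ord.
have := nth_err_lower_bound Lam d n A (fun=> b ^+ m) (b ^+ m) e uA _ _ e0 ne.
rewrite big_const_seq count_predT iter_addr_0 sA -[b ^+ m *+ 'C(d, m)]mulr_natr mulrBr.
rewrite [b ^+ m * n%:R]mulrC; apply; last by rewrite exprn_ge0// ltW.
move=> h /mapP[T + ->]; rewrite mem_enum inE => /eqP Tm.
split=> //; first by rewrite exprn_ge0// ltW.
rewrite eigval_prod (bigID (fun k => k \in T)) /= [X in _ * X]big1 ?mulr1; last first.
  by move=> k /negPf kT; rewrite /eigval1 ffunE kT eqxx.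
rewrite -Tm -prodr_const; apply: ler_prod => k kT.
by rewrite (ltW b0) /= /eigval1 ffunE kT /= normr1 powR1 mulr1.
Qed.

Lemma init_err_bounds d : exists2 e0 : R, init_err g r d = e0%:E &
  1 <= e0 <= Num.sqrt (2 * eigsum d).
Proof.
have i1 := init_err_le (d := d) g_gt0 r_gt.
have i2 := init_err_ge (d := d) (r := r) g_gt0 0.
have fin : init_err g r d \is a fin_num.
  by rewrite fin_numElt (lt_le_trans _ i2) ?ltNyr// (le_lt_trans i1) ?ltry.
exists (fine (init_err g r d)); first by rewrite fineK.
rewrite -!lee_fin fineK// i1 andbT; apply: le_trans i2.
by rewrite lee_fin -[leLHS]sqrtr1 ler_wsqrtr// sum_box_ge1.
Qed.

Lemma ncomp_le_nat Lam c (eps : R) d N :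
  (nth_err g r Lam N d <= eps%:E * CRI g r c d)%E ->
  (ncomp g r Lam c eps d <= N%:R%:E)%E.
Proof. by move=> H; apply: ereal_inf_lbound; exists N. Qed.

Lemma le_ncomp Lam c (eps X : R) d :
  (forall n, (nth_err g r Lam n d <= eps%:E * CRI g r c d)%E -> X <= n%:R) ->
  (X%:E <= ncomp g r Lam c eps d)%E.
Proof.
by move=> H; apply: le_ereal_inf_tmp => _ [n /H nX <-]; rewrite lee_fin.
Qed.

Lemma ncomp_NOR_le_ABS Lam (eps : R) d : 0 < eps ->
  (ncomp g r Lam NOR eps d <= ncomp g r Lam ABS eps d)%E.
Proof.
move=> e0; apply: le_ereal_inf_tmp => _ [n nH <-]; apply: ncomp_le_nat.
apply: le_trans nH _; rewrite /= lee_pmul2l ?lte_fin//.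
by have [i -> /andP[i1 _]] := init_err_bounds d; rewrite lee_fin.
Qed.

(** Zero samples never suffice, as the initial error is at least 1. This makes the logarithm of the
    complexity nonnegative. *)
Lemma ncomp_ge1 Lam c (eps : R) d : 0 < eps < 1 ->
  (1 <= ncomp g r Lam c eps d)%E.
Proof.
move=> /andP[e0 e1]; apply: le_ncomp => -[|n]; last by rewrite ler1n.
rewrite /nth_err eqxx; have [i ie /andP[i1 _]] := init_err_bounds d.
have i0 : 0 < i by exact: lt_le_trans i1.
case: c => /=; rewrite ie ?mule1 -?EFinM lee_fin => H; exfalso; nra.
Qed.

(** Both bounds are Markov's inequality for the exponent [1 - s]: above the level, [q^(1 - s)] is at
    most [mu^(1 - s)]; below it, [mu = mu^s mu^(1 - s)] is at most [q^s mu^(1 - s)]. *)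
Lemma level_set d m (s q : R) (A := [seq h <- @box d m | q < eigval h])
    (S := \sum_(h <- @box d m) eigval h `^ (1 - s)) :
  0 < q -> 0 < s < 1 ->
  (size A)%:R <= S * q `^ (- (1 - s)) /\
  \sum_(h <- @box d m) eigval h -
  \sum_(h <- A) eigval h <= q `^ s * S.
Proof.
move=> q0 /andP[s0 s1].
have sumID (F : mindex d -> R) : \sum_(h <- @box d m) F h =
    \sum_(h <- A) F h + \sum_(h <- @box d m | ~~ (q < eigval h)) F h.
  by rewrite /A big_filter (bigID (fun h : mindex d => q < eigval h)).
split.
  rewrite powRN -ler_pdivrMr ?invr_gt0 ?powR_gt0// invrK -sum1_size natr_sum mulr_suml.
  rewrite /S sumID.
  apply: (@le_trans _ _ (\sum_(h <- A) eigval h `^ (1 - s))).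
    rewrite big_seq [leRHS]big_seq; apply: ler_sum => h; rewrite mem_filter => /andP[qh _].
    rewrite mul1r ge0_ler_powR ?nnegrE ?subr_ge0 ?(ltW s1) ?(ltW q0) ?(ltW qh)//.
    exact: eigval_ge0.
  by rewrite lerDl sumr_ge0// => h _; exact: powR_ge0.
rewrite sumID addrAC subrr add0r /S mulr_sumr sumID -[leLHS]add0r lerD//.
  by apply: sumr_ge0 => h _; rewrite mulr_ge0 ?powR_ge0.
apply: ler_sum => h; rewrite -leNgt => hq.
have h0 := eigval_gt0 g_gt0 (r := r) h.
rewrite -[leLHS]powRr1 ?(ltW h0)// -[1 in leLHS](subrKC s) powRD ?(gt_eqF h0) ?implybT//.
rewrite ler_wpM2r ?powR_ge0// ge0_ler_powR ?nnegrE ?(ltW s0) ?(ltW q0) ?(ltW h0)//.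
Qed.

(* The cut-off [q] is chosen so that the discarded eigenvalues contribute
   [E ^+ 2 / 16]. *)
Lemma nth_err_target Lam d m N (s E : R)
    (S := \sum_(h <- @box d m) eigval h `^ (1 - s)) :
  0 < s < 1 -> 0 < E -> (0 < N)%N ->
  eigsum d - E ^+ 2 / 16 <=
    \sum_(h <- @box d m) eigval h ->
  72 * eigsum d / E ^+ 2 *
    expR (s^-1 * (2 * ln S) + (s^-1 - 1) * (2 * ln (16 / E ^+ 2))) <= N%:R ->
  (nth_err g r Lam N d <= E%:E)%E.
Proof.
move=> s01 E0 N0 tail HN; have /andP[s0 s1] := s01.
have E2 : 0 < E ^+ 2 by rewrite exprn_gt0.
have S0 : 0 < S.
  have h0 : 0 \in @box d m by rewrite mem_box; apply/forallP => k; rewrite ffunE.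
  rewrite /S (bigD1_seq 0) ?box_uniq//= ltr_pwDl ?sumr_ge0//.
    exact/powR_gt0/eigval_gt0.
  by move=> h _; exact: powR_ge0.
pose q := (E ^+ 2 / (16 * S)) `^ s^-1.
have b0 : 0 < E ^+ 2 / (16 * S) by rewrite divr_gt0 ?mulr_gt0.
have q0 : 0 < q by exact: powR_gt0.
have [] := level_set d m s q q0 s01; set A := [seq h <- _ | _]; rewrite -/S => sA tA.
have qs : q `^ s = E ^+ 2 / (16 * S).
  by rewrite /q -powRrM mulVf ?gt_eqF// powRr1// ltW.
have uA : uniq A by rewrite filter_uniq// box_uniq.
have es1 : 1 <= eigsum d by exact: eigsum_ge1.
apply: (le_trans (nth_err_le g_gt0 r_gt Lam A N uA N0)).
(* Half of [E] goes to each part. Truncation leaves [E^2 / 16] outside the box and [E^2 / 16] below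
   the level, and twice their sum is [(E / 2)^2]. The sampling part requires
   [18 K^2 eigsum / N <= E^2 / 4], whence 72. *)
rewrite lee_fin [leRHS]splitr lerD//.
  rewrite -[leRHS]ger0_norm ?divr_ge0 ?(ltW E0)// -sqrtr_sqr ler_wsqrtr//.
  have qS : q `^ s * S = E ^+ 2 / 16 by rewrite qs; field; rewrite gt_eqF.
  rewrite qS in tA; rewrite expr_div_n; lra.
set K := S * q `^ (- (1 - s)) in sA.
have K2 : K ^+ 2 = expR (s^-1 * (2 * ln S) + (s^-1 - 1) * (2 * ln (16 / E ^+ 2))).
  have -> : ln (16 / E ^+ 2) = ln 16 - ln (E ^+ 2).
    by rewrite lnM ?posrE ?invr_gt0// lnV.
  rewrite /K /q -powRrM -{1}(lnK S0) /powR gt_eqF// -expRD expr2 -expRD; congr expR.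
  rewrite lnM ?posrE ?invr_gt0 ?mulr_gt0// lnV ?posrE ?mulr_gt0// lnM ?posrE//.
  by move: (ln (E ^+ 2)) (ln 16) (ln S) => x y z; field; rewrite gt_eqF.
have K0 : 0 <= K by rewrite mulr_ge0 ?powR_ge0// ltW.
apply: (@le_trans _ _ (K * Num.sqrt (18 * eigsum d / N%:R))).
  by rewrite ler_wpM2r ?sqrtr_ge0.
rewrite -[K]ger0_norm// -sqrtr_sqr -sqrtrM ?sqr_ge0//.
rewrite -[leRHS]ger0_norm ?divr_ge0 ?(ltW E0)// -sqrtr_sqr ler_wsqrtr//.
rewrite mulrA ler_pdivrMr ?ltr0n//.
move: HN; rewrite -K2 mulrAC ler_pdivrMr// expr_div_n; lra.
Qed.

End InformationComplexity.

(** * Scalar estimates for powers with exponent near 1 *)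

Section ScalarEstimates.
Context {R : realType}.
Implicit Types (x s t : R).

Lemma lnp_ge1 x : 1 <= lnp x.
Proof. by rewrite /lnp le_max lexx. Qed.

Lemma ln_le_lnp x : ln x <= lnp x.
Proof. by rewrite /lnp le_max lexx orbT. Qed.

Lemma lnp_inv_le x : 0 < x <= 1 -> lnp (1 / x) <= 1 - ln x.
Proof.
move=> /andP[x0 x1]; rewrite /lnp div1r lnV ?posrE// ge_max.
by have := ln_le0 x1; lra.
Qed.

Lemma expRN_le_inv (y : R) : 0 <= y -> expR (- y) <= (1 + y)^-1.
Proof.
move=> y0; rewrite expRN lef_pV2 ?posrE ?expR_gt0 ?expR_ge1Dx//; lra.
Qed.

Lemma powR_lnE x t : 0 < x -> x `^ t = expR (t * ln x).
Proof. by move=> x0; rewrite /powR gt_eqF. Qed.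

(** Together with [ln_large] this splits the weights at [d^(-2)]: for smaller ones, d terms of size
    [sqrt x] add up to a constant; for larger ones, [- ln x] is of order [lnp d], and a power with
    exponent of order [1 / lnp d] is comparable to 1. *)
Lemma sqrt_small x (d : nat) : (0 < d)%N -> 0 < x -> x < d%:R ^- 2 ->
  Num.sqrt x <= d%:R^-1.
Proof.
move=> d0 x0 xd; rewrite -[leRHS]ger0_norm ?invr_ge0// -sqrtr_sqr ler_wsqrtr//.
by rewrite exprVn ltW.
Qed.

Lemma ln_large x (d : nat) : (0 < d)%N -> 0 < x -> d%:R ^- 2 <= x ->
  - ln x <= 2 * lnp d%:R.
Proof.
move=> d0 x0 dx; have dr0 : 0 < d%:R :> R by rewrite ltr0n.
have : ln (d%:R ^- 2) <= ln x by rewrite ler_ln// posrE invr_gt0 exprn_gt0.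
rewrite lnV ?posrE ?exprn_gt0// expr2 lnM ?posrE//.
have := ln_le_lnp (d%:R : R); lra.
Qed.

(** For [x >= d^(-2)] the number [y = - s ln x] lies in [0, 2], where [exp (- y) <= 1 - y / 3]; the
    term [s x] covers the 1 in [lnp (1 / x) <= 1 - ln x]. For smaller [x] the entropy term is at
    most [3 sqrt x], and the left side is not positive. *)
Lemma entropy_term_lower x s (d : nat) : (0 < d)%N -> 0 < x <= 1 ->
  s = (lnp d%:R)^-1 ->
  s / 3 * (x * lnp (1 / x) - 3 / d%:R) <= x * (1 - x `^ s) + s * x.
Proof.
move=> d0 x01 sE; have /andP[x0 x1] := x01; have L1 := lnp_ge1 (d%:R : R).
have s0 : 0 < s by rewrite sE invr_gt0 (lt_le_trans _ L1).
have dr0 : 0 < d%:R :> R by rewrite ltr0n.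
have lx := ln_le0 x1; have hp := lnp_inv_le x x01.
have [xd|xd] := lerP (d%:R ^- 2) x.
  pose y := s * - ln x.
  have y0 : 0 <= y by rewrite /y mulr_ge0 ?(ltW s0)// oppr_ge0.
  have y2 : y <= 2.
    rewrite /y sE mulrC ler_pdivrMr ?(lt_le_trans _ L1)//; exact: ln_large.
  have e1 : x `^ s <= 1 - y / 3.
    rewrite powR_lnE// -[s * ln x]opprK -mulrN -/y.
    apply: (le_trans (expRN_le_inv _ y0)).
    by rewrite -(ler_pM2r (x := 1 + y)) ?mulVf ?gt_eqF ?ltr_pwDl//; nra.
  have d3 : 0 <= s / 3 * (3 / d%:R) by rewrite mulr_ge0 ?divr_ge0// ltW.
  have h1 : s / 3 * (x * lnp (1 / x)) <= s / 3 * x + x * (y / 3).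
    rewrite (_ : s / 3 * x + _ = s / 3 * (x * (1 - ln x))); last by rewrite /y; ring.
    by rewrite !ler_wpM2l ?divr_ge0// ltW.
  have h2 : x * (y / 3) <= x * (1 - x `^ s) by rewrite ler_wpM2l ?(ltW x0)//; lra.
  have h3 : 0 <= s * x by rewrite mulr_ge0// ltW.
  rewrite mulrBr; lra.
have sx := sqrt_small _ _ d0 x0 xd.
have xs : x = Num.sqrt x ^+ 2 by rewrite sqr_sqrtr// ltW.
have q0 : 0 < Num.sqrt x by rewrite sqrtr_gt0.
have q1 : Num.sqrt x <= 1 by rewrite -[leRHS]sqrtr1 ler_wsqrtr.
have lb : - ln x <= 2 / Num.sqrt x.
  rewrite {1}xs expr2 lnM ?posrE//.
  have := ln_le_sub1 (Num.sqrt x)^-1; rewrite invr_gt0 => /(_ q0).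
  rewrite lnV ?posrE//; lra.
have h : x * lnp (1 / x) <= 3 / d%:R.
  apply: (@le_trans _ _ (x * (1 + 2 / Num.sqrt x))).
    by rewrite ler_wpM2l ?(ltW x0)//; lra.
  apply: (@le_trans _ _ (3 * Num.sqrt x)); last by rewrite ler_wpM2l.
  rewrite {1}xs; move: (Num.sqrt x) q0 q1 => q q0 q1.
  rewrite (_ : q ^+ 2 * (1 + 2 / q) = q ^+ 2 + 2 * q); last by field; rewrite gt_eqF.
  nra.
apply: (@le_trans _ _ 0).
  by rewrite pmulr_rle0 ?divr_gt0// subr_le0.
apply: addr_ge0; apply: mulr_ge0; rewrite ?(ltW x0) ?(ltW s0)//.
by rewrite subr_ge0 powR_lnE// -expR0 ler_expR pmulr_rle0.
Qed.

(** For [x >= d^(-2)] the choice of [s] gives [x^(- s) <= e]; below, [x^(3/4)] times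
    [lnp (1 / x) <= 5 x^(-1/4)] is at most [5 sqrt x]. *)
Lemma powR_lnp_term_upper x s s0 (d : nat) : (0 < d)%N -> 0 < x <= 1 ->
  0 < s0 <= 1 / 4 -> s = s0 / lnp d%:R ->
  x `^ (1 - s) * lnp (1 / x) <= expR 1 * (x * lnp (1 / x)) + 5 / d%:R.
Proof.
move=> d0 x01 /andP[s00 s04] sE; have /andP[x0 x1] := x01; have L1 := lnp_ge1 (d%:R : R).
have L0 : 0 < lnp (d%:R : R) by rewrite (lt_le_trans _ L1).
have sp : 0 < s by rewrite sE divr_gt0.
have s4 : s <= 1 / 4.
  by apply: le_trans s04; rewrite sE ler_pdivrMr// ler_peMr// ltW.
have dr0 : 0 < d%:R :> R by rewrite ltr0n.
have lx := ln_le0 x1; have hp := lnp_inv_le x x01.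
have l0 : 0 <= lnp (1 / x) by rewrite (le_trans _ (lnp_ge1 _)).
have [xd|xd] := lerP (d%:R ^- 2) x.
  apply: (@le_trans _ _ (expR 1 * (x * lnp (1 / x)))); last by rewrite lerDl divr_ge0// ltW.
  rewrite mulrA ler_wpM2r// powR_lnE// -{2}(lnK (x := x)) ?posrE// -expRD ler_expR.
  have : s * - ln x <= 1.
    have := ln_large _ _ d0 x0 xd => h.
    apply: (@le_trans _ _ (s * (2 * lnp d%:R))); first by rewrite ler_wpM2l// ltW.
    by rewrite sE [2 * _]mulrC mulrA divfK ?gt_eqF//; lra.
  lra.
have sx := sqrt_small _ _ d0 x0 xd.
apply: (@le_trans _ _ (5 * Num.sqrt x)); last first.
  apply: (@le_trans _ _ (5 / d%:R)); first by rewrite ler_wpM2l.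
  by rewrite lerDr !mulr_ge0 ?expR_ge0// ltW.
pose v := expR (- (1 / 4) * ln x).
have v1 : 1 <= v by rewrite /v -[leLHS]expR0 ler_expR; lra.
have lv : lnp (1 / x) <= 5 * v.
  have := ln_le_sub1 v (expR_gt0 _); rewrite /v expRK -/v; lra.
have a1 : x `^ (1 - s) <= expR (3 / 4 * ln x).
  by rewrite powR_lnE// ler_expR; nra.
apply: (@le_trans _ _ (expR (3 / 4 * ln x) * (5 * v))).
  by apply: ler_pM => //; exact: powR_ge0.
have -> : Num.sqrt x = expR (1 / 2 * ln x).
  by rewrite -powR12_sqrt ?(ltW x0)// powR_lnE// div1r.
rewrite mulrCA ler_wpM2l// /v -expRD ler_expR; lra.
Qed.

Lemma powR_diff_le x s : 0 < x <= 1 -> 0 < s ->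
  s^-1 * (x `^ (1 - s) - x) <= x `^ (1 - s) * - ln x.
Proof.
move=> /andP[x0 x1] s0.
have xE : x = x `^ (1 - s) * expR (s * ln x).
  by rewrite powR_lnE// -expRD (_ : _ + _ = ln x) ?lnK ?posrE//; ring.
rewrite {2}xE mulrC ler_pdivrMr// -{1}[x `^ _]mulr1 -mulrBr -mulrA.
rewrite ler_wpM2l ?powR_ge0//.
have := expR_ge1Dx (s * ln x); lra.
Qed.

Lemma ln1D_ge x : 0 <= x -> x / (1 + x) <= ln (1 + x).
Proof.
move=> x0; have p : 0 < 1 + x by rewrite ltr_pwDl.
have := ln_le_sub1 (1 + x)^-1; rewrite invr_gt0 => /(_ p); rewrite lnV ?posrE//.
have -> : x / (1 + x) = 1 - (1 + x)^-1 by field; rewrite gt_eqF.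
lra.
Qed.

Lemma nat_upper (x : R) : 0 <= x -> exists N : nat,
  [/\ (0 < N)%N, x <= N%:R & N%:R <= x + 1].
Proof.
move=> x0; have /andP[a b] := truncn_itv x0.
by exists (Num.truncn x).+1; split=> //; [exact: ltW|rewrite -natr1 lerD2r].
Qed.

Lemma sum_ord_shift (d : nat) (F : nat -> R) :
  \sum_(1 <= j < d.+1) F j = \sum_(k < d) F k.+1.
Proof. by rewrite big_add1 big_mkord. Qed.

Lemma prod_le_expR (d : nat) (F G : 'I_d -> R) : (forall k, 0 <= F k) ->
  (forall k, F k <= expR (G k)) -> \prod_k F k <= expR (\sum_k G k).
Proof.
move=> F0 FG; rewrite expR_sum; apply: ler_prod => k _.
by rewrite F0 FG.
Qed.

End ScalarEstimates.

(** * Upper bounds for the complexity *)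

Section ComplexityBounds.
Context {R : realType} {g r : nat -> R}.
Hypothesis g1_le1 : g 1%N <= 1.
Hypothesis g_noninc : forall j : nat, (0 < j)%N -> g j.+1 <= g j.
Hypothesis g_gt0 : forall j : nat, (0 < j)%N -> 0 < g j.
Hypothesis r1_gt : 1 / 2 < r 1%N.
Hypothesis r_nondec : forall j : nat, (0 < j)%N -> r j <= r j.+1.

Local Notation eigval := (@eigval R _ g r).
Local Notation eigsum d := (@eigsum R d g r).

Lemma g_anti i j : (0 < i)%N -> (i <= j)%N -> g j <= g i.
Proof.
move=> i0 ij; rewrite -(subnK ij); elim: (j - i)%N => // n ih.
by rewrite addSn (le_trans (g_noninc _ _))// addn_gt0 i0 orbT.
Qed.

Lemma g_in01 j : (0 < j)%N -> 0 < g j <= 1.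
Proof. by move=> j0; rewrite g_gt0//= (le_trans (g_anti 1 j _ _)). Qed.

Lemma r_ge1 j : (0 < j)%N -> r 1%N <= r j.
Proof. by case: j => // j _; elim: j => // j ih; apply: le_trans ih (r_nondec _ _). Qed.

Lemma r_gt j : (0 < j)%N -> 1 / 2 < r j.
Proof. by move=> /r_ge1; exact: lt_le_trans. Qed.

(** Chosen so that [2 r_1 (1 - 2 s0) = r_1 + 1/2 > 1]; then [Z] bounds all zeta sums with exponent
    [2 r_j (1 - s)], [s <= 2 s0], uniformly in [j]. One [s0] is available for [s], the other absorbs
    a logarithm of the frequency in [eigen_ratio_term]. *)
Let s0 : R := (1 - (2 * r 1%N)^-1) / 4.
Let Z : R := (r 1%N + 1 / 2) / (r 1%N + 1 / 2 - 1).

Let s0_bounds : 0 < s0 <= 1 / 4.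
Proof.
have i1 : (2 * r 1%N)^-1 < 1 by rewrite invf_lt1; have := r1_gt; lra.
have i0 : 0 < (2 * r 1%N)^-1 by rewrite invr_gt0; have := r1_gt; lra.
by rewrite /s0; lra.
Qed.

Let zsum_leZ j (t : R) m : (0 < j)%N -> 1 - 2 * s0 <= t -> zsum (2 * r j * t) m <= Z.
Proof.
move=> j0 ht; have rj := r_ge1 _ j0; have rh := r1_gt; have /andP[s00 s04] := s0_bounds.
apply: (@le_trans _ _ (zsum (r 1%N + 1 / 2) m)); last by apply: zsum_bound; lra.
apply: zsum_anti; apply: (@le_trans _ _ (2 * r 1%N * (1 - 2 * s0))).
  by rewrite /s0 le_eqVlt; apply/orP; left; apply/eqP; field; lra.
by apply: ler_pM => //; lra.
Qed.

Let Z_ge1 : 1 <= Z.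
Proof. by rewrite /Z ler_pdivlMr; have := r1_gt; lra. Qed.

Lemma sum_box_powR_le d m (s : R) : 0 <= s -> s <= s0 ->
  \sum_(h <- @box d m) eigval h `^ (1 - s) <=
  expR (2 * Z * \sum_(k < d) g k.+1 `^ (1 - s)).
Proof.
move=> sge sle; have /andP[s00 s04] := s0_bounds; have Z1 := Z_ge1.
rewrite sum_box_eigval_powR// mulr_sumr; apply: prod_le_expR => k.
  by rewrite addr_ge0// !mulr_ge0 ?powR_ge0 ?zsum_ge0.
apply: le_trans (expR_ge1Dx _); rewrite lerD2l.
have zZ : zsum (2 * r k.+1 * (1 - s)) m <= Z by apply: zsum_leZ => //; lra.
rewrite mulrAC ler_wpM2r ?powR_ge0// ler_wpM2l//.
Qed.

Lemma g_le_powR k (s : R) : 0 <= s -> s <= 1 -> g k.+1 <= g k.+1 `^ (1 - s).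
Proof.
move=> sge s1; have /andP[g0 gl] := g_in01 k.+1 isT.
rewrite -[leLHS]powRr1 ?(ltW g0)// !powR_lnE// ler_expR ler_wnM2r//; first exact: ln_le0.
lra.
Qed.

Lemma eigsum_le d : eigsum d <= expR (2 * Z * \sum_(k < d) g k.+1).
Proof.
have /andP[s00 s04] := s0_bounds.
apply: ge_sup; first by exists (\sum_(h <- @box d 0) eigval h); exists 0%N.
move=> _ [m _ <-]; have := sum_box_powR_le d m 0 (lexx 0) (ltW s00).
rewrite subr0; under eq_bigr do rewrite powRr1 ?eigval_ge0//.
by under [X in expR (_ * X)]eq_bigr do rewrite powRr1 ?(ltW (g_gt0 _ _))//.
Qed.

Lemma eigsum_le_expR : exists2 C : R, 0 < C &
  forall d, eigsum d <= expR (C * \sum_(k < d) g k.+1).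
Proof. by exists (2 * Z); [have := Z_ge1; lra|exact: eigsum_le]. Qed.

(** Both [eigsum] and [S] are exponentials of sums of [g^(1 - s)]. The exponent [s] stays free: a
    constant suits bounded sums or weights tending to 0, while for [t < 1] it will be of order
    [1 / lnp d]. *)
Lemma ncomp_ABS_upper : exists s1 C : R, [/\ 0 < s1, s1 <= 1 / 4, 0 < C &
  forall Lam s d eps, 0 < s -> s <= s1 -> 0 < eps < 1 ->
  (ncomp g r Lam ABS eps d <=
    (expR (C / s * (1 + ln eps^-1 + \sum_(k < d) g k.+1 `^ (1 - s))))%:E)%E].
Proof.
have /andP[s00 s04] := s0_bounds; have Z1 := Z_ge1.
have l16 : 0 <= ln (16 : R) by rewrite ln_ge0// ler1n.
have l73 : 0 <= ln (73 : R) by rewrite ln_ge0// ler1n.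
exists s0, (6 * Z + 6 + 2 * ln 16 + ln 73); split=> //; first lra.
move=> Lam s d eps sp sle /andP[e0 e1].
set l := ln eps^-1; set Sg := \sum_(k < d) _.
have l0 : 0 <= l by rewrite ln_ge0// invf_ge1// ltW.
have Sg0 : 0 <= Sg by apply: sumr_ge0 => k _; exact: powR_ge0.
have [m _ tail] := eigsum_approx (d := d) g_gt0 r_gt 0 (eps ^+ 2 / 16)
  ltac:(by rewrite divr_gt0// exprn_gt0).
set S := \sum_(h <- @box d m) eigval h `^ (1 - s).
set X := 72 * eigsum d / eps ^+ 2 *
  expR (s^-1 * (2 * ln S) + (s^-1 - 1) * (2 * ln (16 / eps ^+ 2))).
have es1 := eigsum_ge1 (d := d) g_gt0 r_gt.
have es0 : 0 < eigsum d by apply: lt_le_trans es1.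
have X0 : 0 <= X.
  by rewrite mulr_ge0 ?expR_ge0// divr_ge0 ?exprn_ge0 ?mulr_ge0// ltW.
have [N [N0 XN NX]] := nat_upper X X0.
have s01 : 0 < s < 1 by lra.
have nN := nth_err_target g_gt0 r_gt Lam d m N s eps s01 e0 N0 (ltW tail) XN.
apply: (@le_trans _ _ N%:R%:E); first by apply: ncomp_le_nat; rewrite /= mule1.
rewrite lee_fin; apply: (le_trans NX).
have i1 : 1 <= s^-1 by rewrite invf_ge1//; lra.
pose Y := 2 * Z * Sg + 2 * l + s^-1 * (4 * Z * Sg) + s^-1 * (2 * (ln 16 + 2 * l)).
have ZS : 0 <= Z * Sg by rewrite mulr_ge0//; lra.
have Y0 : 0 <= Y.
  have y1 : 0 <= s^-1 * (4 * Z * Sg) by rewrite mulr_ge0 ?invr_ge0; lra.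
  have y2 : 0 <= s^-1 * (2 * (ln 16 + 2 * l)) by rewrite mulr_ge0 ?invr_ge0; lra.
  rewrite /Y; lra.
have le2 : ln (16 / eps ^+ 2) = ln 16 + 2 * l.
  rewrite lnM ?posrE ?invr_gt0 ?exprn_gt0// -exprVn expr2 lnM ?posrE ?invr_gt0// -/l; ring.
have lS : ln S <= 2 * Z * Sg.
  have [Sp|Sn] := ltP 0 S; last by rewrite (le_trans (ln_le0 _)); lra.
  by rewrite -ler_expR lnK ?posrE//; apply: sum_box_powR_le => //; exact: ltW.
have XY : X <= 72 * expR Y.
  rewrite /X -!mulrA ler_wpM2l// mulrA.
  apply: (@le_trans _ _ (expR (2 * Z * Sg + 2 * l) *
      expR (s^-1 * (4 * Z * Sg) + s^-1 * (2 * (ln 16 + 2 * l))))); last first.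
    by rewrite -expRD /Y !addrA.
  apply: ler_pM; rewrite ?expR_ge0//.
  - by rewrite divr_ge0 ?exprn_ge0// ltW.
  - rewrite expRD; apply: ler_pM; rewrite ?(ltW es0) ?invr_ge0 ?exprn_ge0 ?(ltW e0)//.
      apply: (le_trans (eigsum_le d)); rewrite ler_expR ler_wpM2l//; first lra.
      by apply: ler_sum => k _; apply: g_le_powR; lra.
    by rewrite mulr_natl mulr2n expRD lnK ?posrE ?invr_gt0// -expr2 exprVn.
  - rewrite ler_expR le2; apply: lerD; first by rewrite ler_wpM2l ?invr_ge0 ?(ltW sp)//; lra.
    by rewrite ler_wpM2r ?mulr_ge0//; lra.
(* The extra 1 is the rounding of [X] up to an integer. *)
apply: (@le_trans _ _ (73 * expR Y)).
  by have : 1 <= expR Y; [rewrite -[leLHS]expR0 ler_expR|lra].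
rewrite -[73 in leLHS](lnK (x := 73)) ?posrE// -expRD ler_expR /Y.
rewrite [leRHS](_ : _ = s^-1 * ((6 * Z + 6 + 2 * ln 16 + ln 73) * (1 + l + Sg))); last by ring.
apply: (@le_trans _ _ (s^-1 * (ln 73 + (2 * Z * Sg + 2 * l) + 4 * Z * Sg + 2 * (ln 16 + 2 * l)))).
  rewrite !mulrDr !addrA !lerD2r.
  have a1 : ln 73 <= s^-1 * ln (73 : R) by rewrite ler_peMl.
  have a2 : 2 * Z * Sg <= s^-1 * (2 * Z * Sg) by rewrite ler_peMl//; lra.
  have a3 : 2 * l <= s^-1 * (2 * l) by rewrite ler_peMl//; lra.
  lra.
rewrite ler_wpM2l ?invr_ge0 ?(ltW sp)//.
have b1 : 0 <= Z * l by rewrite mulr_ge0//; lra.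
have b2 : 0 <= ln 16 * l by rewrite mulr_ge0.
have b3 : 0 <= ln 73 * l by rewrite mulr_ge0.
have b4 : 0 <= ln 16 * Sg by rewrite mulr_ge0.
have b5 : 0 <= ln 73 * Sg by rewrite mulr_ge0.
lra.
Qed.

(** One coordinate of [s^-1 (ln S - (1 - s) ln La)], split into [ln b] and the difference quotient
    [s^-1 (ln a - ln b)] in the exponent. The latter is bounded uniformly in [s], the factor
    [p ln j] from the frequencies being at most [j^(p s0) / s0]. *)
Lemma eigen_ratio_term k m (s : R) : 0 < s -> s <= s0 ->
  s^-1 * (ln (1 + 2 * g k.+1 `^ (1 - s) * zsum (2 * r k.+1 * (1 - s)) m) -
    (1 - s) * ln (1 + 2 * g k.+1 * zsum (2 * r k.+1) m)) <=
  (4 * Z + 2 * Z / s0) * (g k.+1 `^ (1 - s) * lnp (1 / g k.+1)).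
Proof.
move=> sp sle; have /andP[s00 s04] := s0_bounds; have Z1 := Z_ge1.
have /andP[g0 gl] := g_in01 k.+1 isT; set G := g k.+1 in g0 gl *.
set p := 2 * r k.+1; have p0 : 0 < p by rewrite mulr_gt0//; have := r_gt k.+1 isT; lra.
set sg := zsum p m; set st := zsum _ m.
have Gp := powR_ge0 G (1 - s).
have lG0 : ln G <= 0 by exact: ln_le0.
have sg0 : 0 <= sg by exact: zsum_ge0.
have st0 : 0 <= st by exact: zsum_ge0.
have sgZ : sg <= Z by rewrite /sg -[p]mulr1; apply: zsum_leZ => //; lra.
have stZ : st <= Z by apply: zsum_leZ => //; lra.
pose a := 1 + 2 * G `^ (1 - s) * st; pose b := 1 + 2 * G * sg.
have b1 : 1 <= b by rewrite lerDl !mulr_ge0// ltW.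
have a1 : 1 <= a by rewrite lerDl !mulr_ge0.
have GG : G <= G `^ (1 - s) by apply: g_le_powR; lra.
have lb : ln b <= 2 * G * sg.
  by have := ln_le_sub1 b (lt_le_trans ltr01 b1); rewrite /b; lra.
(* Term by term, with z = G j^(-p): s^-1 (z^(1 - s) - z) <= - z^(1 - s) ln z. *)
have diff : s^-1 * (G `^ (1 - s) * st - G * sg) <=
    G `^ (1 - s) * (Z * - ln G + Z / s0).
  apply: (@le_trans _ _ (\sum_(1 <= j < m.+1) G `^ (1 - s) *
      (j%:R `^ (- (p * (1 - s))) * - ln G + j%:R `^ (- (p * (1 - s - s0))) / s0))).
    rewrite /st /sg /zsum !mulr_sumr -sumrB mulr_sumr big_nat_cond [leRHS]big_nat_cond.
    apply: ler_sum => j /andP[/andP[j0 _] _].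
    have jr : 1 <= j%:R :> R by rewrite ler1n.
    have jr0 : 0 < j%:R :> R by rewrite ltr0n.
    have lj0 : 0 <= ln (j%:R : R) by rewrite ln_ge0.
    pose z := G * j%:R `^ (- p).
    have z0 : 0 < z by rewrite mulr_gt0// powR_gt0.
    have lnz : ln z = ln G - p * ln j%:R.
      by rewrite lnM ?posrE ?powR_gt0// powR_lnE// expRK mulNr.
    have z1 : z <= 1.
      by rewrite -[z]lnK ?posrE// -expR0 ler_expR lnz; have := mulr_ge0 (ltW p0) lj0; lra.
    have zs : z `^ (1 - s) = G `^ (1 - s) * j%:R `^ (- (p * (1 - s))).
      by rewrite powRM ?(ltW g0) ?powR_ge0// -powRrM mulNr.
    have h := powR_diff_le z s; rewrite z0 z1 /= zs in h.
    apply: (le_trans (h isT sp)); rewrite -mulrA ler_wpM2l// lnz opprB mulrDr addrC lerD2l.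
    rewrite (_ : - (p * (1 - s - s0)) = - (p * (1 - s)) + p * s0); last by ring.
    rewrite powRD ?(gt_eqF jr0) ?implybT// -mulrA ler_wpM2l ?powR_ge0//.
    rewrite ler_pdivlMr// powR_lnE//.
    have := expR_ge1Dx (p * s0 * ln j%:R); lra.
  rewrite -mulr_sumr ler_wpM2l// big_split /= -!mulr_suml; apply: lerD.
    by rewrite ler_wpM2r ?oppr_ge0.
  rewrite ler_wpM2r ?invr_ge0 ?(ltW s00)//.
  by apply: zsum_leZ => //; lra.
have ab : b <= a.
  rewrite /a /b lerD2l; apply: ler_pM => //; first by rewrite mulr_ge0// ltW.
    by rewrite ler_wpM2l.
  by apply: zsum_anti; rewrite ler_piMr ?(ltW p0)//; lra.
have b0 : 0 < b by exact: lt_le_trans b1.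
have a0 : 0 < a by exact: lt_le_trans a1.
have lab : ln a - ln b <= a - b.
  have := ln_le_sub1 (a / b) (divr_gt0 a0 b0).
  rewrite lnM ?posrE ?invr_gt0// lnV ?posrE// => /le_trans; apply.
  rewrite (_ : a / b - 1 = (a - b) / b); last by field; rewrite gt_eqF.
  by rewrite ler_pdivrMr// ler_peMr// subr_ge0.
rewrite (_ : s^-1 * (_ - _) = s^-1 * (ln a - ln b) + ln b); last first.
  by rewrite -/a -/b; field; rewrite gt_eqF.
have h1 : s^-1 * (ln a - ln b) <= 2 * (G `^ (1 - s) * (Z * - ln G + Z / s0)).
  apply: (@le_trans _ _ (s^-1 * (a - b))); first by rewrite ler_wpM2l ?invr_ge0 ?(ltW sp).
  rewrite (_ : a - b = 2 * (G `^ (1 - s) * st - G * sg)); last by rewrite /a /b; ring.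
  by rewrite mulrCA ler_wpM2l.
have h2 : ln b <= 2 * (G `^ (1 - s) * Z).
  apply: (le_trans lb); rewrite -mulrA ler_wpM2l//; apply: ler_pM => //; exact: ltW.
set P := G `^ (1 - s) in Gp h1 h2 *; set ell := lnp (1 / G).
have l1 : 1 <= ell by exact: lnp_ge1.
have lG : - ln G <= ell by rewrite /ell (le_trans _ (ln_le_lnp _))// div1r lnV ?posrE.
have Zs : 0 <= Z / s0 by rewrite divr_ge0; lra.
have e1 : P * (Z * - ln G) <= P * (Z * ell) by rewrite !ler_wpM2l//; lra.
have e2 : P * (Z / s0) <= P * (Z / s0 * ell) by rewrite ler_wpM2l// ler_peMr.
have e3 : P * Z <= P * (Z * ell) by rewrite ler_wpM2l// ler_peMr//; lra.
rewrite (_ : _ * (P * ell) = 4 * (P * (Z * ell)) + 2 * (P * (Z / s0 * ell))); last by ring.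
rewrite mulrDr in h1; lra.
Qed.

Lemma sum_g_lnp_ge0 d : 0 <= \sum_(k < d) g k.+1 * lnp (1 / g k.+1).
Proof.
apply: sumr_ge0 => k _; rewrite mulr_ge0 ?(ltW (g_gt0 _ _))//.
exact: le_trans (lnp_ge1 _).
Qed.

(** The target error is scaled by the initial error, so [S] enters only relative to [La^(1 - s)].
    Their logarithmic difference is of order [s] times the entropy, which cancels the factor
    [1 / s]; with [s = s0 / lnp d] only the dependence on [eps] retains the factor [lnp d]. *)
Lemma ncomp_NOR_upper : exists C : R, 0 < C /\ forall Lam d eps, (0 < d)%N ->
  0 < eps < 1 -> (ncomp g r Lam NOR eps d <=
    (expR (C * (lnp d%:R * (1 + ln eps^-1) +
      \sum_(k < d) g k.+1 * lnp (1 / g k.+1))))%:E)%E.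
Proof.
have /andP[s00 s04] := s0_bounds; have Z1 := Z_ge1.
have l16 : 0 <= ln (16 : R) by rewrite ln_ge0// ler1n.
have l145 : 0 <= ln (145 : R) by rewrite ln_ge0// ler1n.
have Zs : 0 <= 2 * Z / s0 by apply: divr_ge0; lra.
have C10 : 0 <= 4 * Z + 2 * Z / s0 by lra.
set C1 := 4 * Z + 2 * Z / s0 in C10.
have ex0 : 0 < expR (1 : R) by exact: expR_gt0.
have Ca0 : 0 < (ln (145 : R) + 2 * ln 16 + 6) / s0 by rewrite divr_gt0//; lra.
have Cb0 : 0 <= 2 * C1 * (expR 1 + 5) by apply: mulr_ge0; lra.
set Ca := _ / s0 in Ca0; set Cb := 2 * C1 * _ in Cb0.
exists (Ca + Cb); split; first lra.
move=> Lam d eps d0 /andP[e0 e1].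
set l := ln eps^-1; set L := lnp d%:R; set Ed := \sum_(k < d) _.
have l0 : 0 <= l by rewrite ln_ge0// invf_ge1// ltW.
have L1 : 1 <= L by exact: lnp_ge1.
have L0 : 0 < L by exact: lt_le_trans L1.
have Ed0 : 0 <= Ed by exact: sum_g_lnp_ge0.
pose s := s0 / L.
have sp : 0 < s by rewrite divr_gt0.
have sle : s <= s0 by rewrite ler_pdivrMr// ler_peMr// ltW.
have ep2 : 0 < eps ^+ 2 / 16 by rewrite divr_gt0// exprn_gt0.
have [m _ tail] := eigsum_approx (d := d) g_gt0 r_gt 0 (eps ^+ 2 / 16) ep2.
set La := \sum_(h <- _) eigval h in tail.
have La1 : 1 <= La by exact: sum_box_ge1.
have La0 : 0 < La by exact: lt_le_trans La1.
(* [sqrt La] is at most the initial error by [init_err_ge], so reaching [E] is sufficient. *)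
pose E := eps * Num.sqrt La.
have E0 : 0 < E by rewrite mulr_gt0// sqrtr_gt0.
have EE : E ^+ 2 = eps ^+ 2 * La by rewrite exprMn sqr_sqrtr// ltW.
set S := \sum_(h <- @box d m) eigval h `^ (1 - s).
set X := 72 * eigsum d / E ^+ 2 *
  expR (s^-1 * (2 * ln S) + (s^-1 - 1) * (2 * ln (16 / E ^+ 2))).
have es1 := eigsum_ge1 (d := d) g_gt0 r_gt.
have X0 : 0 <= X.
  by rewrite mulr_ge0 ?expR_ge0// divr_ge0 ?sqr_ge0// mulr_ge0//; lra.
have [N [N0 XN NX]] := nat_upper X X0.
have s01 : 0 < s < 1 by lra.
have tail' : eigsum d - E ^+ 2 / 16 <= La.
  apply: ltW; apply: le_lt_trans tail; rewrite lerB// EE ler_wpM2r ?invr_ge0//.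
  by rewrite ler_peMr// sqr_ge0.
have nN := nth_err_target g_gt0 r_gt Lam d m N s E s01 E0 N0 tail' XN.
apply: (@le_trans _ _ N%:R%:E).
  apply: ncomp_le_nat; apply: (le_trans nN) => /=.
  by rewrite EFinM lee_pmul2l ?lte_fin//; exact: init_err_ge.
rewrite lee_fin; apply: (le_trans NX).
have S_gt0 : 0 < S.
  rewrite /S sum_box_eigval_powR//; apply: prodr_gt0 => k _.
  by rewrite ltr_pwDl// !mulr_ge0 ?powR_ge0 ?zsum_ge0.
have lnprod (F : 'I_d -> R) : (forall k, 1 <= F k) ->
    ln (\prod_k F k) = \sum_k ln (F k).
  move=> F1; elim: (index_enum _) => [|k t ih]; first by rewrite !big_nil ln1.
  rewrite !big_cons lnM ?ih// posrE ?(lt_le_trans ltr01 (F1 k))//.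
  by apply: prodr_gt0 => i _; exact: lt_le_trans (F1 i).
have Q : s^-1 * (ln S - (1 - s) * ln La) <= C1 * (expR 1 * Ed + 5).
  rewrite /S /La sum_box_eigval_powR// sum_box_eigval// !lnprod; last 2 first.
  - by move=> k; rewrite lerDl !mulr_ge0 ?zsum_ge0// ltW ?g_gt0.
  - by move=> k; rewrite lerDl !mulr_ge0 ?zsum_ge0// powR_ge0.
  rewrite mulr_sumr -sumrB mulr_sumr.
  apply: (@le_trans _ _ (\sum_(k < d) C1 * (expR 1 * (g k.+1 * lnp (1 / g k.+1)) + 5 / d%:R))).
    apply: ler_sum => k _; apply: (le_trans (eigen_ratio_term k m s sp sle)).
    rewrite ler_wpM2l//; apply: (powR_lnp_term_upper _ _ s0) => //.
    exact: g_in01.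
  rewrite -mulr_sumr ler_wpM2l// big_split /= -mulr_sumr lerD2l sumr_const card_ord.
  by rewrite -[5 / d%:R *+ d]mulr_natr divfK// gt_eqF// ltr0n.
have i1 : 1 <= s^-1 by rewrite invf_ge1//; lra.
have sE : s^-1 = L / s0 by rewrite /s invf_div.
have le2 : ln (16 / E ^+ 2) = ln 16 + 2 * l - ln La.
  rewrite EE invfM mulrA lnM ?posrE ?divr_gt0 ?exprn_gt0 ?invr_gt0//.
  rewrite lnM ?posrE ?invr_gt0 ?exprn_gt0// -exprVn expr2 lnM ?posrE ?invr_gt0// -/l.
  by rewrite lnV ?posrE//; ring.
pose Y := 2 * l + 2 * (C1 * (expR 1 * Ed + 5)) + s^-1 * (2 * (ln 16 + 2 * l)).
have Y0 : 0 <= Y.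
  have y1 : 0 <= C1 * (expR 1 * Ed + 5).
    by rewrite mulr_ge0// addr_ge0// mulr_ge0// ltW.
  have y2 : 0 <= s^-1 * (2 * (ln 16 + 2 * l)) by rewrite mulr_ge0 ?invr_ge0; lra.
  rewrite /Y; lra.
have XY : X <= 144 * expR Y.
  (* 144 is twice 72, because [eigsum] is at most [2 La]. *)
  apply: (@le_trans _ _ (144 * (expR (2 * l) * expR (2 * (C1 * (expR 1 * Ed + 5)) +
      s^-1 * (2 * (ln 16 + 2 * l)))))); last by rewrite -expRD /Y !addrA.
  rewrite mulrA; apply: ler_pM; rewrite ?expR_ge0//.
  - by rewrite divr_ge0 ?sqr_ge0// mulr_ge0//; lra.
  - have -> : expR (2 * l) = eps ^- 2.
      by rewrite mulr_natl mulr2n expRD lnK ?posrE ?invr_gt0// -expr2 exprVn.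
    rewrite EE invfM mulrA mulrAC ler_wpM2r ?invr_ge0 ?sqr_ge0// ler_pdivrMr//.
    have : eps ^+ 2 <= 1 by rewrite expr_le1// ltW.
    lra.
  - rewrite ler_expR le2.
    (* Since [s^-1 - 1 = s^-1 (1 - s)], the [ln La] hidden in [E] combines with [ln S] into the
       quantity bounded by [Q]. *)
    rewrite (_ : _ + _ = 2 * (s^-1 * (ln S - (1 - s) * ln La)) +
        (s^-1 - 1) * (2 * (ln 16 + 2 * l))); last by field; rewrite gt_eqF.
    apply: lerD; first by rewrite ler_wpM2l.
    by rewrite ler_wpM2r ?mulr_ge0//; lra.
apply: (@le_trans _ _ (145 * expR Y)).
  by have : 1 <= expR Y; [rewrite -[leLHS]expR0 ler_expR|lra].
rewrite -[145 in leLHS](lnK (x := 145)) ?posrE// -expRD ler_expR /Y.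
have a1 : ln 145 <= s^-1 * ln (145 : R) by rewrite ler_peMl.
have a3 : 2 * l <= s^-1 * (2 * l) by rewrite ler_peMl//; lra.
apply: (@le_trans _ _ (s^-1 * (ln 145 + 2 * l + 2 * (ln 16 + 2 * l)) +
    2 * (C1 * (expR 1 * Ed + 5)))); first by rewrite !mulrDr; lra.
have c1 : s^-1 * (ln 145 + 2 * l + 2 * (ln 16 + 2 * l)) <= Ca * (L * (1 + l)).
  rewrite sE /Ca (_ : _ / s0 * (L * _) = L / s0 * ((ln 145 + 2 * ln 16 + 6) * (1 + l))); last by ring.
  have Ls0 : 0 <= L / s0 by rewrite -sE invr_ge0 ltW.
  apply: ler_wpM2l => //.
  have b2 : 0 <= ln 16 * l by rewrite mulr_ge0.
  have b3 : 0 <= ln 145 * l by rewrite mulr_ge0.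
  lra.
have LL : 1 <= L * (1 + l) by rewrite mulr_ege1//; lra.
have c2 : 2 * (C1 * (expR 1 * Ed + 5)) <= Cb * (L * (1 + l) + Ed).
  have -> : 2 * (C1 * (expR 1 * Ed + 5)) = 2 * C1 * (expR 1 * Ed + 5) by ring.
  rewrite /Cb -[leRHS]mulrA; apply: ler_wpM2l; first lra.
  have b1 : 0 <= expR 1 * (L * (1 + l)) by rewrite mulr_ge0//; lra.
  lra.
have c3 : 0 <= Ca * Ed by rewrite mulr_ge0// ltW.
rewrite mulrDl !mulrDr; rewrite mulrDr in c2; lra.
Qed.

End ComplexityBounds.

(** * Necessity of the entropy bound *)

Section EntropyLowerBound.
Context {R : realType} {g r : nat -> R}.
Hypothesis g1_le1 : g 1%N <= 1.
Hypothesis g_noninc : forall j : nat, (0 < j)%N -> g j.+1 <= g j.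
Hypothesis g_gt0 : forall j : nat, (0 < j)%N -> 0 < g j.
Hypothesis r1_gt : 1 / 2 < r 1%N.
Hypothesis r_nondec : forall j : nat, (0 < j)%N -> r j <= r j.+1.

Local Notation eigval := (@eigval R _ g r).
Local Notation eigsum d := (@eigsum R d g r).

Let g_in01' : forall j, (0 < j)%N -> 0 < g j <= 1 := g_in01 g1_le1 g_noninc g_gt0.
Let r_gt' : forall j, (0 < j)%N -> 1 / 2 < r j := r_gt r1_gt r_nondec.

(* Markov's inequality for the normalized eigenvalues with exponent
   [s = 1 / lnp d]: half of the mass sits on eigenvalues below [q La]. *)
Lemma ncomp_NOR_lower Lam d n : (0 < d)%N ->
  (nth_err g r Lam n d <= (1 / 4)%:E * init_err g r d)%E ->
  \sum_(k < d) g k.+1 * lnp (1 / g k.+1) <= 18 * (lnp d%:R + ln n%:R).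
Proof.
move=> d0 nH; set Ed := \sum_(k < d) _; set L := lnp d%:R.
have L1 : 1 <= L by exact: lnp_ge1.
have L0 : 0 < L by exact: lt_le_trans L1.
pose s := L^-1; have sp : 0 < s by rewrite invr_gt0.
have es1 := eigsum_ge1 (d := d) g_gt0 r_gt'.
(* [m >= 1] makes every zeta sum at least 1, and slack 1 yields [eigsum <= 2 La] because
   [La >= 1]. *)
have [m m1 tail] := eigsum_approx (d := d) g_gt0 r_gt' 1 1 ltr01.
set La := \sum_(h <- _) eigval h in tail.
have La1 : 1 <= La by exact: sum_box_ge1.
have La0 : 0 < La by exact: lt_le_trans La1.
pose e := 1 / 4 * Num.sqrt (2 * eigsum d).
have ege0 : 0 <= e by rewrite mulr_ge0 ?sqrtr_ge0.
have e2 : e ^+ 2 <= La / 4.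
  by rewrite exprMn sqr_sqrtr; lra.
have ne : (nth_err g r Lam n d <= e%:E)%E.
  apply: (le_trans nH); rewrite /e [leRHS]EFinM lee_pmul2l ?lte_fin//.
  exact: (init_err_le g_gt0 r_gt').
(* With [s L = 1], this is the value for which the Markov bound, together with [S1], equals
   [La / 2]. *)
pose X := 2 / 9 * (Ed - 3) - L * ln 2.
pose q := expR (- X); have q0 : 0 < q by exact: expR_gt0.
pose A := [seq h <- @box d m | eigval h <= q * La].
have uA : uniq A by rewrite filter_uniq// box_uniq.
have qLa0 : 0 < q * La by rewrite mulr_gt0.
have markov : \sum_(h <- @box d m | ~~ (eigval h <= q * La)) eigval h <=
    (q * La) `^ (- s) * \sum_(h <- @box d m) eigval h `^ (1 + s).
  rewrite [leRHS]mulr_sumr [leRHS](bigID (fun h : mindex d => eigval h <= q * La)) /= -[leLHS]add0r.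
  apply: lerD; first by apply: sumr_ge0 => h _; rewrite mulr_ge0 ?powR_ge0.
  apply: ler_sum => h; rewrite -ltNge => hq.
  have h0 := eigval_gt0 g_gt0 (r := r) h.
  rewrite powRD ?(gt_eqF h0) ?implybT// powRr1 ?(ltW h0)// mulrCA ler_peMr ?(ltW h0)//.
  rewrite powRN mulrC ler_pdivlMr ?powR_gt0// mul1r.
  by rewrite ge0_ler_powR ?nnegrE ?(ltW sp) ?(ltW qLa0) ?(ltW h0)// ltW.
have La_prod : La = \prod_(k < d) (1 + 2 * g k.+1 * zsum (2 * r k.+1) m).
  exact: sum_box_eigval.
have S1 : \sum_(h <- @box d m) eigval h `^ (1 + s) <=
    La * La `^ s * expR (- (2 / 9 * s * (Ed - 3))).
  rewrite sum_box_eigval_powR// La_prod powR_prod; last first.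
    by move=> k; rewrite addr_ge0// !mulr_ge0 ?zsum_ge0// ltW// g_gt0.
  have -> : - (2 / 9 * s * (Ed - 3)) = \sum_(k < d)
      - (2 / 3 * (s / 3 * (g k.+1 * lnp (1 / g k.+1) - 3 / d%:R))).
    rewrite sumrN -!mulr_sumr sumrB sumr_const card_ord -[3 / d%:R *+ d]mulr_natr divfK ?gt_eqF ?ltr0n//.
    by rewrite -/Ed; field.
  rewrite expR_sum -!big_split /=; apply: ler_prod => k _.
  have /andP[g0 gl] := g_in01' k.+1 isT; set G := g k.+1 in g0 gl *.
  set sg := zsum (2 * r k.+1) m.
  have sg1 : 1 <= sg by exact: zsum_ge1.
  rewrite addr_ge0 ?mulr_ge0 ?powR_ge0 ?zsum_ge0//=.
  set b := 1 + 2 * G * sg; have b1 : 1 <= b by rewrite /b; nra.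
  have b0 : 0 < b by exact: lt_le_trans b1.
  have Gs0 := powR_ge0 G s; have Gs1 : G `^ s <= 1.
    by rewrite powR_lnE// -[leRHS]expR0 ler_expR pmulr_rle0// ln_le0.
  (* From [G <= 1 <= sg] one has [b <= 3 sg], so the loss [2 G sg (1 - G^s)] is at least the
     fraction [2/3 G (1 - G^s)] of [b]. *)
  have t1 : 1 + 2 * G `^ (1 + s) * zsum (2 * r k.+1 * (1 + s)) m <=
      b * expR (- (2 / 3 * (G * (1 - G `^ s)))).
    apply: (@le_trans _ _ (b * (1 - 2 / 3 * (G * (1 - G `^ s))))); last first.
      by rewrite ler_wpM2l ?(ltW b0)//; exact: expR_ge1Dx.
    apply: (@le_trans _ _ (1 + 2 * G * G `^ s * sg)).
      rewrite lerD2l powRD ?(gt_eqF g0) ?implybT// powRr1 ?(ltW g0)//.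
      rewrite [2 * (G * _)]mulrA; apply: ler_wpM2l; first by rewrite !mulr_ge0// ltW.
      apply: zsum_anti; rewrite ler_peMr//; last lra.
      by have := r_gt' k.+1 isT; lra.
    rewrite /b; set u := G `^ s in Gs0 Gs1 *.
    have : 0 <= G * (1 - u) * (3 * sg - (1 + 2 * G * sg)).
      by rewrite !mulr_ge0 ?(ltW g0)//; nra.
    lra.
  (* The same inequality gives [ln b >= 2/3 G], so [b^s] pays for the term [s G] on the right of
     [entropy_term_lower]. *)
  have t2 : 1 <= b `^ s * expR (- (2 / 3 * (s * G))).
    rewrite powR_lnE// -expRD -[leLHS]expR0 ler_expR.
    have : 2 / 3 * G <= ln b.
      apply: le_trans (ln1D_ge (2 * G * sg) _); last by rewrite !mulr_ge0 ?zsum_ge0// ltW.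
      have k1 : 0 <= 3 * sg - (1 + 2 * G * sg) by nra.
      by rewrite ler_pdivlMr//; have := mulr_ge0 (ltW g0) k1; lra.
    move=> h; have := ler_wpM2l (ltW sp) h; lra.
  have ent := entropy_term_lower G s d d0 (g_in01' k.+1 isT) erefl.
  apply: (le_trans t1); rewrite -[leRHS]mulrA ler_wpM2l ?(ltW b0)//.
  apply: (@le_trans _ _ (b `^ s * expR (- (2 / 3 * (s * G))) *
      expR (- (2 / 3 * (G * (1 - G `^ s)))))).
    by rewrite ler_peMl ?expR_ge0.
  rewrite -mulrA ler_wpM2l ?powR_ge0// -expRD ler_expR; lra.
have half : \sum_(h <- @box d m | ~~ (eigval h <= q * La)) eigval h <= La / 2.
  apply: (le_trans markov).
  apply: (le_trans (ler_wpM2l (powR_ge0 _ _) S1)).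
  rewrite powRN powRM ?(ltW q0) ?(ltW La0)// invfM.
  have Lp : 0 < La `^ s by exact: powR_gt0.
  rewrite (_ : _ * (La * _ * _) = La * ((q `^ s)^-1 * expR (- (2 / 9 * s * (Ed - 3))))); last first.
    by field; rewrite !gt_eqF ?powR_gt0.
  rewrite ler_wpM2l ?(ltW La0)// /q powR_lnE// expRK -expRN -expRD.
  rewrite -[2 in leRHS](lnK (x := 2)) ?posrE// -expRN ler_expR /X.
  have sL : s * L = 1 by rewrite mulVf// gt_eqF.
  have := congr1 (fun z => z * ln 2) sL; rewrite mul1r.
  by move: (s) (L) (Ed) (ln 2) => s' L' E' l2; lra.
have hA h : h \in A -> [/\ 0 <= eigval h, eigval h <= eigval h & eigval h <= q * La].
  by rewrite mem_filter => /andP[hq _]; split=> //; exact: eigval_ge0.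
have lb := nth_err_lower_bound g_gt0 r_gt' Lam d n A eigval (q * La) e uA hA (ltW qLa0) ege0 ne.
have AE : La = \sum_(h <- A) eigval h +
    \sum_(h <- @box d m | ~~ (eigval h <= q * La)) eigval h.
  by rewrite /A big_filter; exact: bigID.
(* [A] carries at least [La / 2], its eigenvalues are at most [q La], and the squared error is at
   most [La / 4]. *)
have nq : 1 / 4 <= n%:R * q.
  rewrite -(ler_pM2r La0) -mulrA; lra.
have n0 : 0 < n%:R :> R by rewrite -(pmulr_lgt0 _ q0); lra.
have : ln (1 / 4) <= ln (n%:R * q) by rewrite ler_ln ?posrE ?mulr_gt0//.
rewrite lnM ?posrE// expRK div1r lnV ?posrE// (_ : 4 = 2 * 2); last by ring.
rewrite lnM ?posrE// /X => h.
have l2 : ln (2 : R) <= 1 by have := ln_le_sub1 (2 : R) (ltr0n _ 2); lra.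
have Ll : L * ln 2 <= L by rewrite ler_piMr// ltW.
have lnn : 0 <= ln (n%:R : R) by rewrite ln_ge0// ler1n -(ltr0n R).
lra.
Qed.

End EntropyLowerBound.

(** * Elementary asymptotics *)

Section Asymptotics.
Context {R : realType}.
Implicit Types (x s t : R) (u : nat -> R).

Lemma lnp_le1D (d : nat) : (0 < d)%N -> lnp d%:R <= 1 + ln (d%:R : R).
Proof.
move=> d0; rewrite /lnp ge_max; have : 0 <= ln (d%:R : R) by rewrite ln_ge0// ler1n.
lra.
Qed.

Lemma powR_nat_ge1 (d : nat) t : (0 < d)%N -> 0 <= t -> 1 <= d%:R `^ t :> R.
Proof. by move=> d0 t0; rewrite -[leLHS](@powRr0 _ d%:R) ler_powR ?ler1n. Qed.

(** The function x ln(1/x) decreases beyond 1/e, but there [lnp] equals 1 and the product is x, so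
    monotonicity holds on all of (0, 1]. *)
Lemma xlnp_mono x (y : R) : 0 < x -> x <= y -> y <= 1 ->
  x * lnp (1 / x) <= y * lnp (1 / y).
Proof.
move=> x0 xy y1; have y0 : 0 < y by exact: lt_le_trans xy.
have l1 := lnp_ge1 (1 / y).
rewrite {1}/lnp; case: (leP 1 (ln (1 / x))) => h; last first.
  by rewrite mulr1 (le_trans xy)// ler_peMr// ltW.
have -> : ln (1 / x) = ln (1 / y) + ln (y / x).
  by rewrite !div1r !lnM ?posrE ?invr_gt0// !lnV ?posrE//; ring.
have a1 : x * ln (1 / y) <= x * lnp (1 / y) by rewrite ler_wpM2l ?(ltW x0)// ln_le_lnp.
have a2 : x * ln (y / x) <= y - x.
  have := ln_le_sub1 (y / x) (divr_gt0 y0 x0) => /(ler_wpM2l (ltW x0)) /le_trans; apply.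
  by rewrite mulrBr mulr1 mulrC divfK ?gt_eqF.
have a3 : y - x <= (y - x) * lnp (1 / y) by rewrite ler_peMr// subr_ge0.
rewrite mulrDr; lra.
Qed.

(** With [q = x^(s/4)] and [a ln x <= q], the square of the logarithm is at most [q^2 / a^2];
    completing the square against [e q^4] gives the constant. *)
Lemma ln_sqr_small s (e : R) : 0 < s -> 0 < e ->
  exists2 M, 0 <= M & forall x, 1 <= x -> ln x ^+ 2 <= e * x `^ s + M.
Proof.
move=> s0 e0; pose a := s / 4; have a0 : 0 < a by rewrite divr_gt0.
exists ((a ^+ 2) ^- 2 / (4 * e)).
  by rewrite divr_ge0 ?invr_ge0 ?exprn_ge0 ?mulr_ge0// ltW.
move=> x x1; have x0 : 0 < x by exact: lt_le_trans x1.
have lx : 0 <= ln x by exact: ln_ge0.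
pose q := expR (a * ln x); have q0 : 0 < q by exact: expR_gt0.
have h1 : a * ln x <= q.
  by have := expR_ge1Dx (a * ln x); rewrite -/q; lra.
have -> : x `^ s = q ^+ 4.
  rewrite powR_lnE// /q -expRM_natl; congr expR.
  by rewrite /a mulrA -mulr_natl; field.
have h2 : (a * ln x) ^+ 2 <= q ^+ 2 by rewrite lerXn2r ?nnegrE ?mulr_ge0// ltW.
have h3 : ln x ^+ 2 <= q ^+ 2 * (a ^+ 2)^-1.
  by rewrite ler_pdivlMr ?exprn_gt0// -exprMn mulrC.
apply: (le_trans h3); rewrite -subr_ge0.
set y := q ^+ 2; set z := (a ^+ 2)^-1; rewrite -[(a ^+ 2) ^- 2]exprVn -/z.
have -> : e * q ^+ 4 + z ^+ 2 / (4 * e) - y * z = (2 * e * y - z) ^+ 2 / (4 * e).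
  by rewrite /y; field; rewrite gt_eqF.
by rewrite divr_ge0 ?sqr_ge0// mulr_ge0// ltW.
Qed.

Lemma lnp_sqr_small t (e : R) : 0 < t -> 0 < e ->
  exists2 M, 0 <= M & forall d : nat, (0 < d)%N ->
  lnp (d%:R : R) ^+ 2 <= e * d%:R `^ t + M.
Proof.
move=> t0 e0; have [M M0 H] := ln_sqr_small t (e / 2) t0 (divr_gt0 e0 (ltr0n _ 2)).
exists (2 + 2 * M); first lra.
move=> d d0; have := H d%:R; rewrite ler1n => /(_ d0).
have := lnp_le1D d d0; have := lnp_ge1 (d%:R : R).
move: (lnp _) (ln _) (_ `^ _) => L l D L1 Ll h.
have : L ^+ 2 <= (1 + l) ^+ 2 by rewrite lerXn2r ?nnegrE; lra.
have := sqr_ge0 (1 - l); lra.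
Qed.

(* [o]-bounds in each variable combine once [x + d] is large. *)
Lemma two_scale_bound s t (A : R -> R) (V : nat -> R) : 0 < s -> 0 < t ->
  (forall e, 0 < e -> exists M, forall x, 1 <= x -> A x <= e * x `^ s + M) ->
  (forall e, 0 < e -> exists M, forall d, (0 < d)%N -> V d <= e * d%:R `^ t + M) ->
  forall e, 0 < e -> exists M, forall x (d : nat), 1 <= x -> (0 < d)%N ->
  M < x + d%:R -> V d + A x <= e * (x `^ s + d%:R `^ t).
Proof.
move=> s0 t0 hA hV e e0; have e2 : 0 < e / 2 by rewrite divr_gt0.
have [M1 h1] := hA _ e2; have [M2 h2] := hV _ e2.
pose y := Num.max 1 ((M1 + M2) / (e / 2)).
have y1 : 1 <= y by rewrite le_max lexx.
have y0 : 0 < y by exact: lt_le_trans y1.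
have yM : M1 + M2 <= e / 2 * y.
  by rewrite mulrC -ler_pdivrMr// le_max lexx orbT.
exists (y `^ s^-1 + y `^ t^-1) => x d x1 d0 xd.
have pow z a : 0 < a -> 0 <= z -> y `^ a^-1 <= z -> y <= z `^ a.
  move=> a0 z0 yz; rewrite -[leLHS]powRr1 ?(ltW y0)// -(mulVf (lt0r_neq0 a0)) powRrM.
  by rewrite ge0_ler_powR ?nnegrE ?powR_ge0// ltW.
have xs := powR_ge0 x s; have dt := powR_ge0 (d%:R : R) t.
have yy : y <= x `^ s + d%:R `^ t.
  have [h|h] := leP (y `^ s^-1) x.
    apply: (le_trans (pow _ _ s0 _ h)); first lra.
    by rewrite lerDl.
  apply: (@le_trans _ _ (d%:R `^ t)); last by rewrite lerDr.
  by apply: pow => //; lra.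
have := h1 x x1; have := h2 d d0; have := ler_wpM2l (ltW e2) yy; lra.
Qed.

Lemma cesaro_small u : (forall k, 0 <= u k) -> u @ \oo --> (0 : R) ->
  forall e, 0 < e -> exists M, forall d : nat, \sum_(k < d) u k <= e * d%:R + M.
Proof.
move=> u0 cu e e0; have /cvgrPdist_le/(_ e e0)[N _ HN] := cu.
exists (\sum_(k < N) u k) => d.
apply: (@le_trans _ _ (\sum_(k < d) (e + (if (k < N)%N then u k else 0)))).
  apply: ler_sum => k _; case: ltnP => kN; first by rewrite lerDr ltW.
  by rewrite addr0; have := HN k kN; rewrite sub0r normrN ger0_norm.
rewrite big_split /= sumr_const card_ord -[e *+ d]mulr_natr lerD2l.
rewrite -(big_mkord xpredT (fun k => if (k < N)%N then u k else 0)) -big_mkcond /=.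
rewrite -(big_mkord xpredT u) (big_nat_widen 0 N (maxn d N)) ?leq_maxr//=.
rewrite [leRHS](@big_cat_nat _ _ _ d) ?leq_maxl//= lerDl.
by apply: sumr_ge0 => k _.
Qed.

(** Discrete form of the integral of x^(p - 1). The increment of [k^p] is estimated by [(1 - 1/k)^p
    <= exp (- p/k) <= 1 / (1 + p/k)], and the constant 2 instead of 1 absorbs the factor
    [1 + p/k <= 2]. *)
Lemma sum_powR_le (p : R) (d : nat) : 0 < p -> p <= 1 ->
  \sum_(1 <= j < d.+1) j%:R `^ (p - 1) <= 2 / p * d%:R `^ p :> R.
Proof.
move=> p0 p1; elim: d => [|d ih]; first by rewrite big_geq// mulr_ge0 ?powR_ge0 ?divr_ge0// ltW.
rewrite big_nat_recr//=; apply: (le_trans (lerD ih (lexx _))).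
rewrite -lerBrDl -mulrBr; set k : R := d.+1%:R.
have k0 : 0 < k by rewrite ltr0n.
have kE : k `^ (p - 1) = k `^ p / k.
  by rewrite powRB ?(gt_eqF k0) ?implybT// powRr1 ?(ltW k0).
have pk : p / k <= 1 by rewrite ler_pdivrMr// mul1r (le_trans p1)// ler1n.
have pk0 : 0 <= p / k by rewrite divr_ge0// ltW.
have dk : d%:R `^ p <= k `^ p * (1 + p / k)^-1.
  case: d @k k0 kE pk pk0 ih => [|d] k k0 kE pk pk0 _.
    by rewrite powR0 ?gt_eqF// mulr_ge0 ?powR_ge0// invr_ge0; lra.
  have d0 : 0 < d.+1%:R :> R by rewrite ltr0n.
  have -> : d.+1%:R `^ p = k `^ p * expR (p * ln (d.+1%:R / k)).
    rewrite !powR_lnE// -expRD lnM ?posrE ?invr_gt0// lnV ?posrE//; congr expR; ring.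
  rewrite ler_wpM2l ?powR_ge0//; apply: le_trans (expRN_le_inv _ pk0).
  rewrite ler_expR -mulrN ler_wpM2l ?(ltW p0)//.
  apply: (le_trans (ln_le_sub1 _ (divr_gt0 d0 k0))).
  rewrite (_ : k = d.+1%:R + 1); last by rewrite natr1.
  rewrite le_eqVlt; apply/orP; left; apply/eqP; field.
  by rewrite gt_eqF//; have := ler0n R d; lra.
rewrite kE; apply: (@le_trans _ _ (2 / p * (k `^ p - k `^ p * (1 + p / k)^-1))); last first.
  by rewrite ler_wpM2l ?divr_ge0 ?(ltW p0)// lerB.
clearbody k.
have e1 : 1 + p / k != 0 by rewrite lt0r_neq0// ltr_pwDl.
have -> : 2 / p * (k `^ p - k `^ p * (1 + p / k)^-1) = k `^ p / k * (2 / (1 + p / k)).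
  have kp : k + p != 0 by rewrite gt_eqF// ltr_pwDr// ltW.
  by field; rewrite kp !gt_eqF.
rewrite ler_peMr ?divr_ge0 ?powR_ge0 ?(ltW k0)// ler_pdivlMr; lra.
Qed.

Lemma powR_term_upper x s s0 (d : nat) : (0 < d)%N -> 0 < x <= 1 ->
  0 < s0 <= 1 / 4 -> s = s0 / lnp d%:R ->
  x `^ (1 - s) <= expR 1 * x + 1 / d%:R.
Proof.
move=> d0 x01 /andP[s00 s04] sE; have /andP[x0 x1] := x01; have L1 := lnp_ge1 (d%:R : R).
have L0 : 0 < lnp (d%:R : R) by rewrite (lt_le_trans _ L1).
have sp : 0 < s by rewrite sE divr_gt0.
have s4 : s <= 1 / 4.
  by apply: le_trans s04; rewrite sE ler_pdivrMr// ler_peMr// ltW.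
have dr0 : 0 < d%:R :> R by rewrite ltr0n.
have lx := ln_le0 x1.
have [xd|xd] := lerP (d%:R ^- 2) x.
  apply: (@le_trans _ _ (expR 1 * x)); last by rewrite lerDl divr_ge0// ltW.
  rewrite powR_lnE// -{2}(lnK (x := x)) ?posrE// -expRD ler_expR.
  have : s * - ln x <= 1.
    have := ln_large _ _ d0 x0 xd => h.
    apply: (@le_trans _ _ (s * (2 * lnp d%:R))); first by rewrite ler_wpM2l// ltW.
    by rewrite sE [2 * _]mulrC mulrA divfK ?gt_eqF//; lra.
  lra.
apply: (@le_trans _ _ (1 / d%:R)); last by rewrite lerDr mulr_ge0 ?expR_ge0// ltW.
rewrite div1r; apply: le_trans (sqrt_small _ _ d0 x0 xd).
rewrite -powR12_sqrt ?(ltW x0)// !powR_lnE// ler_expR ler_wnM2r//; lra.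
Qed.

Lemma limn_einf_sup_einfs (v : nat -> \bar R) :
  limn_einf v = ereal_sup (range (einfs v)).
Proof. by rewrite limn_einf_lim; apply/cvg_lim => //; exact: cvg_einfs_sup. Qed.

Lemma limn_einf_ge (v : nat -> \bar R) (c : \bar R) (N : nat) :
  (forall n, (N <= n)%N -> (c <= v n)%E) -> (c <= limn_einf v)%E.
Proof.
move=> H; rewrite limn_einf_sup_einfs.
apply: (@le_trans _ _ (einfs v N)); last by apply: ereal_sup_ubound; exists N.
by apply: le_ereal_inf_tmp => _ [p /= Np <-]; exact: H.
Qed.

Lemma lt_limn_einf (v : nat -> \bar R) (c : \bar R) : (c < limn_einf v)%E ->
  exists N, forall n, (N <= n)%N -> (c < v n)%E.
Proof.
rewrite limn_einf_sup_einfs => /ereal_sup_gt[_ [N _ <-] cN]; exists N => n Nn.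
by apply: (lt_le_trans cN); apply: ereal_inf_lbound; exists n.
Qed.

End Asymptotics.

(** * Criteria for weak tractability with t >= 1, and necessity for every t > 0 *)

Section Tractability.
Context {R : realType} {g r : nat -> R}.
Hypothesis g1_le1 : g 1%N <= 1.
Hypothesis g_noninc : forall j : nat, (0 < j)%N -> g j.+1 <= g j.
Hypothesis g_gt0 : forall j : nat, (0 < j)%N -> 0 < g j.
Hypothesis r1_gt : 1 / 2 < r 1%N.
Hypothesis r_nondec : forall j : nat, (0 < j)%N -> r j <= r j.+1.

Let gin := g_in01 g1_le1 g_noninc g_gt0.
Let rgt := r_gt r1_gt r_nondec.
Let entropy (d : nat) : R := \sum_(k < d) g k.+1 * lnp (1 / g k.+1).

Lemma ncomp_nat_witness Lam c (eps B : R) d :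
  (ncomp g r Lam c eps d <= B%:E)%E ->
  exists n, (nth_err g r Lam n d <= eps%:E * CRI g r c d)%E /\ n%:R <= B + 1.
Proof.
move=> H; have /ereal_inf_lt[_ [n nH <-]] : (ncomp g r Lam c eps d < (B + 1)%:E)%E.
  by apply: le_lt_trans H _; rewrite lte_fin ltrDl.
by rewrite lte_fin => /ltW nB; exists n.
Qed.

Lemma ncomp_NOR_le Lam c (eps : R) d : 0 < eps ->
  (ncomp g r Lam NOR eps d <= ncomp g r Lam c eps d)%E.
Proof. by move=> e0; case: c => //; exact: ncomp_NOR_le_ABS. Qed.

Lemma ncomp_le_ABS Lam c (eps : R) d : 0 < eps ->
  (ncomp g r Lam c eps d <= ncomp g r Lam ABS eps d)%E.
Proof. by move=> e0; case: c => //; exact: ncomp_NOR_le_ABS. Qed.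

(** The single accuracy 1/4 suffices to control the entropy, so any bound on the complexity becomes
    a condition on the weights. *)
Lemma entropy_le Lam c (B : R) d : (0 < d)%N -> 1 <= B ->
  (ncomp g r Lam c (1 / 4) d <= B%:E)%E ->
  entropy d <= 18 * (lnp d%:R + 1 + ln B).
Proof.
move=> d0 B1 H; have B0 : 0 < B by exact: lt_le_trans B1.
have e0 : 0 < 1 / 4 :> R by [].
have [n [nH nB]] := ncomp_nat_witness _ _ _ _ _ (le_trans (ncomp_NOR_le Lam c _ d e0) H).
apply: le_trans (ncomp_NOR_lower g1_le1 g_noninc g_gt0 r1_gt r_nondec Lam d n d0 nH) _.
rewrite ler_wpM2l// -addrA lerD2l.
have lB : 0 <= ln B by exact: ln_ge0.
case: n {nH} nB => [|n] nB; first by rewrite ln0// addr_ge0.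
have n0 : 0 < n.+1%:R :> R by rewrite ltr0n.
have nB2 : n.+1%:R <= 2 * B by lra.
apply: (@le_trans _ _ (ln (2 * B))); first by rewrite ler_ln ?posrE ?mulr_gt0.
rewrite lnM ?posrE// lerD2r.
by have := ln_le_sub1 (2 : R) (ltr0n _ 2); lra.
Qed.

(** By [ncomp_ge1] the logarithm is nonnegative, and finiteness, quotient and absolute value merge
    into one exponential bound. *)
Lemma stWTP Lam c (s t : R) : ALG_stWT g r Lam c s t <->
  forall eta : R, 0 < eta -> exists M : R, forall (d : nat) (eps : R),
    (0 < d)%N -> 0 < eps < 1 -> M < eps^-1 + d%:R ->
    (ncomp g r Lam c eps d <= (expR (eta * (eps^-1 `^ s + d%:R `^ t)))%:E)%E.
Proof.
have den d (eps : R) : (0 < d)%N -> 0 < eps < 1 -> 0 < eps^-1 `^ s + d%:R `^ t.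
  by move=> d0 /andP[e0 _]; rewrite addr_gt0// powR_gt0 ?invr_gt0 ?ltr0n.
split=> H eta eta0; have [M HM] := H eta eta0; exists M => d eps d0 e01 Md.
  have [fin le] := HM d eps d0 e01 Md; have D := den d eps d0 e01.
  have n1 := ncomp_ge1 g_gt0 rgt Lam c eps d e01.
  have fn : ncomp g r Lam c eps d \is a fin_num.
    by rewrite ge0_fin_numE// (le_trans _ n1).
  move: n1 le; rewrite -(fineK fn) -/(1%:E) !lee_fin; set N := fine _ => n1.
  rewrite ler_norml => /andP[_]; rewrite ler_pdivrMr// => h.
  by rewrite -[N]lnK ?posrE ?(lt_le_trans ltr01)// ler_expR.
have le := HM d eps d0 e01 Md; have D := den d eps d0 e01.
have n1 := ncomp_ge1 g_gt0 rgt Lam c eps d e01.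
have fin : (ncomp g r Lam c eps d < +oo)%E by rewrite (le_lt_trans le)// ltry.
split=> //; have fn : ncomp g r Lam c eps d \is a fin_num.
  by rewrite ge0_fin_numE// (le_trans _ n1).
move: n1 le; rewrite -(fineK fn) -/(1%:E) !lee_fin /=; set N := fine _ => n1 le.
have N0 : 0 < N by exact: lt_le_trans n1.
rewrite ger0_norm ?divr_ge0 ?ln_ge0 ?(ltW D)//.
by rewrite ler_pdivrMr// -ler_expR lnK.
Qed.

Lemma stWT_from_ABS Lam c s t : ALG_stWT g r Lam ABS s t -> ALG_stWT g r Lam c s t.
Proof.
move=> /stWTP H; apply/stWTP => eta eta0; have [M HM] := H eta eta0.
exists M => d eps d0 e01 Md; apply: le_trans (HM d eps d0 e01 Md).
by apply: ncomp_le_ABS; case/andP: e01.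
Qed.

Lemma stWT_mono Lam c s (t t' : R) : t <= t' ->
  ALG_stWT g r Lam c s t -> ALG_stWT g r Lam c s t'.
Proof.
move=> tt /stWTP H; apply/stWTP => eta eta0; have [M HM] := H eta eta0.
exists M => d eps d0 e01 Md; apply: le_trans (HM d eps d0 e01 Md) _.
rewrite lee_fin ler_expR ler_wpM2l ?(ltW eta0)// lerD2l.
by rewrite ler_powR// ler1n.
Qed.

Lemma le_powR_inv (t y z : R) : 0 < t -> 0 <= y -> 0 <= z ->
  (y `^ t^-1 <= z) = (y <= z `^ t).
Proof.
move=> t0 y0 z0; have yK : (y `^ t^-1) `^ t = y by rewrite -powRrM mulVf ?gt_eqF// powRr1.
apply/idP/idP => [h|].
  by rewrite -yK ge0_ler_powR ?nnegrE ?powR_ge0// ltW.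
apply: contraTT; rewrite -!ltNge => h.
by rewrite -yK gt0_ltr_powR ?nnegrE ?powR_ge0.
Qed.

Lemma powR_nat_large (t M : R) : 0 < t ->
  exists N : nat, forall d : nat, (N <= d)%N -> M <= d%:R `^ t.
Proof.
move=> t0; pose y := Num.max 1 M; have y1 : 1 <= y by rewrite le_max lexx.
have y0 : 0 < y by exact: lt_le_trans y1.
have [N [_ HN _]] := nat_upper (y `^ t^-1) (powR_ge0 _ _).
exists N => d Nd; apply: (@le_trans _ _ y); first by rewrite le_max lexx orbT.
by rewrite -le_powR_inv ?(ltW y0)// (le_trans HN)// ler_nat.
Qed.

Lemma g_lnp_mono i j : (0 < i)%N -> (i <= j)%N ->
  g j * lnp (1 / g j) <= g i * lnp (1 / g i).
Proof.
move=> i0 ij; have /andP[gi0 gi1] := gin i i0.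
have /andP[gj0 _] := gin j (leq_trans i0 ij).
by apply: xlnp_mono => //; exact: g_anti.
Qed.

(** By monotonicity of [g lnp (1 / g)] the entropy is at least d times its last term. With the
    accuracy fixed at 1/4 the hypothesis makes the entropy [o(d^t)], and dividing by [d^t] gives the
    limit. *)
Lemma stWT_cvg Lam c (s t : R) : 0 < t -> ALG_stWT g r Lam c s t ->
  (fun j : nat => j%:R `^ (1 - t) * g j * lnp (1 / g j)) @ \oo --> (0 : R).
Proof.
move=> t0 /stWTP H; apply/cvgrPdist_le => e e0.
pose e1 := e / 72; have e10 : 0 < e1 by rewrite divr_gt0.
have [M HM] := H e1 e10.
have [M1 M10 H1] := lnp_sqr_small t e1 t0 e10.
have [N1 [_ HN1 _]] := nat_upper `|M| (normr_ge0 M).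
have [N2 HN2] := powR_nat_large t ((M1 + 1 + e1 * 4 `^ s) / e1) t0.
exists (maxn 1 (maxn N1 N2)) => // d /=; rewrite !geq_max => /andP[d0 /andP[dN1 dN2]].
have dr0 : 0 < d%:R :> R by rewrite ltr0n.
have /andP[gd0 gd1] := gin d d0.
have D0 : 0 < d%:R `^ t :> R by exact: powR_gt0.
have big : M1 + 1 + e1 * 4 `^ s <= e1 * d%:R `^ t.
  by rewrite [leRHS]mulrC -ler_pdivrMr//; exact: HN2.
have Ed : entropy d <= 18 * (lnp d%:R + 1 + e1 * (4 `^ s + d%:R `^ t)).
  have -> : e1 * (4 `^ s + d%:R `^ t) = ln (expR (e1 * (4 `^ s + d%:R `^ t))) by rewrite expRK.
  apply: (entropy_le Lam c) => //.
    by rewrite -[leLHS]expR0 ler_expR mulr_ge0 ?(ltW e10)// addr_ge0 ?powR_ge0.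
  have e401 : 0 < (1 / 4 : R) < 1 by lra.
  have := HM d (1 / 4) d0 e401; rewrite div1r invrK; apply.
  have h1 : M <= N1%:R by apply: le_trans HN1; exact: ler_norm.
  have h2 : N1%:R <= d%:R :> R by rewrite ler_nat.
  lra.
have L1 := lnp_ge1 (d%:R : R); have L2 := H1 d d0.
have LL : lnp d%:R <= lnp (d%:R : R) ^+ 2 by rewrite expr2 ler_peMr//; lra.
have Ed' : entropy d <= e * d%:R `^ t.
  have -> : e = 72 * e1 by rewrite /e1; field.
  have := mulr_ge0 (ltW e10) (ltW D0); move: Ed big L2 LL; rewrite [e1 * (_ + _)]mulrDr -[72 * e1 * _]mulrA.
  move: (lnp d%:R) (e1 * d%:R `^ t) (e1 * 4 `^ s) (entropy d) (lnp d%:R ^+ 2) => *; lra.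
have dg : d%:R * (g d * lnp (1 / g d)) <= entropy d.
  have -> : d%:R * (g d * lnp (1 / g d)) = \sum_(k < d) g d * lnp (1 / g d).
    by rewrite sumr_const card_ord mulr_natl.
  by apply: ler_sum => k _; exact: g_lnp_mono.
rewrite sub0r normrN ger0_norm; last first.
  by rewrite !mulr_ge0 ?powR_ge0 ?(ltW gd0)// (le_trans _ (lnp_ge1 _)).
have -> : d%:R `^ (1 - t) * g d * lnp (1 / g d) = d%:R * (g d * lnp (1 / g d)) / d%:R `^ t.
  by rewrite powRB ?(gt_eqF dr0) ?implybT// powRr1 ?(ltW dr0)//; ring.
by rewrite ler_pdivrMr// (le_trans dg).
Qed.

Lemma stWT_cvg_g Lam c (s : R) : ALG_stWT g r Lam c s 1 -> g @ \oo --> (0 : R).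
Proof.
move=> /(stWT_cvg _ _ _ _ ltr01) /cvgrPdist_le H; apply/cvgrPdist_le => e e0.
have [N _ HN] := H e e0; exists (maxn 1 N) => // j /=; rewrite geq_max => /andP[j0 jN].
have /andP[gj0 _] := gin j j0.
have := HN j jN; rewrite /= subrr powRr0 mul1r !sub0r !normrN.
rewrite !ger0_norm ?mulr_ge0 ?(ltW gj0)//; last exact: le_trans (lnp_ge1 _).
by apply: le_trans; rewrite ler_peMr ?(ltW gj0)// lnp_ge1.
Qed.

(* With [sigma_d = s1 / K_d] in the complexity bound, the mixed term
   [K_d ln (1 / eps)] splits as [K_d ^+ 2 + ln (1 / eps) ^+ 2]. *)
Lemma stWT_sufficient (s1 C : R) Lam (s t : R) (K : nat -> R) :
  0 < s1 -> 0 < C -> 0 < s -> 0 < t ->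
  (forall Lam s d eps, 0 < s -> s <= s1 -> 0 < eps < 1 ->
    (ncomp g r Lam ABS eps d <=
    (expR (C / s * (1 + ln eps^-1 + \sum_(k < d) g k.+1 `^ (1 - s))))%:E)%E) ->
  (forall d, 1 <= K d) ->
  (forall e, 0 < e -> exists M, forall d, (0 < d)%N ->
    K d ^+ 2 <= e * d%:R `^ t + M) ->
  (forall e, 0 < e -> exists M, forall d, (0 < d)%N ->
    K d * (\sum_(k < d) g k.+1 `^ (1 - s1 / K d)) <= e * d%:R `^ t + M) ->
  ALG_stWT g r Lam ABS s t.
Proof.
move=> s10 C0 s0 t0 up K1 hK hG; apply/stWTP => eta eta0.
pose C' := C / s1; have C'0 : 0 < C' by rewrite divr_gt0.
pose A (x : R) := C' * ln x ^+ 2.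
pose V d := C' * (2 * K d ^+ 2 + K d * (\sum_(k < d) g k.+1 `^ (1 - s1 / K d))).
have hA e : 0 < e -> exists M, forall x, 1 <= x -> A x <= e * x `^ s + M.
  move=> e0; have [M _ HM] := ln_sqr_small s (e / C') s0 (divr_gt0 e0 C'0).
  exists (C' * M) => x x1.
  have -> : e * x `^ s + C' * M = C' * (e / C' * x `^ s + M) by field; rewrite gt_eqF.
  by rewrite ler_wpM2l ?(ltW C'0)//; exact: HM.
have hV e : 0 < e -> exists M, forall d, (0 < d)%N -> V d <= e * d%:R `^ t + M.
  move=> e0; have e30 : 0 < e / (3 * C') by rewrite divr_gt0// mulr_gt0.
  have [M1 H1] := hK _ e30; have [M2 H2] := hG _ e30.
  exists (C' * (2 * M1 + M2)) => d d0; have h1 := H1 d d0; have h2 := H2 d d0.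
  rewrite /V (_ : e * _ + _ = C' * (2 * (e / (3 * C') * d%:R `^ t + M1) +
    (e / (3 * C') * d%:R `^ t + M2))); last by field; rewrite gt_eqF.
  by rewrite ler_wpM2l ?(ltW C'0)// lerD// ler_wpM2l.
have [M HM] := two_scale_bound s t A V s0 t0 hA hV eta eta0.
exists M => d eps d0 e01 Md; have /andP[e0 e1] := e01.
have x1 : 1 <= eps^-1 by rewrite invf_ge1// ltW.
have Kd0 : 0 < K d by exact: lt_le_trans (K1 d).
have sK : s1 / K d <= s1 by rewrite ler_pdivrMr// ler_peMr// ltW.
have sK0 : 0 < s1 / K d by rewrite divr_gt0.
apply: (le_trans (up Lam _ d eps sK0 sK e01)); rewrite lee_fin ler_expR.
apply: le_trans (HM _ d x1 d0 Md); rewrite /V /A.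
set l := ln eps^-1; set G := \sum_(k < d) _.
have -> : C / (s1 / K d) = C' * K d by rewrite /C'; field; rewrite !gt_eqF.
rewrite -mulrA -mulrDr ler_wpM2l ?(ltW C'0)//.
have := K1 d; have := sqr_ge0 (K d - l); move: (K d) => k h k1.
rewrite !mulrDr mulr1; have : k <= k ^+ 2 by rewrite expr2 ler_peMr//; lra.
have := sqr_ge0 l; lra.
Qed.

(** A fixed exponent suffices here: [g^(1 - s1)] still tends to 0, hence so do its Cesaro means. *)
Lemma cvg_g_stWT Lam c (s : R) : 0 < s -> g @ \oo --> (0 : R) ->
  ALG_stWT g r Lam c s 1.
Proof.
move=> s0 cg; apply: stWT_from_ABS.
have [s1 [C [s10 s14 C0 up]]] := ncomp_ABS_upper g1_le1 g_noninc g_gt0 r1_gt r_nondec.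
apply: (stWT_sufficient s1 C Lam s 1 (fun=> 1)) => //.
  by move=> e e0; exists 1 => d d0; rewrite expr1n lerDr mulr_ge0 ?powR_ge0 ?(ltW e0).
move=> e e0; have p0 : 0 < 1 - s1 by lra.
have cu : (fun k => g k.+1 `^ (1 - s1)) @ \oo --> (0 : R).
  apply/cvgrPdist_le => z z0; have z'0 : 0 < z `^ (1 - s1)^-1 by exact: powR_gt0.
  have zK : (z `^ (1 - s1)^-1) `^ (1 - s1) = z by rewrite -powRrM mulVf ?gt_eqF// powRr1 ?ltW.
  have /cvgrPdist_le/(_ _ z'0)[N _ HN] := cg; exists N => // j /= Nj.
  have := HN j.+1 (leqW Nj); rewrite /= !sub0r !normrN.
  have /andP[g0 _] := gin j.+1 isT.
  rewrite !ger0_norm ?powR_ge0 ?(ltW g0)// => h.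
  by rewrite -zK ge0_ler_powR ?nnegrE ?powR_ge0 ?(ltW p0) ?(ltW g0).
have [M HM] := cesaro_small _ (fun k => powR_ge0 _ _) cu e e0.
by exists M => d d0; rewrite divr1 mul1r powRr1.
Qed.

Lemma stWT_gt1 Lam c (s t : R) : 0 < s -> 1 < t -> ALG_stWT g r Lam c s t.
Proof.
move=> s0 t1; apply: stWT_from_ABS; have t0 : 0 < t by lra.
have [s1 [C [s10 s14 C0 up]]] := ncomp_ABS_upper g1_le1 g_noninc g_gt0 r1_gt r_nondec.
apply: (stWT_sufficient s1 C Lam s t (fun=> 1)) => //.
  by move=> e e0; exists 1 => d d0; rewrite expr1n lerDr mulr_ge0 ?powR_ge0 ?(ltW e0).
move=> e e0; have t10 : 0 < t - 1 by lra.
have [N HN] := powR_nat_large (t - 1) e^-1 t10.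
exists N%:R => d d0; rewrite divr1 mul1r.
apply: (@le_trans _ _ d%:R).
  rewrite -[d in leRHS]card_ord -sum1_card natr_sum; apply: ler_sum => k _.
  have /andP[g0 g1] := gin k.+1 isT.
  by rewrite powR_lnE// -[leRHS]expR0 ler_expR mulr_ge0_le0 ?ln_le0//; lra.
have dr0 : 0 < d%:R :> R by rewrite ltr0n.
have [Nd|dN] := leqP N d; last first.
  by rewrite -[leLHS]add0r lerD ?mulr_ge0 ?powR_ge0 ?(ltW e0)// ler_nat ltnW.
apply: (@le_trans _ _ (e * d%:R `^ t)); last by rewrite lerDl.
have -> : d%:R `^ t = d%:R `^ (t - 1) * d%:R :> R.
  by rewrite -[X in _ * X]powRr1 ?(ltW dr0)// -powRD ?subrK// (gt_eqF dr0) implybT.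
rewrite mulrA ler_peMl ?(ltW dr0)//.
by have := ler_wpM2l (ltW e0) (HN d Nd); rewrite mulfV// gt_eqF.
Qed.

End Tractability.

(** * Weak tractability with t < 1 and uniform weak tractability *)

Section WeakTractability.
Context {R : realType} {g r : nat -> R}.
Hypothesis g1_le1 : g 1%N <= 1.
Hypothesis g_noninc : forall j : nat, (0 < j)%N -> g j.+1 <= g j.
Hypothesis g_gt0 : forall j : nat, (0 < j)%N -> 0 < g j.
Hypothesis r1_gt : 1 / 2 < r 1%N.
Hypothesis r_nondec : forall j : nat, (0 < j)%N -> r j <= r j.+1.

Let gin := g_in01 g1_le1 g_noninc g_gt0.
Let weight_decay (t : R) :=
  (fun j : nat => j%:R `^ (1 - t) * g j * lnp (1 / g j)) @ \oo --> (0 : R).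

Lemma cvg_weightP (t : R) : weight_decay t <->
  forall e, 0 < e -> exists N, forall j, (N <= j)%N -> (0 < j)%N ->
    g j * lnp (1 / g j) <= e * j%:R `^ (t - 1).
Proof.
have E j e : (0 < j)%N -> (`|0 - j%:R `^ (1 - t) * g j * lnp (1 / g j)| <= e) =
    (g j * lnp (1 / g j) <= e * j%:R `^ (t - 1)).
  move=> j0; have /andP[g0 _] := gin j j0.
  have P : 0 < j%:R `^ (t - 1) :> R by rewrite powR_gt0// ltr0n.
  have Q : 0 <= g j * lnp (1 / g j) by rewrite mulr_ge0 ?(ltW g0)// (le_trans _ (lnp_ge1 _)).
  rewrite sub0r normrN (_ : _ * lnp _ = (g j * lnp (1 / g j)) / j%:R `^ (t - 1)).
    by rewrite ger0_norm ?ler_pdivrMr// divr_ge0// ltW.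
  by rewrite -powRN opprB; ring.
split=> [/cvgrPdist_le H e e0|H].
  have [N _ HN] := H e e0; exists N => j Nj j0; have := HN j Nj.
  by rewrite /= E.
apply/cvgrPdist_le => e e0; have [N HN] := H e e0.
exists (maxn 1 N) => // j /=; rewrite geq_max => /andP[j0 Nj].
by rewrite E//; exact: HN.
Qed.

Lemma sum_initial (L : R) (N d : nat) : 0 <= L ->
  \sum_(1 <= j < d.+1) (if (j < N)%N then L else 0) <= N%:R * L.
Proof.
move=> L0; apply: (@le_trans _ _ ((minn d N)%:R * L)); last first.
  by rewrite ler_wpM2r// ler_nat geq_minr.
elim: d => [|d ih]; first by rewrite big_geq// mulr_ge0.
rewrite big_nat_recr//= (le_trans (lerD ih (lexx _)))//; case: ltnP => dN; last first.
  by rewrite addr0 ler_wpM2r// ler_nat geq_minr.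
rewrite (minn_idPl (ltnW (ltnW dN))) -natr1; lra.
Qed.

Lemma ln_le_lnp_inv j (t : R) : (0 < j)%N -> g j <= j%:R `^ (t - 1) ->
  (1 - t) * ln j%:R <= ln (1 / g j).
Proof.
move=> j0; have /andP[g0 _] := gin j j0; have jr : 0 < j%:R :> R by rewrite ltr0n.
rewrite -ler_ln ?posrE ?powR_gt0// ln_powR div1r lnV ?posrE//; lra.
Qed.

(* The factor [lnp d] is split as [1 + ln j + ln (d / j)]; the first part is
   absorbed by [lnp (1 / g j)], which dominates [ln j], and the second is
   at most a small power of [d / j]. *)
Lemma lnp_sum_small (t : R) : 0 < t -> t < 1 -> weight_decay t ->
  forall e, 0 < e -> exists M, forall d, (0 < d)%N ->
    lnp d%:R * (\sum_(k < d) g k.+1) <= e * d%:R `^ t + M.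
Proof.
move=> t0 t1 /cvg_weightP H e e0.
pose a := t / 2; have a0 : 0 < a by rewrite /a; lra.
(* The two summands are the constants of the sums of [j^(t - 1)] and of [j^(t - a - 1)], where
   [t - a = a]. Scaling by [n] keeps both within [e / 2]; the other [e / 2] absorbs the indices
   below [N], each costing at most [L]. *)
pose K := 2 / (1 - t) * (2 / t) + a^-1 * (2 / a).
have u0 : 0 < 1 - t by lra.
have K0 : 0 < K by rewrite addr_gt0 ?mulr_gt0 ?divr_gt0 ?invr_gt0.
pose n := Num.min 1 (e / 2 / K).
have n0 : 0 < n by rewrite lt_min ltr01 !divr_gt0.
have n1 : n <= 1 by rewrite ge_min lexx.
have nK : n * K <= e / 2 by rewrite -ler_pdivlMr// ge_min lexx orbT.
have [N0 HN0] := H n n0; pose N := maxn 1 N0.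
have N1 : (0 < N)%N by rewrite leq_max.
have Nr : 0 < N%:R :> R by rewrite ltr0n.
have [M M0 HM] := lnp_sqr_small t (e / 2 / N%:R) t0 ltac:(by rewrite !divr_gt0).
exists (N%:R * M) => d d0; have L1 := lnp_ge1 (d%:R : R).
have dr : 0 < d%:R :> R by rewrite ltr0n.
set L := lnp d%:R in L1 *.
have term j : (1 <= j < d.+1)%N -> g j * L <=
   n * (2 / (1 - t)) * j%:R `^ (t - 1) + n / a * d%:R `^ a * j%:R `^ ((t - a) - 1)
   + (if (j < N)%N then L else 0).
  move=> /andP[j0 jd]; have /andP[g0 g1] := gin j j0.
  have jr : 0 < j%:R :> R by rewrite ltr0n.
  case: ltnP => jN.
    rewrite -[leLHS]add0r lerD// ?addr_ge0 ?mulr_ge0 ?powR_ge0 ?invr_ge0 ?(ltW n0)//;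
      try lra.
    by rewrite ler_piMl//; lra.
  rewrite addr0; have hj := HN0 j (leq_trans (leq_maxr _ _) jN) j0.
  have pj := powR_gt0 (t - 1) jr; set q := j%:R `^ (t - 1) in hj pj *.
  have lp1 := lnp_ge1 (1 / g j).
  have gq : g j <= n * q by apply: le_trans hj; rewrite ler_peMr// ltW.
  have gq1 : g j <= q by apply: (le_trans gq); rewrite ler_piMl// ltW.
  have ll : (1 - t) * ln j%:R <= lnp (1 / g j).
    by apply: le_trans (ln_le_lnp _); exact: ln_le_lnp_inv.
  have lj : 0 <= ln (j%:R : R) by rewrite ln_ge0// ler1n.
  have dj : ln (d%:R / j%:R) <= a^-1 * (d%:R / j%:R) `^ a.
    have pos : 0 < d%:R / j%:R :> R by rewrite divr_gt0.
    have := ln_le_sub1 ((d%:R / j%:R : R) `^ a) (powR_gt0 _ pos).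
    rewrite ln_powR => h; rewrite -ler_pdivrMl ?invr_gt0// invrK; lra.
  have ld : L <= 1 + ln j%:R + a^-1 * (d%:R / j%:R) `^ a.
    apply: (le_trans (lnp_le1D d d0)).
    rewrite -addrA lerD2l -lerBlDl; apply: le_trans dj.
    by rewrite lnM ?posrE ?invr_gt0// lnV ?posrE.
  apply: (le_trans (ler_wpM2l (ltW g0) ld)); rewrite mulrDr; apply: lerD.
    apply: (@le_trans _ _ (2 / (1 - t) * (g j * lnp (1 / g j)))); last first.
      rewrite (_ : n * _ * q = 2 / (1 - t) * (n * q)); last by ring.
      by rewrite ler_wpM2l// divr_ge0// ltW.
    rewrite mulrCA ler_wpM2l ?(ltW g0)// mulrAC ler_pdivlMr//.
    have : (1 - t) * 1 <= lnp (1 / g j) by lra.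
    lra.
  have -> : j%:R `^ (t - a - 1) = q * (j%:R `^ a)^-1.
    rewrite -powRN -powRD; last by rewrite (gt_eqF jr) implybT.
    congr powR; ring.
  have -> : (d%:R / j%:R) `^ a = d%:R `^ a * (j%:R `^ a)^-1 :> R.
    by rewrite powRM ?invr_ge0 ?(ltW jr) ?(ltW dr)// -powR_inv1 ?(ltW jr)// -powRrM mulN1r powRN.
  rewrite (_ : n / a * _ * _ = n * q * (a^-1 * (d%:R `^ a / j%:R `^ a))); last by ring.
  by rewrite ler_wpM2r// mulr_ge0 ?invr_ge0 ?(ltW a0)// divr_ge0 ?powR_ge0.
rewrite -sum_ord_shift mulrC mulr_suml; apply: (le_trans (ler_sum_nat term)).
rewrite !big_split /= -!mulr_sumr.
have ta : 0 < t - a by rewrite /a; lra.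
have s1 := sum_powR_le t d t0 (ltW t1).
have s2 := sum_powR_le (t - a) d ta ltac:(by rewrite /a; lra).
have s3 := sum_initial L N d ltac:(by rewrite (le_trans _ L1)).
have c1 : 0 <= n * (2 / (1 - t)) by rewrite mulr_ge0 ?divr_ge0// ltW.
have c2 : 0 <= n / a * d%:R `^ a by rewrite mulr_ge0 ?divr_ge0 ?powR_ge0// ltW.
have D0 := powR_ge0 (d%:R : R) t.
have T1 := ler_wpM2l c1 s1; have T2 := ler_wpM2l c2 s2.
have T2E : n / a * d%:R `^ a * (2 / (t - a) * d%:R `^ (t - a)) = n * (a^-1 * (2 / a)) * d%:R `^ t.
  rewrite (_ : t - a = a); last by rewrite /a; field.
  have -> : d%:R `^ t = d%:R `^ a * d%:R `^ a :> R.
    by rewrite -powRD ?(gt_eqF dr) ?implybT//; congr powR; rewrite /a; field.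
  ring.
rewrite T2E in T2; have T3 := ler_wpM2r D0 nK.
have T4 : N%:R * L <= e / 2 * d%:R `^ t + N%:R * M.
  have LL : L <= L ^+ 2 by rewrite expr2 ler_peMr//; lra.
  have := ler_wpM2l (ltW Nr) (le_trans LL (HM d d0)); rewrite mulrDr.
  by rewrite mulrA mulrCA mulfV ?mulr1 // gt_eqF.
have KE : n * K * d%:R `^ t = n * (2 / (1 - t)) * (2 / t * d%:R `^ t) + n * (a^-1 * (2 / a)) * d%:R `^ t.
  by rewrite /K; ring.
rewrite KE in T3; rewrite -/a.
move: T1 T2 T3 T4 s3; lra.
Qed.

(** With the exponent [s1 / lnp d], [powR_term_upper] replaces [g^(1 - s)] by [e g + 1 / d], so
    [lnp_sum_small] applies. *)
Lemma cvg_stWT Lam c (s t : R) : 0 < s -> 0 < t -> t < 1 -> weight_decay t ->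
  ALG_stWT g r Lam c s t.
Proof.
move=> s0 t0 t1 H; apply: stWT_from_ABS => //.
have [s1 [C [s10 s14 C0 up]]] := ncomp_ABS_upper g1_le1 g_noninc g_gt0 r1_gt r_nondec.
apply: (stWT_sufficient g_gt0 r1_gt r_nondec s1 C Lam s t (fun d => lnp d%:R)) => //.
- by move=> d; exact: lnp_ge1.
- by move=> e e0; have [M _ HM] := lnp_sqr_small t e t0 e0; exists M.
move=> e e0; have E0 := expR_gt0 (1 : R).
have [M1 H1] := lnp_sum_small t t0 t1 H (e / 2 / expR 1) ltac:(by rewrite !divr_gt0).
have [M2 _ H2] := lnp_sqr_small t (e / 2) t0 ltac:(by rewrite divr_gt0).
exists (expR 1 * M1 + M2) => d d0; have L1 := lnp_ge1 (d%:R : R).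
have L0 : 0 <= lnp (d%:R : R) by rewrite (le_trans _ L1).
have LL : lnp d%:R <= lnp (d%:R : R) ^+ 2 by rewrite expr2 ler_peMr.
have dr : 0 < d%:R :> R by rewrite ltr0n.
have S : \sum_(k < d) g k.+1 `^ (1 - s1 / lnp d%:R) <= expR 1 * (\sum_(k < d) g k.+1) + 1.
  apply: (@le_trans _ _ (\sum_(k < d) (expR 1 * g k.+1 + 1 / d%:R))).
    by apply: ler_sum => k _; apply: (powR_term_upper _ _ s1) => //; [exact: gin|rewrite s10].
  rewrite big_split /= -mulr_sumr sumr_const card_ord -[_ *+ d]mulr_natl.
  by rewrite div1r mulfV ?gt_eqF.
apply: (le_trans (ler_wpM2l L0 S)); rewrite mulrDr mulr1 mulrCA.
have := ler_wpM2l (ltW E0) (H1 d d0); rewrite mulrDr.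
rewrite (_ : expR 1 * (e / 2 / expR 1 * _) = e / 2 * d%:R `^ t); last by field; rewrite gt_eqF.
have := H2 d d0; move: LL; lra.
Qed.

(** The condition liminf >= 1 amounts to the decay conditions for all small t: decay with t gives
    [g j <= j^(t - 1)], so the ratio is at least [1 - t]; conversely a ratio above [1 - t/2] gives
    [g j <= j^(t/2 - 1)], and the spare power [j^(t/2)] absorbs the logarithm. *)
Lemma UWT_iff Lam c : ALG_UWT g r Lam c <->
  (1 <= limn_einf (fun j : nat => (ln (1 / g j) / ln j%:R)%:E))%E.
Proof.
have lnj j : (2 <= j)%N -> 0 < ln (j%:R : R) by move=> j2; rewrite ln_gt0// ltr1n.
split=> [H|H alpha beta a0 b0].
  apply/lee_addgt0Pr => e e0; pose t := Num.min e (1 / 2).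
  have t0 : 0 < t by rewrite lt_min e0 /=; lra.
  have te : t <= e by rewrite ge_min lexx.
  have t2 : t <= 1 / 2 by rewrite ge_min lexx orbT.
  suff h : ((1 - t)%:E <= limn_einf (fun j : nat => (ln (1 / g j) / ln j%:R)%:E))%E.
    apply: (@le_trans _ _ ((1 - t)%:E + t%:E)%E); first by rewrite -EFinD lee_fin; lra.
    by apply: leeD => //; rewrite lee_fin.
  have /cvg_weightP/(_ 1 ltr01)[N HN] := stWT_cvg g1_le1 g_noninc g_gt0 r1_gt r_nondec
    Lam c 1 t t0 (H 1 t ltr01 t0).
  apply: (limn_einf_ge _ _ (maxn 2 N)) => j; rewrite geq_max => /andP[j2 jN].
  have j0 : (0 < j)%N by apply: leq_trans j2.
  have /andP[g0 _] := gin j j0.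
  rewrite lee_fin ler_pdivlMr ?lnj//; apply: ln_le_lnp_inv => //.
  have := HN j jN j0; rewrite [1 * _ `^ _]mul1r => h; apply: le_trans h.
  by rewrite ler_peMr ?(ltW g0)// lnp_ge1.
pose t := Num.min beta (1 / 2).
have t0 : 0 < t by rewrite lt_min b0 /=; lra.
have tb : t <= beta by rewrite ge_min lexx.
have t2 : t <= 1 / 2 by rewrite ge_min lexx orbT.
apply: (stWT_mono g_gt0 r1_gt r_nondec Lam c alpha t) => //.
apply: cvg_stWT => //; first by lra.
have [N HN] : exists N, forall j, (N <= j)%N ->
    ((1 - t / 2)%:E < (ln (1 / g j) / ln j%:R)%:E)%E.
  by apply: lt_limn_einf; apply: lt_le_trans H; rewrite lte_fin; lra.
apply/cvg_weightP => e e0; pose b := t / 2; have b0' : 0 < b by rewrite divr_gt0.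
have [M _ HM] := lnp_sqr_small b (e / 2) b0' ltac:(by rewrite divr_gt0).
have [N2 HN2] := powR_nat_large b (M / (e / 2)) b0'.
exists (maxn 2 (maxn N N2)) => j; rewrite !geq_max => /andP[j2 /andP[jN jN2]] j0.
have /andP[g0 g1] := gin j j0; have jr : 0 < j%:R :> R by rewrite ltr0n.
have l0 := lnj j j2; have L1 := lnp_ge1 (j%:R : R).
pose x := j%:R `^ (b - 1) : R; have x0 : 0 < x by exact: powR_gt0.
have lx : ln (1 / x) = (1 - b) * ln j%:R.
  by rewrite div1r lnV ?posrE// /x ln_powR; ring.
have x1 : x <= 1.
  by rewrite /x powR_lnE// -[leRHS]expR0 ler_expR mulr_le0_ge0 ?(ltW l0)// /b; lra.
have gx : g j <= x.
  have := HN j jN; rewrite lte_fin ltr_pdivlMr// -/b -lx !div1r !lnV ?posrE// ltrN2.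
  by rewrite ltr_ln ?posrE// => /ltW.
apply: (le_trans (xlnp_mono _ _ g0 gx x1)).
have lp : lnp (1 / x) <= lnp j%:R.
  rewrite /lnp ge_max !le_max lexx /= lx; apply/orP; right.
  by rewrite ler_piMl ?(ltW l0)// /b; lra.
apply: (le_trans (ler_wpM2l (ltW x0) lp)).
have -> : j%:R `^ (t - 1) = x * j%:R `^ b :> R.
  by rewrite /x -powRD ?(gt_eqF jr) ?implybT//; congr powR; rewrite /b; field.
rewrite mulrCA ler_wpM2l ?(ltW x0)//.
have LL : lnp j%:R <= lnp (j%:R : R) ^+ 2 by rewrite expr2 ler_peMr//; lra.
apply: (le_trans LL); apply: (le_trans (HM j j0)).
have := HN2 j jN2; rewrite ler_pdivrMr ?divr_gt0//; lra.
Qed.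

End WeakTractability.

(** * Polynomial and quasi-polynomial tractability *)

(** Each of the m factors [d - i] of the falling factorial is at least [d / 2]. *)
Lemma bin_ge_expn (d m : nat) : (2 * m <= d)%N ->
  (d ^ m <= 2 ^ m * (m`! * 'C(d, m)))%N.
Proof.
move=> md; rewrite [(m`! * _)%N]mulnC bin_ffact ffact_prod.
rewrite -[in X in (X <= _)%N](card_ord m) -[in X in (_ <= X * _)%N](card_ord m) -!prod_nat_const.
rewrite -big_split /=; apply: leq_prod => i _; have := ltn_ord i; lia.
Qed.

Section StrongTractability.
Context {R : realType} {g r : nat -> R}.
Hypothesis g1_le1 : g 1%N <= 1.
Hypothesis g_noninc : forall j : nat, (0 < j)%N -> g j.+1 <= g j.
Hypothesis g_gt0 : forall j : nat, (0 < j)%N -> 0 < g j.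
Hypothesis r1_gt : 1 / 2 < r 1%N.
Hypothesis r_nondec : forall j : nat, (0 < j)%N -> r j <= r j.+1.

Let gin := g_in01 g1_le1 g_noninc g_gt0.
Let rgt := r_gt r1_gt r_nondec.
Let entropy (d : nat) : R := \sum_(k < d) g k.+1 * lnp (1 / g k.+1).
Let ratio (j : nat) : \bar R := (ln (1 / g j) / ln j%:R)%:E.

Let ln_nat_gt0 j : (2 <= j)%N -> 0 < ln (j%:R : R).
Proof. by move=> j2; rewrite ln_gt0// ltr1n. Qed.

(** For c strictly between 1 and the liminf, [s2 = (c - 1) / (2 c)] gives
    [c (1 - s) >= (c + 1) / 2 > 1], so [g^(1 - s)] is eventually below a summable power. *)
Lemma sum_powR_bounded : (1 < limn_einf ratio)%E -> exists s2 : R, 0 < s2 <= 1 / 2 /\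
  forall s, 0 < s -> s <= s2 -> exists K, forall d, \sum_(k < d) g k.+1 `^ (1 - s) <= K.
Proof.
move=> H; have [c c1 cL] : exists2 c : R, 1 < c & (c%:E < limn_einf ratio)%E.
  case: (limn_einf ratio) H => [l| |]//; rewrite ?lte_fin => l1.
    by exists ((1 + l) / 2); rewrite ?lte_fin; lra.
  by exists 2; rewrite ?ltry//; lra.
have [N HN] := lt_limn_einf _ _ cL; clear H cL; pose s2 := (c - 1) / (2 * c).
have s2E : c * s2 = (c - 1) / 2 by rewrite /s2; field; rewrite gt_eqF//; lra.
have s20 : 0 < s2 by rewrite /s2 divr_gt0; lra.
have s21 : s2 <= 1 / 2 by rewrite /s2 ler_pdivrMr; lra.
exists s2; split=> [|s s0 ss]; first by rewrite s20 s21.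
pose p := (c + 1) / 2; have p1 : 1 < p by rewrite /p; lra.
have cs : p <= c * (1 - s).
  have := ler_wpM2l (ltW (lt_trans ltr01 c1)) ss; rewrite s2E /p; lra.
pose M := maxn 2 N; exists (M%:R + p / (p - 1)) => d.
rewrite -(sum_ord_shift d (fun j => g j `^ (1 - s))); apply: le_trans (lerD (lexx _) (zsum_bound p d p1)).
have i1 := sum_initial (1 : R) M d ler01.
rewrite mulr1 in i1; apply: le_trans (lerD i1 (lexx _)).
rewrite /zsum -big_split /=; apply: ler_sum_nat => j /andP[j0 _].
have /andP[g0 g1] := gin j j0; have jr : 0 < j%:R :> R by rewrite ltr0n.
case: ltnP => jM.
  rewrite -[leLHS]addr0 lerD ?powR_ge0// powR_lnE// -[leRHS]expR0 ler_expR.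
  by rewrite mulr_ge0_le0 ?ln_le0//; lra.
move: jM; rewrite geq_max => /andP[j2 jN]; have l0 := ln_nat_gt0 j j2.
have := HN j jN; rewrite lte_fin ltr_pdivlMr// div1r lnV ?posrE// => h.
rewrite add0r !powR_lnE// ler_expR.
have s1 : 0 <= 1 - s by lra.
have := ler_wpM2l s1 (ltW h); have := ler_wpM2r (ltW l0) cs; lra.
Qed.

Lemma SPT_of_liminf Lam c : (1 < limn_einf ratio)%E -> ALG_SPT g r Lam c.
Proof.
move=> /sum_powR_bounded[s2 [/andP[s20 s21] HS]].
have [s1 [C [s10 s14 C0 up]]] := ncomp_ABS_upper g1_le1 g_noninc g_gt0 r1_gt r_nondec.
pose s := Num.min s1 s2; have s0 : 0 < s by rewrite lt_min s10 s20.
have ss1 : s <= s1 by rewrite ge_min lexx.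
have [K HK] := HS s s0 ltac:(by rewrite ge_min lexx orbT).
exists (expR (C / s * (1 + K))), (C / s) => d eps d0 e01; have /andP[e0 e1] := e01.
apply: (le_trans (ncomp_le_ABS g_gt0 r1_gt r_nondec Lam c eps d e0)).
apply: (le_trans (up Lam s d eps s0 ss1 e01)); rewrite lee_fin.
rewrite powR_lnE ?invr_gt0// -expRD ler_expR -mulrDr ler_wpM2l ?divr_ge0 ?(ltW s0) ?(ltW C0)//.
have := HK d; lra.
Qed.

Lemma PT_of_SPT Lam c : ALG_SPT g r Lam c -> ALG_PT g r Lam c.
Proof.
move=> [C [p H]]; exists C, p, 0 => d eps d0 e01.
by rewrite powRr0 mulr1; exact: H.
Qed.

Lemma PT_NOR_normal Lam c : ALG_PT g r Lam c -> exists C p q : R,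
  [/\ 1 <= C, 1 <= p, 0 <= q & forall d (eps : R), (0 < d)%N -> 0 < eps < 1 ->
   (ncomp g r Lam NOR eps d <= (C * d%:R `^ q * eps^-1 `^ p)%:E)%E].
Proof.
move=> [C [p [q H]]]; exists (Num.max 1 C), (Num.max 1 p), (Num.max 0 q).
split; rewrite ?le_max ?lexx// => d eps d0 e01; have /andP[e0 e1] := e01.
apply: (le_trans (ncomp_NOR_le g_gt0 r1_gt r_nondec Lam c eps d e0)).
apply: (le_trans (H d eps d0 e01)); rewrite lee_fin.
apply: (@le_trans _ _ (Num.max 1 C * d%:R `^ q * eps^-1 `^ p)).
  by rewrite -!mulrA ler_wpM2r ?mulr_ge0 ?powR_ge0// le_max lexx orbT.
have C0 : 0 <= Num.max 1 C by rewrite le_max ler01.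
apply: ler_pM; rewrite ?mulr_ge0 ?powR_ge0//.
  by rewrite ler_wpM2l// ler_powR ?ler1n// le_max lexx orbT.
by rewrite ler_powR ?invf_ge1 ?(ltW e1)// le_max lexx orbT.
Qed.

(** Polynomial tractability forces the entropy, hence the sum of the weights, to be O(ln d), so the
    initial error is polynomial in d. This converts the normalized accuracy into an absolute one in
    [liminf_of_PT]. *)
Lemma PT_eigsum Lam (C p q : R) : 1 <= C -> 1 <= p -> 0 <= q ->
  (forall d (eps : R), (0 < d)%N -> 0 < eps < 1 ->
   (ncomp g r Lam NOR eps d <= (C * d%:R `^ q * eps^-1 `^ p)%:E)%E) ->
  exists2 K, 0 < K & forall d, (0 < d)%N -> @eigsum R d g r <= expR (K * (1 + ln d%:R)).
Proof.
move=> C1 p1 q0 H; have [C0 C00 HC] := eigsum_le_expR g_gt0 r1_gt r_nondec.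
have lC : 0 <= ln C by exact: ln_ge0.
have l4 : 0 <= ln (4 : R) by rewrite ln_ge0// ler1n.
have pl4 : 0 <= p * ln 4 by rewrite mulr_ge0//; lra.
exists (C0 * (18 * (2 + ln C + q + p * ln 4))); first by rewrite !mulr_gt0//; lra.
move=> d d0; apply: (le_trans (HC d)); rewrite ler_expR -mulrA ler_wpM2l ?(ltW C00)//.
have dr : 0 < d%:R :> R by rewrite ltr0n.
have l0 : 0 <= ln (d%:R : R) by rewrite ln_ge0// ler1n.
apply: (@le_trans _ _ (entropy d)).
  apply: ler_sum => k _; have /andP[gk0 _] := gin k.+1 isT.
  by rewrite ler_peMr ?(ltW gk0)// lnp_ge1.
have e401 : 0 < (1 / 4 : R) < 1 by lra.
have C0' : 0 < C by lra.
have B1 : 1 <= C * d%:R `^ q * (1 / 4)^-1 `^ p.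
  rewrite div1r invrK !mulr_ege1//; first exact: powR_nat_ge1.
  by rewrite -[leLHS](@powRr0 _ 4) ler_powR//; lra.
have := entropy_le g1_le1 g_noninc g_gt0 r1_gt r_nondec Lam NOR _ d d0 B1 (H d _ d0 e401).
rewrite !lnM ?posrE ?mulr_gt0 ?powR_gt0 ?invr_gt0// !ln_powR div1r invrK => h.
apply: (le_trans h); rewrite -mulrA ler_wpM2l//.
have := @lnp_le1D R d d0; move: (lnp _) => L hL.
have a1 := mulr_ge0 lC l0; have a2 := mulr_ge0 pl4 l0.
have a3 := mulr_ge0 q0 l0; move: hL l0 a1 a2 a3 pl4 lC.
move: (p * ln 4) (ln C) (ln d%:R) => x y l hL l0 a1 a2 a3 x0 y0; lra.
Qed.

(* If [g d > d `^ - (1 + 1 / p)] for arbitrarily large [d], the lower bound by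
   [nth_err_draws] with [m] factors forces about [d ^ m] samples at an accuracy
   polynomial in [1 / d], whereas the assumed bound only has exponent
   [m / 2 + O(1)] in [d]. *)
Lemma liminf_of_PT Lam c : ALG_PT g r Lam c -> (1 < limn_einf ratio)%E.
Proof.
move=> /PT_NOR_normal[C [p [q [C1 p1 q0 H]]]].
have [K K0 HK] := PT_eigsum Lam C p q C1 p1 q0 H.
rewrite ltNge; apply/negP => L1.
have p0 : 0 < p by lra.
pose eta := p^-1; have eta0 : 0 < eta by rewrite invr_gt0.
have freq N : exists2 d, (N <= d)%N & ln (1 / g d) / ln d%:R < 1 + eta.
  apply: contrapT => no.
  have : ((1 + eta)%:E <= limn_einf ratio)%E.
    apply: (limn_einf_ge _ _ N) => d Nd; rewrite lee_fin leNgt; apply/negP => lt.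
    by apply: no; exists d.
  by move=> /le_trans /(_ L1); rewrite lee_fin; lra.
(* With [eta = 1 / p] the assumed bound at accuracy [exp (- w)] has degree [q + p K / 2 + m / 2] in
   d, which this choice of [m] makes at most [m - 1]. *)
have [m [m0 mlow _]] := nat_upper (2 * (q + p * K / 2) + 2)
  ltac:(by rewrite addr_ge0// mulr_ge0// addr_ge0// !mulr_ge0// ltW).
pose cm : R := (2 ^ m * m`!)%:R^-1.
have fm0 : (0 < 2 ^ m * m`!)%N by rewrite muln_gt0 expn_gt0 fact_gt0.
have cm0 : 0 < cm by rewrite invr_gt0 ltr0n.
have cm1 : cm <= 1 by rewrite invf_le1 ?ltr0n// ler1n.
pose k := - ln (cm / 4).
have k0 : 0 < k by rewrite oppr_gt0 ln_lt0// divr_gt0//=; lra.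
pose A := C * expR (p * (k + K) / 2).
have A0 : 0 < A by rewrite mulr_gt0 ?expR_gt0//; lra.
have [N [_ HN _]] := nat_upper (2 * (A + 1) / cm + 1) ltac:(by rewrite addr_ge0// divr_ge0 ?mulr_ge0 ?addr_ge0// ltW).
have [d] := freq (maxn N (maxn 2 (2 * m))).
rewrite !geq_max => /andP[dN /andP[d2 dm]].
have d0 : (0 < d)%N by exact: leq_trans d2.
have /andP[gd0 gd1] := gin d d0.
have dr : 0 < d%:R :> R by rewrite ltr0n.
have l0 := ln_nat_gt0 d d2.
rewrite ltr_pdivrMr// div1r lnV ?posrE// => gd.
pose l := ln (d%:R : R); pose b := expR (- (1 + eta) * l).
have b0 : 0 < b by exact: expR_gt0.
have bg : b <= g d by rewrite -[g d]lnK ?posrE// ler_expR /l; lra.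
(* Chosen so that the squared accuracy times the bound on the squared initial error is exactly half
   of the lower bound [cm (b d)^m] for the eigenvalue sum (see [epsE]). *)
pose w := (k + K + (K + eta * m%:R) * l) / 2.
have em0 : 0 <= eta * m%:R by rewrite mulr_ge0// ltW.
have w0 : 0 < w.
  have := mulr_ge0 (addr_ge0 (ltW K0) em0) (ltW l0); rewrite -/l /w; lra.
pose eps := expR (- w); have eps0 : 0 < eps by exact: expR_gt0.
have eps1 : eps < 1 by rewrite /eps -expR0 ltr_expR; lra.
have e01 : 0 < eps < 1 by rewrite eps0.
have [n [nH nB]] := ncomp_nat_witness _ _ _ _ _ (H d eps d0 e01).
have [e0 e0E /andP[e01' e0s]] := init_err_bounds g_gt0 rgt d.
have bgk (i : 'I_d) : b <= g i.+1.
  by apply: (le_trans bg); apply: (g_anti g_noninc).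
move: nH; rewrite /= e0E -EFinM => nH.
have ee0 : 0 <= eps * e0 by rewrite mulr_ge0 ?(ltW eps0)//; lra.
have draws := nth_err_draws g_gt0 rgt Lam d n m b (eps * e0) b0 (le_trans bg gd1) bgk ee0 nH.
have es : e0 ^+ 2 <= 2 * expR (K * (1 + l)).
  have E0 : 0 <= 2 * @eigsum R d g r.
    by have := eigsum_ge1 (d := d) g_gt0 rgt; lra.
  apply: (@le_trans _ _ (2 * @eigsum R d g r)); last by rewrite ler_wpM2l// HK.
  by rewrite -[leRHS]sqr_sqrtr// lerXn2r ?nnegrE ?sqrtr_ge0//; lra.
have dmE : d%:R ^+ m = expR (m%:R * l) :> R by rewrite -[d%:R]lnK ?posrE// -expRM_natl.
have bE : b ^+ m * d%:R ^+ m = expR (- eta * m%:R * l).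
  by rewrite dmE /b -expRM_natl -expRD; congr expR; ring.
have epsE : eps ^+ 2 * (2 * expR (K * (1 + l))) = cm / 2 * (b ^+ m * d%:R ^+ m).
  have -> : cm / 2 = 2 * expR (- k) by rewrite /k opprK lnK ?posrE ?divr_gt0//; field.
  rewrite bE /eps -expRM_natl mulrCA -expRD -mulrA -expRD; congr (_ * expR _).
  by rewrite /w; field.
have draws2 : b ^+ m * ('C(d, m)%:R - n%:R) <= b ^+ m * (cm / 2 * d%:R ^+ m).
  rewrite [leRHS]mulrCA -epsE; apply: (le_trans draws).
  by rewrite exprMn ler_wpM2l// exprn_ge0// ltW.
rewrite ler_pM2l ?exprn_gt0// in draws2.
have Cdm : cm * d%:R ^+ m <= 'C(d, m)%:R.
  rewrite mulrC ler_pdivrMr ?ltr0n// -natrX -natrM ler_nat mulnC -mulnA.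
  exact: bin_ge_expn.
have dm1 : 1 <= d%:R ^+ m.-1 :> R by rewrite exprn_ege1// ler1n.
have up : C * d%:R `^ q * eps^-1 `^ p <= A * d%:R ^+ m.-1.
  have -> : d%:R ^+ m.-1 = expR ((m%:R - 1) * l) :> R.
    rewrite -[d%:R]lnK ?posrE// -expRM_natl; congr expR.
    by rewrite -[m in RHS](prednK m0) -natr1 /l; ring.
  rewrite /eps -expRN opprK !powR_lnE ?expR_gt0// expRK /A -!mulrA -!expRD.
  rewrite ler_wpM2l ?(le_trans ler01)// ler_expR.
  have -> : q * ln d%:R + p * w = p * (k + K) / 2 + (q + p * K / 2 + m%:R / 2) * l.
    by rewrite /w /eta -/l; field; rewrite gt_eqF.
  rewrite -[p * (k + K) / 2]mulrA lerD2l ler_wpM2r ?(ltW l0)//; lra.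
have fin : cm * d%:R * d%:R ^+ m.-1 <= 2 * (A + 1) * d%:R ^+ m.-1.
  rewrite -mulrA -exprS prednK//.
  have := lerD nB up; move: Cdm draws2 dm1.
  move: ('C(d, m)%:R) (n%:R) (d%:R ^+ m) (d%:R ^+ m.-1) => x y u v *; lra.
rewrite ler_pM2r ?exprn_gt0// in fin.
have : d%:R <= 2 * (A + 1) / cm by rewrite ler_pdivlMr// mulrC.
have : N%:R <= d%:R :> R by rewrite ler_nat.
move: HN; lra.
Qed.

(** Necessity uses only accuracy 1/4, where the assumed bound makes the entropy O(lnp d); conversely
    such an entropy is dominated by the term [lnp d (1 + ln eps^-1)] of [ncomp_NOR_upper]. *)
Lemma QPT_iff Lam : ALG_QPT g r Lam NOR <->
  (ereal_sup [set ((lnp d%:R)^-1 * \sum_(1 <= j < d.+1) g j * lnp (1 / g j))%:E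
                 | d in [set d : nat | (0 < d)%N]] < +oo)%E.
Proof.
split=> [[C [t H]]|H].
  pose C' := Num.max 1 C; pose t' := Num.max 0 t.
  have C1 : 1 <= C' by rewrite le_max lexx.
  have t0 : 0 <= t' by rewrite le_max lexx.
  have C0 : 0 < C' by exact: lt_le_trans C1.
  have l4 : 0 <= ln (4 : R) by rewrite ln_ge0// ler1n.
  pose K := 18 * (2 + ln C' + 2 * t' * (1 + ln 4)).
  apply: (@le_lt_trans _ _ K%:E); last exact: ltry.
  apply: ge_ereal_sup => _ [d d0 <-]; rewrite lee_fin sum_ord_shift.
  have L1 := lnp_ge1 (d%:R : R); have L0 : 0 < lnp (d%:R : R) by exact: lt_le_trans L1.
  rewrite ler_pdivrMl// -/(entropy d).
  have l0 : 0 <= ln (d%:R : R) by rewrite ln_ge0// ler1n.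
  pose B := C' * expR (t' * (1 + ln d%:R) * (1 + ln 4)).
  have e401 : 0 < (1 / 4 : R) < 1 by lra.
  have p0 : 0 <= (1 + ln d%:R) * (1 + ln 4) :> R by rewrite mulr_ge0// addr_ge0.
  have B1 : 1 <= B.
    rewrite /B mulr_ege1// -[leLHS]expR0 ler_expR -mulrA.
    exact: mulr_ge0.
  have nB : (ncomp g r Lam NOR (1 / 4) d <= B%:E)%E.
    apply: (le_trans (H d _ d0 e401)); rewrite lee_fin div1r invrK.
    apply: (@le_trans _ _ (C' * expR (t * (1 + ln d%:R) * (1 + ln 4)))).
      by rewrite ler_wpM2r ?expR_ge0// le_max lexx orbT.
    by rewrite ler_wpM2l ?(ltW C0)// ler_expR -!mulrA ler_wpM2r// le_max lexx orbT.
  have := entropy_le g1_le1 g_noninc g_gt0 r1_gt r_nondec Lam NOR B d d0 B1 nB.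
  rewrite /B lnM ?posrE ?expR_gt0// expRK => h; apply: (le_trans h).
  rewrite [leRHS]mulrC /K -[_ * lnp _]mulrA ler_wpM2l//.
  have lL : 1 + ln d%:R <= 2 * lnp (d%:R : R) by have := ln_le_lnp (d%:R : R); lra.
  have q0 : 0 <= t' * (1 + ln 4) by rewrite mulr_ge0// addr_ge0.
  have := ler_wpM2l q0 lL; have lC : 0 <= ln C' by exact: ln_ge0.
  have := ler_peMr lC L1; rewrite !mulrDl; lra.
have [K K0 HK] : exists2 K : R, 0 <= K & forall d, (0 < d)%N -> entropy d <= K * lnp d%:R.
  move: H; set S := ereal_sup _ => SH.
  have SP d : (0 < d)%N -> (((lnp d%:R)^-1 * entropy d)%:E <= S)%E.
    by move=> d0; apply: ereal_sup_ubound; exists d => //; rewrite sum_ord_shift.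
  exists (Num.max 0 (fine S)); first by rewrite le_max lexx.
  move=> d d0; have L0 : 0 < lnp (d%:R : R) by exact: lt_le_trans (lnp_ge1 _).
  rewrite mulrC -ler_pdivrMl//; have := SP d d0.
  have Sf : S \is a fin_num by rewrite fin_numElt SH andbT (lt_le_trans _ (SP 1%N isT))// ltNyr.
  by rewrite -(fineK Sf) lee_fin le_max => ->; rewrite orbT.
have [C [C0 HC]] := ncomp_NOR_upper g1_le1 g_noninc g_gt0 r1_gt r_nondec.
exists 1, (C * (1 + K)) => d eps d0 e01; have /andP[e0 e1] := e01.
apply: (le_trans (HC Lam d eps d0 e01)); rewrite mul1r lee_fin ler_expR.
rewrite -!mulrA ler_wpM2l ?(ltW C0)//.
have l0 : 0 <= ln eps^-1 by rewrite ln_ge0// invf_ge1// ltW.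
have L1 := lnp_ge1 (d%:R : R).
apply: (@le_trans _ _ ((1 + K) * (lnp d%:R * (1 + ln eps^-1)))).
  rewrite [leRHS]mulrDl mul1r lerD2l (le_trans (HK d d0))// ler_wpM2l//.
  by rewrite ler_peMr//; lra.
rewrite ler_wpM2l ?addr_ge0// ler_wpM2r ?addr_ge0//; exact: lnp_le1D.
Qed.

End StrongTractability.

Theorem theorem5p2 (R : realType) (g r : nat -> R)
  (hg1 : g 1%N <= 1)
  (hgmon : forall j : nat, (0 < j)%N -> g j.+1 <= g j)
  (hgpos : forall j : nat, (0 < j)%N -> 0 < g j)
  (hr1 : 1 / 2 < r 1%N)
  (hrmon : forall j : nat, (0 < j)%N -> r j <= r j.+1) :
  forall Lam : info_class,
  (* 1 *)
  (forall c : criterion,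
     (ALG_SPT g r Lam c <-> ALG_PT g r Lam c) /\
     (ALG_PT g r Lam c <->
        (1 < limn_einf (fun j : nat => (ln (1 / g j) / ln j%:R)%:E))%E)) /\
  (* 2 *)
  (ALG_QPT g r Lam NOR <->
     (ereal_sup [set ((lnp d%:R)^-1 * \sum_(1 <= j < d.+1) g j * lnp (1 / g j))%:E
                 | d in [set d : nat | (0 < d)%N]] < +oo)%E) /\
  (* 4 *)
  (forall c : criterion,
     ALG_UWT g r Lam c <->
        (1 <= limn_einf (fun j : nat => (ln (1 / g j) / ln j%:R)%:E))%E) /\
  (* 5 *)
  (forall (c : criterion) (s t : R), 0 < s -> 1 < t -> ALG_stWT g r Lam c s t) /\
  (* 6 *)
  (forall (c : criterion) (s : R), 0 < s ->
     (ALG_stWT g r Lam c s 1 <-> ALG_WT g r Lam c) /\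
     (ALG_WT g r Lam c <-> g @ \oo --> (0 : R))) /\
  (* 7 *)
  (forall (c : criterion) (s t : R), 0 < s -> 0 < t -> t < 1 ->
     (ALG_stWT g r Lam c s t <->
        (fun j : nat => j%:R `^ (1 - t) * g j * lnp (1 / g j)) @ \oo --> (0 : R))).
Proof.
move=> Lam; split; [move=> c; split|split; [|split; [|split; [|split]]]].
- split; first exact: PT_of_SPT.
  by move=> /(liminf_of_PT hg1 hgmon hgpos hr1 hrmon); exact: SPT_of_liminf.
- split; first exact: liminf_of_PT.
  by move=> L; apply: PT_of_SPT; exact: SPT_of_liminf.
- exact: QPT_iff.
- by move=> c; exact: UWT_iff.
- by move=> c s t s0 t1; exact: stWT_gt1.
(* Both notions are equivalent to the weights tending to 0, which allows the exponent of [eps^-1] to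
   be changed. *)
- move=> c s s0; split; split.
  + by move=> /(stWT_cvg_g hg1 hgmon hgpos hr1 hrmon) cg; exact: cvg_g_stWT.
  + by move=> /(stWT_cvg_g hg1 hgmon hgpos hr1 hrmon) cg; exact: cvg_g_stWT.
  + exact: stWT_cvg_g.
  + by move=> cg; exact: cvg_g_stWT.
- move=> c s t s0 t0 t1; split; first exact: stWT_cvg.
  exact: cvg_stWT.
Qed.
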